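(* Let $\mathbf M$ be an SPCA model and let $k$ be an integer with $1\le k<\omega(\mathbf M)$. The following statements are equivalent. 1. $\mathbf M$ is equivalent to a $k$-multiplicative model. 2. Some $\gamma\in\mathbb N$ is a cycle twisting bound of $\mathbf S^k$. 3. Any two cycles $W$ and $W'$ of $\mathbf S^k$ with $\mathrm{ext}(W)\,\mathrm{ext}(W')<0$ have a vertex in common.
   Context: **PCA models.** All arcs are open arcs of a circle. A circle $C$ of length $|C|$ has a distinguished point $0$ and each point is identified with its clockwise distance from $0$, so points are compared as numbers in $[0,|C|)$. For points $s\ne t$, $(s,t)$ is the open arc going clockwise from $s$ to $t$; an arc $A=(s,t)$ has beginning point $s(A)=s$ and ending point $t(A)=t$, its extremes. $A<B$ means $s(A)<s(B)$. A proper circular-arc (PCA) model is a pair $\mathbf M=(C,\mathcal A)$ where $\mathcal A=\mathcal A(\mathbf M)$ is a finite family of arcs of $C$, none included in another and no two sharing an extreme. Its arcs are $A_0<\dots<A_{n-1}$; $A_0$ is the initial arc. $\mathbf M$ is PIG if no arc $A$ satisfies $0\in A\cup\{t(A)\}$; by convention, if the arcs of $\mathbf M$ do not cover $C$, then $0$ is placed so that $\mathbf M$ is PIG. $\mathbf M$ is strict PCA (SPCA) if it is not PIG. Two PCA models are equivalent if there is a bijection between their arcs under which the sequences of extremes, read clockwise starting at the beginning point of the initial arc, coincide. **Functions on arcs** (indices mod $n$). $L(A_i)=A_{i-1}$, $R(A_i)=A_{i+1}$. $F_r(A_i)$ is the last arc of the contiguous sequence $A_i,A_{i+1},\dots$ of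 arcs whose beginning points lie in $A_i\cup\{s(A_i)\}$; $F_l(A_i)$ is the first arc of the contiguous sequence $\dots,A_{i-1},A_i$ of arcs whose ending points lie in $A_i\cup\{t(A_i)\}$. $H_l(A_i)$ is the unique arc $A$ with $F_r(A)=A_i$ and $F_r(R(A))\ne A_i$; $H_r(A_i)$ is the unique arc $A$ with $F_l(A)=A_i$ and $F_l(L(A))\neq A_i$; each is $\bot$ if no such arc exists. $f^j$ denotes the $j$-th iterate of $f$ ($f^0$ is the identity, $\bot$ is mapped to $\bot$). **Powers.** For $j\ge 0$, $A^j=(s(A),\,s(F_r^j(A))+\varepsilon(x+1))$, where $x$ is the number of arcs $B\ne A$ with $F_r^j(B)=F_r^j(A)$ such that, walking clockwise from $s(B)$, $s(A)$ is met no later than $s(F_r^j(A))$ (the latter being met at once if $B=F_r^j(A)$), and $\varepsilon>0$ is so small that no extreme of $\mathbf M$ lies in $(s(F_r^j(A)),t(A^j)]$. $\mathbf M^j=(C,\{A^j: A\in\mathcal A\})$. $\omega(\mathbf M)$ is $n$ if $\mathbf M$ is PIG, and otherwise the minimum integer $\omega>1$ such that $A^\omega\subset A$ for some arc $A$. **Multiplicative models.** A UCA model is a PCA model all of whose arcs have the same length. A $(c,\ell+1)$-CA model is a UCA model whose circle has integer length $c$, whose arcs have integer length $\ell+1$, and whose extremes are integers. For such a model $\mathbf U$ and $i\ge0$, $i\times\mathbf U$ has the same circle and the arcs $(s(A),\,s(A)+i\ell+1 \bmod c)$. $\mathbf U$ is $k$-multiplicative when $i\times\mathbf U$ is a UCA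 model equivalent to $\mathbf U^i$ for every $0\le i\le k$. ''A $k$-multiplicative model'' means a $k$-multiplicative $(c,\ell+1)$-CA model for some $c,\ell$. **Synthetic graph.** A $1$-hollow is an edge $B\to A$ for arcs $A,B$ with $s(B)\in A$, $B=F_r(A)$ and $A=F_l(B)$. An $i$-nose ($i\ge 0$) is an edge $A\to B$ for arcs with $s(B)\notin A^i$ and $A=H_l^i(L(B))$. $\mathbf S_*^k=\mathbf S^k_*(\mathbf M)$ is the directed multigraph (loops allowed) with vertex set $\mathcal A(\mathbf M)$ whose edges are the $1$-hollows and the $i$-noses for $0\le i\le k$. An $i$-nose $A\to B$ is short if $i<k$ and ($H_l(A)\ne\bot$ or $H_r(B)\neq\bot$). $\mathbf S^k=\mathbf S^k(\mathbf M)$ is obtained from $\mathbf S_*^k$ by deleting the short noses. A nose $A\to B$ is internal if $A<B$, a hollow $A\to B$ is internal if $B<A$; other edges are external. For a walk $W$, $\mathrm{ext}(W)$ is its number of external hollows minus its number of external noses (with multiplicity). A circuit is a closed walk; a cycle is a circuit $v_0,\dots,v_j=v_0$ ($j\ge1$) with $v_0,\dots,v_{j-1}$ distinct. For a circuit $W$, $j\cdot W$ is $W$ traversed $j$ times. **Rows.** $\mathrm{row}(A)=0$ if $A$ is the initial arc; $\mathrm{row}(A)=\mathrm{row}(B)+1$ if $A=H_r(B)$ for some $B<A$; $\mathrm{row}(A)=\mathrm{row}(L(A))$ otherwise. An arc is rightmost if it is the greatest arc (w.r.t. $<$) of its row. A nose $A\to B$ is backward if it is internal and $A$ is rightmost.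 All other internal edges are forward. A walk is internal (forward) if all its edges are internal (forward). **Unrolling.** For $\lambda\in\mathbb N$, $\lambda\cdot\mathbf M$ is the PCA model on a circle of length $\lambda |C|$ that has, for each $A\in\mathcal A(\mathbf M)$ and $0\le i<\lambda$, an arc $A_{(i)}$, called a copy of $A$, with $s(A_{(i)})=s(A)+i|C|$ and $t(A_{(i)})=t(A)+|C|(i+\beta)\bmod \lambda|C|$, where $\beta=1$ if $s(A)>t(A)$ and $\beta=0$ otherwise. $\lambda\cdot\mathbf S^k=\mathbf S^k(\lambda\cdot\mathbf M)$ (rows, internal, forward, etc. are those of the model $\lambda\cdot\mathbf M$). A hollow (nose) $A'\to B'$ of $\lambda\cdot \mathbf S^k$ is a copy of the hollow (nose) $A\to B$ of $\mathbf S^k$ if $A'$ is a copy of $A$ and $B'$ is a copy of $B$; a walk of $\lambda\cdot\mathbf S^k$ is a copy of a walk $W$ of $\mathbf S^k$ if its $i$-th edge is a copy of the $i$-th edge of $W$ for all $i$. **Cycle twisting bounds.** $\gamma\in\mathbb N$ is a hollow (resp. nose) cycle twisting bound of $\mathbf S^k$ if for every cycle $W$ of $\mathbf S^k$ with $\mathrm{ext}(W)>0$ (resp. $\mathrm{ext}(W)<0$) and every $\lambda\ge\gamma$, no internal copy of $\gamma\cdot W$ in $\lambda\cdot\mathbf S^k$ is forward. $\gamma$ is a cycle twisting bound if it is a nose or a hollow cycle twisting bound. *)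

(* Defs.v *)
From HB Require Import structures.
From mathcomp Require Import all_boot all_order all_algebra.

Set Implicit Arguments.
Unset Strict Implicit.
Unset Printing Implicit Defensive.

Import Order.TTheory GRing.Theory Num.Theory.
Local Open Scope ring_scope.

(* A circle of length c, whose points are the elements of [0, c[ ; the ordered
   field R is arbitrary, the real circle being the instance of the reals. *)
Section Circle.
Variables (R : realFieldType) (c : R).
Implicit Types s t p q : R.

(* Clockwise distance from p to q. *)
Definition cw p q : R := if p <= q then q - p else q - p + c.

Definition in_arc s t p : bool := 0 < cw s p < cw s t.

Definition arc_sub s t s' t' : Prop :=
  forall p, 0 <= p < c -> in_arc s t p -> in_arc s' t' p.

(* Reduction modulo c of a p in [0, 2c[ ; it is only used on such p. *)
Definition wrap p : R := if p < c then p else p - c.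
End Circle.

(* The arcs are (beg i, fin i) for i : 'I_narcs.  [is_pca] requires that they
   are numbered by increasing beginning points, so that the index i stands for
   the arc A_i, the order A < B is the order of the indices, and L, R are the
   cyclic predecessor and successor. *)
Record model (R : realFieldType) := Model {
  clen : R;
  narcs : nat;
  beg : 'I_narcs -> R;
  fin : 'I_narcs -> R
}.

Section Models.
Variable R : realFieldType.
Implicit Types M N U : model R.

Definition arc_of M := 'I_(narcs M).

(* (true, A) names the beginning point of A and (false, A) its ending point. *)
Definition extreme M := (bool * 'I_(narcs M))%type.

Definition pt M (e : extreme M) : R := if e.1 then beg e.2 else fin e.2.

Definition inA M (A : arc_of M) (p : R) : bool :=
  in_arc (clen M) (beg A) (fin A) p.

Definition is_pca M : Prop :=
  [/\ 0 < clen M,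
      forall e : extreme M, 0 <= pt e < clen M,
      forall A B : arc_of M, (A < B)%N -> beg A < beg B,
      injective (@pt M)
    & forall A B : arc_of M, A != B ->
        ~ arc_sub (clen M) (beg A) (fin A) (beg B) (fin B)].

Definition is_pig M : Prop :=
  forall A : arc_of M, ~ (inA A 0 \/ fin A = 0).

Definition covers M : Prop :=
  forall p, 0 <= p < clen M -> exists A : arc_of M, inA A p.

(* The middle conjunct is the convention on the position of the point 0. *)
Definition is_spca M : Prop :=
  [/\ is_pca M, ~ covers M -> is_pig M & ~ is_pig M].

Definition origin M : R := head 0 (codom (@beg _ M)).

Definition extreme_seq M : seq (extreme M) :=
  sort (fun e f => cw (clen M) (origin M) (pt e)
                   <= cw (clen M) (origin M) (pt f))
       (enum {: bool * 'I_(narcs M)}).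

Definition equivalent M N : Prop :=
  exists f : arc_of M -> arc_of N,
    bijective f /\
    [seq (e.1, f e.2) | e <- extreme_seq M] = extreme_seq N.

Definition Lf M (A : arc_of M) : arc_of M := ord_pred A.
Definition Rf M (A : arc_of M) : arc_of M := ordS A.

(* "Last" (resp. "first") means farthest clockwise from s(A) (resp. farthest
   anticlockwise from t(A)). *)
Definition Fr M (A : arc_of M) : arc_of M :=
  [arg max_(B > A | (B == A) || inA A (beg B))
     cw (clen M) (beg A) (beg B)]%O.

Definition Fl M (A : arc_of M) : arc_of M :=
  [arg max_(B > A | (B == A) || inA A (fin B))
     cw (clen M) (fin B) (fin A)]%O.

(* None is the undefined value bottom. *)
Definition Hl M (A : arc_of M) : option (arc_of M) :=
  [pick B : arc_of M | (Fr B == A) && (Fr (Rf B) != A)].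

Definition Hr M (A : arc_of M) : option (arc_of M) :=
  [pick B : arc_of M | (Fl B == A) && (Fl (Lf B) != A)].

Definition Frj M (j : nat) (A : arc_of M) : arc_of M := iter j (@Fr M) A.

Definition xnum M (j : nat) (A : arc_of M) : nat :=
  #|[set B : arc_of M | [&& B != A, Frj j B == Frj j A
      & cw (clen M) (beg B) (beg A)
        <= cw (clen M) (beg B) (beg (Frj j A))]]|.

Definition gap M : R :=
  \big[Num.min/clen M]_(e : extreme M * extreme M | pt e.1 != pt e.2)
     cw (clen M) (pt e.1) (pt e.2).

(* A fixed choice of the small positive epsilon, the same for all powers;
   [eps_gt0] and [eps_small] below show that it is small enough. *)
Definition eps M : R := gap M / (narcs M).+1%:R.

Definition power M (j : nat) : model R :=
  @Model R (clen M) (narcs M) (@beg _ M)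
    (fun A : arc_of M =>
       wrap (clen M) (beg (Frj j A) + eps M * (xnum j A).+1%:R)).

Definition inApow M (j : nat) (A : arc_of M) (p : R) : bool :=
  @inA (power M j) A p.

Definition pow_in_self M (j : nat) (A : arc_of M) : Prop :=
  arc_sub (clen M) (beg A) (@fin _ (power M j) A) (beg A) (fin A).

(* Stated as a relation: w is the value omega(M). *)
Definition is_omega M (w : nat) : Prop :=
  (is_pig M /\ w = narcs M) \/
  [/\ ~ is_pig M, (1 < w)%N,
      exists A : arc_of M, pow_in_self w A
    & forall w' : nat, (1 < w' < w)%N -> ~ exists A : arc_of M, pow_in_self w' A].

Definition arc_len M (A : arc_of M) : R := cw (clen M) (beg A) (fin A).

Definition is_uca M : Prop :=
  is_pca M /\ forall A B : arc_of M, arc_len A = arc_len B.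

Definition is_ca_model (c l : nat) U : Prop :=
  [/\ is_uca U, clen U = c%:R,
      forall A : arc_of U, arc_len A = l.+1%:R
    & forall e : extreme U, exists m : nat, pt e = m%:R].

(* The arcs are (s(A), s(A) + i * l + 1 mod c); as clen U = c and s(A) < c, one
   wrap is enough after the integer i * l + 1 has been reduced modulo c. *)
Definition times (c l i : nat) U : model R :=
  @Model R (clen U) (narcs U) (@beg _ U)
    (fun A : arc_of U => wrap (clen U) (beg A + ((i * l).+1 %% c)%:R)).

(* [is_uca (times c l i U)] does not ask for a particular position of the
   point 0, on which neither [is_pca] nor [equivalent] depends otherwise than
   through the choice of the initial arc. *)
Definition k_multiplicative (k : nat) U : Prop :=
  exists c l : nat, is_ca_model c l U /\
    forall i : nat, (i <= k)%N ->
      is_uca (times c l i U) /\ equivalent (times c l i U) (power U i).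

Inductive kind := Hollow | Nose of nat.

Record edge M := Edge { ekind : kind; esrc : arc_of M; etgt : arc_of M }.

(* The hollow B -> A. *)
Definition is_hollow M (B A : arc_of M) : bool :=
  [&& inA A (beg B), B == Fr A & A == Fl B].

Definition Hlj M (j : nat) (A : arc_of M) : option (arc_of M) :=
  iter j (obind (@Hl M)) (Some A).

(* The i-nose A -> B. *)
Definition is_nose M (i : nat) (A B : arc_of M) : bool :=
  ~~ inApow i A (beg B) && (Hlj i (Lf B) == Some A).

Definition is_short M (k i : nat) (A B : arc_of M) : bool :=
  (i < k)%N && ((Hl A != None) || (Hr B != None)).

Definition in_Sstar M (k : nat) (e : edge M) : bool :=
  match ekind e with
  | Hollow => is_hollow (esrc e) (etgt e)
  | Nose i => (i <= k)%N && is_nose i (esrc e) (etgt e)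
  end.

Definition in_S M (k : nat) (e : edge M) : bool :=
  in_Sstar k e &&
  match ekind e with
  | Hollow => true
  | Nose i => ~~ is_short k i (esrc e) (etgt e)
  end.

Definition is_nose_kind (x : kind) : bool :=
  if x is Nose _ then true else false.

Definition internal M (e : edge M) : bool :=
  if is_nose_kind (ekind e) then (esrc e < etgt e)%N else (etgt e < esrc e)%N.

(* Walks are sequences of edges: parallel edges have to be told apart. *)
Definition follows M (e f : edge M) : bool := etgt e == esrc f.

Definition is_walk M (k : nat) (W : seq (edge M)) : bool :=
  all (in_S k) W && sorted (@follows M) W.

Definition is_circuit M (k : nat) (W : seq (edge M)) : bool :=
  all (in_S k) W && path.cycle (@follows M) W.

Definition is_cycle M (k : nat) (W : seq (edge M)) : bool :=
  [&& is_circuit k W, (0 < size W)%N & uniq [seq esrc e | e <- W]].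

Definition ext M (W : seq (edge M)) : int :=
  (count (fun e => ~~ is_nose_kind (ekind e) && ~~ internal e) W)%:Z
  - (count (fun e => is_nose_kind (ekind e) && ~~ internal e) W)%:Z.

Definition repeat_walk M (j : nat) (W : seq (edge M)) : seq (edge M) :=
  flatten (nseq j W).

(* Row of A; the arcs used in the recursion have smaller indices than A, so
   that [A.+1] recursive calls suffice. *)
Fixpoint row_rec M (fuel : nat) (A : arc_of M) : nat :=
  if fuel is d.+1 then
    if A == 0%N :> nat then 0%N
    else if [pick B : arc_of M | (B < A)%N && (Hr B == Some A)] is Some B
         then (row_rec d B).+1
         else row_rec d (Lf A)
  else 0%N.

Definition arc_row M (A : arc_of M) : nat := row_rec A.+1 A.

Definition rightmost M (A : arc_of M) : bool :=
  [forall B : arc_of M, (arc_row B == arc_row A) ==> (B <= A)%N].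

Definition backward M (e : edge M) : bool :=
  [&& is_nose_kind (ekind e), internal e & rightmost (esrc e)].

Definition forward M (e : edge M) : bool := internal e && ~~ backward e.

Lemma base_subproof (lam n : nat) (a : 'I_(lam * n)) : (a %% n < n)%N.
Proof.
by rewrite ltn_mod lt0n; apply/eqP => n0; case: a => a /=; rewrite n0 muln0.
Qed.

(* The arc of index i * n + j of lam.M is the copy (A_j)_(i). *)
Definition copied_arc M (lam : nat) (a : 'I_(lam * narcs M)) : arc_of M :=
  Ordinal (base_subproof a).

Definition unroll (lam : nat) M : model R :=
  @Model R (lam%:R * clen M) (lam * narcs M)
    (fun a => beg (copied_arc a) + (a %/ narcs M)%:R * clen M)
    (fun a => wrap (lam%:R * clen M)
       (fin (copied_arc a)
        + clen M * (a %/ narcs M + (fin (copied_arc a) < beg (copied_arc a))%R)%:R)).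

(* As an edge of the unrolled graph, e' is a copy of e when both are hollows or
   both are noses, whatever their indices as noses. *)
Definition edge_copy (lam : nat) M (e' : edge (unroll lam M)) (e : edge M) :
    bool :=
  [&& is_nose_kind (ekind e') == is_nose_kind (ekind e),
      copied_arc (esrc e') == esrc e & copied_arc (etgt e') == etgt e].

Definition is_copy (lam : nat) M (k : nat)
    (W' : seq (edge (unroll lam M))) (W : seq (edge M)) : bool :=
  is_walk k W' && all2 (@edge_copy lam M) W' W.

Definition no_forward_copy M (k g : nat) (W : seq (edge M)) : Prop :=
  forall (lam : nat) (W' : seq (edge (unroll lam M))),
    (g <= lam)%N -> is_copy k W' (repeat_walk g W) ->
    all (@internal _) W' -> ~ all (@forward _) W'.

Definition hollow_ctb M (k g : nat) : Prop :=
  forall W : seq (edge M), is_cycle k W -> 0 < ext W -> no_forward_copy k g W.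

Definition nose_ctb M (k g : nat) : Prop :=
  forall W : seq (edge M), is_cycle k W -> ext W < 0 -> no_forward_copy k g W.

Definition is_ctb M (k g : nat) : Prop := nose_ctb M k g \/ hollow_ctb M k g.

Lemma cw_gt0 M (e f : extreme M) :
  is_pca M -> pt e != pt f -> 0 < cw (clen M) (pt e) (pt f).
Proof.
case=> _ range _ _ _ ne; rewrite /cw.
have /andP[e0 ec] := range e; have /andP[f0 fc] := range f.
have [ef|fe] := leP (pt e) (pt f); first by rewrite subr_gt0 lt_neqAle ne ef.
by rewrite addrAC subr_gt0 ltr_wpDl.
Qed.

Lemma eps_gt0 M : is_pca M -> 0 < eps M.
Proof.
move=> hM; rewrite /eps divr_gt0 ?ltr0n // /gap lt_bigmin //.
  by case: hM.
by move=> [e f] ne; apply: cw_gt0.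
Qed.

(* Walking clockwise from s(F), with F the j-th iterate of F_r at A, the point
   t(A^j) is met before every extreme of M other than s(F). *)
Lemma eps_small M (j : nat) (A : arc_of M) (e : extreme M) :
  is_pca M -> pt e != beg (Frj j A) ->
  eps M * (xnum j A).+1%:R < cw (clen M) (beg (Frj j A)) (pt e).
Proof.
move=> hM ne.
have gap_le : gap M <= cw (clen M) (beg (Frj j A)) (pt e).
  rewrite /gap (bigmin_le_cond _ (j := ((true, Frj j A) : extreme M, e))) //=.
  by rewrite eq_sym.
apply: lt_le_trans gap_le; rewrite /eps mulrAC ltr_pdivrMr ?ltr0n //.
have gap_gt0 : 0 < gap M.
  by have := eps_gt0 hM; rewrite /eps pmulr_lgt0 // invr_gt0 ltr0n.
rewrite ltr_pM2l // ltr_nat ltnS /xnum.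
apply: (leq_trans (n := #|[set~ A]|.+1)).
  by rewrite ltnS subset_leq_card //; apply/subsetP => B; rewrite !inE => /andP[].
by rewrite cardsC1 card_ord prednK ?(leq_ltn_trans (leq0n A)) ?ltn_ord.
Qed.
End Models.

(* Main.v *)
(* The arcs, unrolled along the universal cover of the circle, are numbered by
   the integers, and F_r becomes a nondecreasing map F with F (x + n) = F x + n,
   which determines the model up to equivalence and is the same for all the
   lambda.M.  An edge moves a vertex x placed in some column h to a later place
   in the cover; a hollow changes h by -1 and an i-nose by i, and a multiplicative
   model is a solution s of the difference constraints of the edges, the column
   weighing l and one turn c.
   1 => 2: along a forward walk the rows change exactly like the columns, so a
   long forward copy of a cycle has the average slope of the rows, and the
   solution s excludes this slope for the cycles of one sign of ext.
   2 => 3: two disjoint cycles of opposite signs lift to disjoint biinfinite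
   paths; by planarity their slopes are separated.  As rows grow with an
   eventually periodic slope, which bounds both, one of the cycles has precisely
   this slope, and its copies are forward when placed high enough.
   3 => 1: crossing cycles of opposite signs combine into a closed walk, so some
   ratio c : l makes all cycles of S^k nonpositive, and longest paths provide s.
   The constraints of the deleted short noses follow by accounting. *)
Require Import Defs.
From Stdlib Require Import Classical FunctionalExtensionality.
From mathcomp Require Import all_boot all_order all_algebra.
From mathcomp Require Import zify ring lra.
Set Implicit Arguments.
Unset Strict Implicit.
Unset Printing Implicit Defensive.
Import Order.TTheory GRing.Theory Num.Theory.
Local Open Scope ring_scope.

(** * Lifts of F_r and the order of places *)

(** Short noses shape the proof. The planarity argument needs them deleted, since an edge nested in
    the columns of a longer nose would let the sweep along two disjoint paths change sides; a
    potential, however, must satisfy their constraints too. These cannot be recovered one at a time: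
    each relies on gaps of width at least 2 whose own constraints may also be missing, so all gaps
    of one kind are settled together by a sum over a full turn. Planarity is expressed without
    topology. The total order [prec] imitates the order of the values s x - h * l for a solution s,
    but exists before any solution does. Of two overlapping edges of disjoint paths one starts in
    the higher column; the sweep preserves which, while the opposite drifts of the paths do not
    allow this for ever. The slope of the rows is the translation number of F, q turns in p
    iterates. The slack 2 of the nose constraints has two uses: it leaves room for an ending point
    strictly between two beginning points, and it decides 1 => 2 when c : l is exactly the slope p :
    q. *)

Record is_lift (n : nat) (F : int -> int) : Prop := IsLift {
  lift_mono : forall x y, x <= y -> F x <= F y;
  lift_shift : forall x, F (x + n%:Z) = F x + n%:Z;
  lift_gt : forall x, x < F x;
  lift_lt : forall x, F x < x + n%:Z
}.

(* H_l^i inverts F_r^i at x. *)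
Definition tightZ (F : int -> int) (i : nat) (x : int) : Prop :=
  forall j, (j < i)%N -> F (iter j F x) < F (iter j F x + 1).

Definition shortZ (F : int -> int) (k i : nat) (x y : int) : Prop :=
  (i < k)%N /\ ((exists z, F z = x) \/ F (y - 1) < F y).

(* Edges of S^k between lifted arcs: for a nose A -> B, L(B) = F_r^i(A). *)
Definition edgeZ (F : int -> int) (k : nat) (a : kind) (x y : int) : Prop :=
  match a with
  | Hollow => F y = x /\ F (y - 1) < x
  | Nose i => [/\ (i <= k)%N, tightZ F i x, y = iter i F x + 1
                & ~ shortZ F k i x y]
  end.

Definition level (a : kind) : int := if a is Nose i then i%:Z else -1.

(* The order of places (x, h), x being moved from column h to column h + d by
   the d-th iterate of F; the second case negates the first, with u and v exchanged. *)
Definition prec (F : int -> int) (u v : int * int) : Prop :=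
  (exists2 d : nat, v.2 = u.2 + d%:Z & iter d F u.1 < v.1) \/
  (exists2 d : nat, u.2 = v.2 + d.+1%:Z & u.1 <= iter d.+1 F v.1).

Section Lift.
Variables (n : nat) (F : int -> int).
Hypothesis hF : is_lift n F.

Lemma lift_pos : (0 < n)%N.
Proof. have := lift_gt hF 0; have := lift_lt hF 0; lia. Qed.

Lemma lift_homo x y : F x < F y -> x < y.
Proof. by rewrite !ltNge; apply: contra => /(lift_mono hF). Qed.

Lemma iter_mono i x y : x <= y -> iter i F x <= iter i F y.
Proof. by elim: i => //= i IH /IH/(lift_mono hF). Qed.

Lemma iter_homo i x y : iter i F x < iter i F y -> x < y.
Proof. by rewrite !ltNge; apply: contra => /(iter_mono i). Qed.

Lemma iter_ge i x : x + i%:Z <= iter i F x.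
Proof. by elim: i => [|i IH] /=; [|have := lift_gt hF (iter i F x)]; lia. Qed.

Lemma lift_shiftN x (m : nat) : F (x + m%:Z * n%:Z) = F x + m%:Z * n%:Z.
Proof.
elim: m => [|m IH]; first by rewrite mul0r !addr0.
have -> : x + m.+1%:Z * n%:Z = (x + m%:Z * n%:Z) + n%:Z by lia.
rewrite (lift_shift hF) IH; lia.
Qed.

Lemma lift_shiftZ x (m : int) : F (x + m * n%:Z) = F x + m * n%:Z.
Proof.
case: m => m; first exact: lift_shiftN.
rewrite NegzE mulNr; have := lift_shiftN (x - m.+1%:Z * n%:Z) m.+1.
by rewrite subrK => ->; rewrite addrK.
Qed.

Lemma iter_shift i x (m : int) : iter i F (x + m * n%:Z) = iter i F x + m * n%:Z.
Proof. by elim: i => //= i ->; rewrite lift_shiftZ. Qed.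

Lemma iterSE i x : iter i.+1 F x = iter i F (F x).
Proof. exact: iterSr. Qed.

(** By tightness F jumps right after each iterate of x, so by induction everything beyond x lands
    beyond [iter i F x]. *)
Lemma tight_last i x z :
  tightZ F i x -> iter i F z <= iter i F x -> z <= x.
Proof.
elim: i x z => [//|i IH] x z ht.
rewrite !iterSE => /IH h.
have {}h : F z <= F x by apply: h => j ji; have := ht j.+1; rewrite iterSE; apply.
have := ht 0%N isT => /= ht0; rewrite leNgt; apply/negP => xz.
have := lift_mono hF (_ : x + 1 <= z); lia.
Qed.

Lemma tight_iter i j x : tightZ F (i + j) x -> tightZ F i (iter j F x).
Proof. by move=> h m mi; rewrite -iterD; apply: h; lia. Qed.

Lemma prec_irr u : ~ prec F u u.
Proof.
by case=> [[d e]|[d e]]; [have := iter_ge d u.1; lia | lia].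
Qed.

Lemma prec_trans u v w : prec F u v -> prec F v w -> prec F u w.
Proof.
case: u v w => [x h] [y g] [z m] [[d /= -> h1]|[d /= -> h1]] [[d' /= e h2]|[d' /= e h2]].
- left; exists (d' + d)%N => /=; first lia.
  rewrite iterD; have := iter_mono d' (ltW h1); lia.
- have [dd|dd] := leqP d'.+1 d.
    left; exists (d - d'.+1)%N => /=; first lia.
    have h3 : iter d F x < iter d'.+1 F z := lt_le_trans h1 h2.
    move: h3.
    by rewrite -{1}(subnKC dd) iterD => /iter_homo.
  right; exists (d' - d)%N => /=; first lia.
  have h3 : iter d F x < iter d'.+1 F z := lt_le_trans h1 h2.
  move: h3.
  have -> : d'.+1 = (d + (d' - d).+1)%N by lia.
  by rewrite iterD => /iter_homo /ltW.
- have [dd|dd] := leqP d.+1 d'.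
    left; exists (d' - d.+1)%N => /=; first lia.
    have := iter_mono (d' - d.+1) (h1 : x <= iter d.+1 F y).
    rewrite -iterD subnK //; lia.
  right; exists (d - d')%N => /=; first lia.
  have {}h1 : x <= iter d.+1 F y := h1.
  move: h1; have -> : d.+1 = ((d - d').+1 + d')%N by lia.
  rewrite iterD; have := iter_mono (d - d').+1 (ltW h2); rewrite /=; lia.
- right; exists (d + d'.+1)%N => /=; first lia.
  have := iter_mono d.+1 (h2 : y <= iter d'.+1 F z).
  rewrite -iterD addSn; move: (h1 : x <= iter d.+1 F y) => {}h1; exact: le_trans.
Qed.

Lemma prec_total u v : u <> v -> prec F u v \/ prec F v u.
Proof.
case: u v => [x h] [y g] ne.
have [hg|gh|hg] := ltgtP h g.
- case: (ltP (iter (absz (g - h)%R) F x) y) => c; [left; left|right; right].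
    by exists (absz (g - h)%R) => //=; lia.
  exists (absz (g - h)%R).-1; rewrite prednK //=; lia.
- case: (ltP (iter (absz (h - g)%R) F y) x) => c; [right; left|left; right].
    by exists (absz (h - g)%R) => //=; lia.
  exists (absz (h - g)%R).-1; rewrite prednK //=; lia.
- have [xy|yx|xy] := ltgtP x y; last by case: ne; congr (_, _).
  + by left; left; exists 0%N; rewrite //= hg addr0.
  + by right; left; exists 0%N; rewrite //= hg addr0.
Qed.

Lemma edge_prec k a x y h : edgeZ F k a x y -> prec F (x, h) (y, h + level a).
Proof.
case: a => [|i] /=.
  by case=> e _; right; exists 0%N => /=; [lia | rewrite e].
by case=> _ _ -> _; left; exists i => //=; lia.
Qed.

(** An edge leaves no room: the tightness of a nose, and the minimality of y among the points mapped
    to x by F in a hollow x -> y, exclude every intermediate place in the columns from one end to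
    the other. *)
Lemma edge_between k a x y h u : edgeZ F k a x y ->
  prec F (x, h) u -> prec F u (y, h + level a) ->
  (u.2 < h /\ u.2 < h + level a) \/ (h < u.2 /\ h + level a < u.2).
Proof.
case: u => z m /=; case: a => [|i] /=.
  case=> e1 e2 [[[|d] /= e h1]|[[|d] /= e h1]] [[[|d'] /= e' h2]|[[|d'] /= e' h2]];
    try by [left; lia | right; lia | lia].
  have := lift_mono hF (_ : z <= y - 1); lia.
case=> _ ht -> _ h1 h2.
have [ |mh] := ltP m h; first by left; lia.
have [ |mhi] := ltP (h + i%:Z) m; first by right; lia.
have {h1} : iter (absz (m - h)%R) F x < z.
  case: h1 => [[d /= e h1]|[d /= e h1]]; last by lia.
  by have -> : (absz (m - h)%R) = d by lia.
have {h2} : iter (absz (h + i%:Z - m)%R) F z <= iter i F x.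
  case: h2 => [[d /= e h2]|[d /= e h2]]; last by lia.
  have -> : (absz (h + i%:Z - m)%R) = d by lia.
  lia.
have -> : i = ((absz (h + i%:Z - m)%R) + (absz (m - h)%R))%N by lia.
move: ht; have {1}-> : i = ((absz (h + i%:Z - m)%R) + (absz (m - h)%R))%N by lia.
move=> /tight_iter ht; rewrite iterD.
have -> : (h + ((absz (h + i%:Z - m)%R) + (absz (m - h)%R))%N%:Z - m) = h + i%:Z - m by lia.
move=> /(tight_last ht); lia.
Qed.

(* A nose nested in the columns of another edge would start in the image of F,
   hence be short. *)
Lemma edge_nested k a b x y z t h m :
  edgeZ F k a x y -> edgeZ F k b z t ->
  prec F (z, m) (x, h) -> prec F (y, h + level a) (t, m + level b) ->
  h < m -> h < m + level b -> m < h + level a -> m + level b < h + level a -> False.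
Proof.
case: a => [|i] /=; first by lia.
case=> ik ht -> _ hb p1 p2 l1 l2 l3 l4.
have {p1} p1 : z <= iter (absz (m - h)%R) F x.
  case: p1 => [[d /= e p1']|[d /= e p1']]; first by lia.
  by have -> : (absz (m - h)%R) = d.+1 by lia.
have {p2} p2 : iter i F x < iter (absz (h + i%:Z - (m + level b))%R) F t.
  case: p2 => [[d /= e p2']|[d /= e p2']]; first by lia.
  have -> : (absz (h + i%:Z - (m + level b))%R) = d.+1 by lia.
  move: p2' => /=; lia.
case: b hb l2 l3 l4 p2 => [|j] /= hb l2 l3 l4 p2.
  case: hb => e1 e2.
  have e3 : i = ((absz (h + i%:Z - (m + -1))%R) + (absz (m + -1 - h)%R))%N by lia.
  move: p2 (ht); rewrite {1}e3 iterD => /iter_homo p2 {}ht.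
  have := ht (absz (m + -1 - h)%R) ltac:(lia).
  have := lift_mono hF (_ : iter (absz (m + -1 - h)%R) F x + 1 <= t).
  move: p1; have -> : (absz (m - h)%R) = (absz (m + -1 - h)%R).+1 by lia.
  rewrite /=; lia.
case: hb => jk htz et ns.
have e3 : i = ((absz (h + i%:Z - (m + j%:Z))%R) + (j + (absz (m - h)%R)))%N by lia.
move: p2; rewrite {1}e3 iterD => /iter_homo; rewrite et iterD => p2.
have p3 : iter (absz (m - h)%R) F x <= z by apply: (tight_last htz); lia.
apply: ns; split; first lia.
left; exists (iter (absz (m - h)%R).-1 F x); rewrite -iterS prednK; lia.
Qed.

Section Cross.
Variables (k : nat) (a b : kind) (u v p q : int * int).
Hypotheses (hE : edgeZ F k a u.1 v.1) (hu : v.2 = u.2 + level a).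
Hypotheses (hE' : edgeZ F k b p.1 q.1) (hp : q.2 = p.2 + level b).
Hypotheses (uq : prec F u q) (pv : prec F p v) (up : u <> p).
Hypothesis lup : p.2 < u.2.

Let betw w : prec F u w -> prec F w v ->
  (w.2 < u.2 /\ w.2 < v.2) \/ (u.2 < w.2 /\ v.2 < w.2).
Proof.
move=> c1 c2; rewrite hu; apply: (edge_between hE).
  by rewrite -surjective_pairing.
by rewrite -hu -surjective_pairing.
Qed.

Let betw' w : prec F p w -> prec F w q ->
  (w.2 < p.2 /\ w.2 < q.2) \/ (p.2 < w.2 /\ q.2 < w.2).
Proof.
move=> c1 c2; rewrite hp; apply: (edge_between hE').
  by rewrite -surjective_pairing.
by rewrite -hp -surjective_pairing.
Qed.

(** If u and v both lie between p and q, each of them is above both columns of p -> q or below both.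
    As u is above and no edge lowers the column by more than one, v cannot get below. *)
Lemma cross_left : prec F v q -> p.2 < v.2.
Proof.
move=> vq; case: (prec_total up) => [c|c].
  by case: (betw c pv); lia.
have uv : prec F u v.
  by have := edge_prec u.2 hE; rewrite -hu -!surjective_pairing.
have := betw' c (prec_trans uv vq); have := betw' (prec_trans c uv) vq.
have : -1 <= level a by case: (a) => [|i] /=; lia.
lia.
Qed.

(** Not the mirror image of [cross_left]: a nose may raise the column by much, so q could jump from
    below u -> v to above it. This is the nesting excluded by [edge_nested], and the one point of
    the planarity argument that depends on the deletion of the short noses. *)
Lemma cross_right : prec F q v -> q.2 < u.2.
Proof.
move=> qv; case: (prec_total up) => [c|c]; last by case: (betw' c uq); lia.
have pq : prec F p q.
  by have := edge_prec p.2 hE'; rewrite -hp -!surjective_pairing.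
have := betw c pv; have := betw (prec_trans c pq) qv.
have [//|c1 c2 c3] := ltP q.2 u.2.
exfalso; apply: (@edge_nested k b a p.1 q.1 u.1 v.1 p.2 u.2) => //.
- by rewrite -hp -hu -!surjective_pairing.
- lia.
- lia.
- lia.
Qed.

(** F moves every point to the right, so a place that precedes another one of a higher column also
    has the smaller position. This turns the sign kept by the sweep into a comparison of
    positions. *)
Lemma cross_pos : p.1 < u.1 \/ p.1 < v.1.
Proof.
case: (prec_total up) => [c|c].
  have l : p.2 < v.2 by case: (betw c pv); lia.
  right; case: pv => [[d e]|[d e]]; last by lia.
  have := iter_ge d p.1; lia.
left; case: c => [[d e]|[d e]]; last by lia.
have := iter_ge d p.1; lia.
Qed.
End Cross.
End Lift.

Lemma periodicZ (T : Type) (g : int -> T) (m : nat) :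
  (forall i, g (i + m%:Z) = g i) -> forall i q : int, g (i + q * m%:Z) = g i.
Proof.
move=> hg; have hN i (q : nat) : g (i + q%:Z * m%:Z) = g i.
  elim: q i => [|q IH] i; first by rewrite mul0r addr0.
  have -> : i + q.+1%:Z * m%:Z = i + q%:Z * m%:Z + m%:Z by lia.
  by rewrite hg IH.
move=> i [q|q]; first exact: hN.
by rewrite -[RHS](hN _ q.+1) -(hN (i + _) q.+1) NegzE mulNr subrK hN.
Qed.

Lemma periodic_bounded (g : int -> int) (m : nat) : (0 < m)%N ->
  (forall i, g (i + m%:Z) = g i) -> exists C : int, forall i, `|g i| <= C.
Proof.
move=> m0 hg; exists (\sum_(r < m) `|g r%:Z|) => i.
have hr : (absz (i %% m%:Z)%Z < m)%N by lia.
rewrite (divz_eq i m%:Z) addrC (periodicZ hg).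
have -> : (i %% m%:Z)%Z = (Ordinal hr)%:Z by rewrite /=; lia.
rewrite (bigD1 (Ordinal hr)) //= lerDl; apply: sumr_ge0 => *; exact: normr_ge0.
Qed.

(** * Disjoint biinfinite paths *)

Record pathZ (n : nat) (F : int -> int) (k : nat) (P : int -> int * int)
    (m : nat) (D V : int) : Prop := PathZ {
  path_edge : forall i, exists2 a, edgeZ F k a (P i).1 (P (i + 1)).1
                & (P (i + 1)).2 = (P i).2 + level a;
  path_period : forall i, P (i + m%:Z) = ((P i).1 + D * n%:Z, (P i).2 + V);
  path_pos : (0 < m)%N
}.

Section Path.
Variables (n : nat) (F : int -> int) (k : nat).
Hypothesis hF : is_lift n F.

Section One.
Variables (P : int -> int * int) (m : nat) (D V : int).
Hypothesis hP : pathZ n F k P m D V.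

Lemma path_shift i (q : int) :
  P (i + q * m%:Z) = ((P i).1 + q * D * n%:Z, (P i).2 + q * V).
Proof.
have hN j (r : nat) : P (j + r%:Z * m%:Z) = ((P j).1 + r%:Z * D * n%:Z, (P j).2 + r%:Z * V).
  elim: r => [|r IH]; first by rewrite !mul0r !addr0 -surjective_pairing.
  have -> : j + r.+1%:Z * m%:Z = (j + r%:Z * m%:Z) + m%:Z by lia.
  by rewrite (path_period hP) IH /=; congr (_, _); lia.
case: q => r; first exact: hN.
have := hN (i + Negz r * m%:Z) r.+1.
have -> : i + Negz r * m%:Z + r.+1%:Z * m%:Z = i by rewrite NegzE mulNr subrK.
move=> ->; rewrite [LHS]surjective_pairing NegzE /=; congr (_, _); lia.
Qed.

Lemma path_bound : exists C : int, forall i, `|m%:Z * (P i).1 - i * D * n%:Z| <= C.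
Proof.
apply: (periodic_bounded (path_pos hP)) => i.
by rewrite (path_period hP) /=; lia.
Qed.

Lemma path_prec1 i : prec F (P i) (P (i + 1)).
Proof.
have [a h e] := path_edge hP i.
by have := edge_prec (P i).2 h; rewrite -e -!surjective_pairing.
Qed.

Lemma path_between u i (d : nat) : (forall j, P j <> u) ->
  prec F (P i) u -> prec F u (P (i + d%:Z)) ->
  exists j, prec F (P j) u /\ prec F u (P (j + 1)).
Proof.
move=> hu; elim: d => [|d IH] h1 h2.
  by move: h2; rewrite addr0 => /(prec_trans hF h1) /(prec_irr hF).
case: (prec_total F (hu (i + d%:Z))) => c; last exact: IH.
by exists (i + d%:Z); split=> //; have <- : i + d.+1%:Z = i + d%:Z + 1 by lia.
Qed.
End One.

(* The sweep of two paths visits the overlapping pairs of edges; the difference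
   of their columns keeps its sign along it, which bounds one of the paths. *)
Definition overlap (P Q : int -> int * int) i j :=
  prec F (P i) (Q (j + 1)) /\ prec F (Q j) (P (i + 1)).

Section Two.
Variables (P Q : int -> int * int) (m m' : nat) (D V D' V' : int).
Hypothesis hP : pathZ n F k P m D V.
Hypothesis hQ : pathZ n F k Q m' D' V'.
Hypothesis dis : forall i j, P i <> Q j.

Lemma overlap_ne i j : overlap P Q i j -> (P i).2 <> (Q j).2.
Proof.
case=> h1 h2.
have [a ha ea] := path_edge hP i; have [b hb eb] := path_edge hQ j.
case: (prec_total F (@dis i j)) => c e.
- move: h2; rewrite [P (i + 1)]surjective_pairing ea => h2.
  move: c; rewrite [P i]surjective_pairing => c.
  have := edge_between hF ha c h2; lia.
- move: h1; rewrite [Q (j + 1)]surjective_pairing eb => h1.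
  move: c; rewrite [Q j]surjective_pairing => c.
  have := edge_between hF hb c h1; lia.
Qed.

Lemma overlap_forward i j : overlap P Q i j -> (Q j).2 < (P i).2 ->
  (overlap P Q (i + 1) j /\ (Q j).2 < (P (i + 1)).2) \/
  (overlap P Q i (j + 1) /\ (Q (j + 1)).2 < (P i).2).
Proof.
case=> h1 h2 l.
have [a ha ea] := path_edge hP i; have [b hb eb] := path_edge hQ j.
case: (prec_total F (@dis (i + 1) (j + 1))) => c; [left|right]; split.
- by split=> //; apply: (prec_trans hF h2); apply: path_prec1 hP _.
- exact: (cross_left hF ha ea hb eb h2 (@dis i j) l c).
- by split=> //; apply: (prec_trans hF h1); apply: path_prec1 hQ _.
- exact: (cross_right hF ha ea hb eb h1 h2 (@dis i j) l c).
Qed.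

(** The columns of overlapping edges always differ. Were the sign different one step earlier, the
    forward step would carry that sign over to the present overlap. *)
Lemma overlap_backward i j : overlap P Q i j -> (P i).2 < (Q j).2 ->
  (overlap P Q (i - 1) j /\ (P (i - 1)).2 < (Q j).2) \/
  (overlap P Q i (j - 1) /\ (P i).2 < (Q (j - 1)).2).
Proof.
case=> h1 h2 l; case: (prec_total F (@dis i j)) => c; [right|left].
- have st : overlap P Q i (j - 1).
    split; rewrite ?subrK //; apply: (prec_trans hF _ h2).
    by have := path_prec1 hQ (j - 1); rewrite subrK.
  split=> //; have := overlap_ne st.
  have [//|lt|e] := ltgtP (P i).2 (Q (j - 1)).2 => // _.
  have [a ha ea] := path_edge hP i.
  have [b hb eb] := path_edge hQ (j - 1).
  case: st => st1 st2; rewrite subrK in hb eb st1.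
  have := cross_right hF ha ea hb eb st1 st2 (@dis _ _) lt h2; lia.
- have st : overlap P Q (i - 1) j.
    split; rewrite ?subrK //; apply: (prec_trans hF _ h1).
    by have := path_prec1 hP (i - 1); rewrite subrK.
  split=> //; have := overlap_ne st.
  have [//|lt|e] := ltgtP (P (i - 1)).2 (Q j).2 => // _.
  have [a ha ea] := path_edge hP (i - 1).
  have [b hb eb] := path_edge hQ j.
  case: st => st1 st2; rewrite subrK in ha ea st2.
  have := cross_left hF ha ea hb eb st2 (@dis _ _) lt h1; lia.
Qed.

Lemma sweep_forward (t : nat) i j : overlap P Q i j -> (Q j).2 < (P i).2 ->
  exists i' j', [/\ i <= i', j <= j', i' + j' = i + j + t%:Z, overlap P Q i' j'
                 & (Q j').2 < (P i').2].
Proof.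
elim: t i j => [|t IH] i j h l; first by exists i, j; split=> //; lia.
case: (overlap_forward h l) => [[h' l']|[h' l']]; have [i' [j' [????]]] := IH _ _ h' l';
  exists i', j'; split=> //; lia.
Qed.

Lemma sweep_backward (t : nat) i j : overlap P Q i j -> (P i).2 < (Q j).2 ->
  exists i' j', [/\ i' <= i, j' <= j, i' + j' = i + j - t%:Z, overlap P Q i' j'
                 & (P i').2 < (Q j').2].
Proof.
elim: t i j => [|t IH] i j h l; first by exists i, j; split=> //; lia.
case: (overlap_backward h l) => [[h' l']|[h' l']]; have [i' [j' [????]]] := IH _ _ h' l';
  exists i', j'; split=> //; lia.
Qed.

Lemma overlap_pos i j : overlap P Q i j -> (Q j).2 < (P i).2 ->
  (Q j).1 < (P i).1 \/ (Q j).1 < (P (i + 1)).1.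
Proof.
case=> h1 h2 l; have [a ha ea] := path_edge hP i; have [b hb eb] := path_edge hQ j.
exact: (cross_pos hF ha ea eb h2 (@dis i j) l).
Qed.
End Two.

Section Planar.
Variables (P Q : int -> int * int) (m m' : nat) (e V e' V' : int).
Hypothesis hP : pathZ n F k P m (- e) V.
Hypothesis hQ : pathZ n F k Q m' e' V'.
Hypothesis dis : forall i j, P i <> Q j.
Hypotheses (e0 : 0 < e) (e0' : 0 < e').

(** P drifts to the left and Q to the right. With P in the higher column, the forward sweep would
    keep P to the right of Q for ever; with P in the lower column, the backward sweep would keep P
    to the left. *)
Lemma overlap_false i j : ~ overlap P Q i j.
Proof.
move=> h.
have [C hC] := path_bound hP; have [C' hC'] := path_bound hQ.
have m0 := path_pos hP; have m0' := path_pos hQ; have n0 := lift_pos hF.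
pose A := m%:Z * e' * n%:Z; pose B := m'%:Z * e * n%:Z.
have A1 : 1 <= A by rewrite /A; nia.
have B1 : 1 <= B by rewrite /B; nia.
(* Up to an error of m' * C + m * C', the difference of positions times m * m' is - (A * j + B * i);
   the extra A + B absorbs the index shift in [overlap_pos]. As A and B are at least 1, T steps of
   the sweep change A * j + B * i by at least T. *)
pose K := m'%:Z * C + m%:Z * C' + A + B.
have dis' j' i' : Q j' <> P i' by move=> /esym; apply: dis.
have key (x y i' j' : int) : `|m%:Z * x - i' * - e * n%:Z| <= C ->
    `|m'%:Z * y - j' * e' * n%:Z| <= C' ->
    (y < x -> A * j' + B * i' < K - A - B) /\ (x < y -> - (K - A - B) < A * j' + B * i').
  move=> h1 h2.
  have {}h1 : `|m'%:Z * (m%:Z * x) + B * i'| <= m'%:Z * C.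
    have -> : m'%:Z * (m%:Z * x) + B * i' = m'%:Z * (m%:Z * x - i' * - e * n%:Z) by rewrite /B; ring.
    by rewrite normrM ger0_norm // ler_wpM2l.
  have {}h2 : `|m%:Z * (m'%:Z * y) - A * j'| <= m%:Z * C'.
    have -> : m%:Z * (m'%:Z * y) - A * j' = m%:Z * (m'%:Z * y - j' * e' * n%:Z) by rewrite /A; ring.
    by rewrite normrM ger0_norm // ler_wpM2l.
  have mm : 0 < m%:Z * m'%:Z by nia.
  rewrite /K; split=> xy; have : m%:Z * m'%:Z * (x - y) != 0 by nia.
    have : 0 < m%:Z * m'%:Z * (x - y) by nia.
    move: h1 h2; rewrite !ler_norml; lia.
  have : 0 < m%:Z * m'%:Z * (y - x) by nia.
  move: h1 h2; rewrite !ler_norml; lia.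
have [l|l|l] := ltgtP (P i).2 (Q j).2; last by case: (overlap_ne hP hQ dis h).
- pose T := K + A * j + B * i.
  have [i' [j' [h1 h2 h3 h4 h5]]] := sweep_backward hP hQ dis (absz T) h l.
  have : 0 <= (A - 1) * (j - j') by apply: mulr_ge0; lia.
  have : 0 <= (B - 1) * (i - i') by apply: mulr_ge0; lia.
  have : T <= absz T by lia.
  move: {A1 B1} h3.
  have h6 : overlap Q P j' i' by case: h4.
  have := overlap_pos hQ hP dis' h6 h5.
  have [_ k1] := key _ _ _ _ (hC i') (hC' j'); have [_ k2] := key _ _ _ _ (hC i') (hC' (j' + 1)).
  rewrite /T; case => [/k1|/k2]; lia.
- pose T := K - A * j - B * i.
  have [i' [j' [h1 h2 h3 h4 h5]]] := sweep_forward hP hQ dis (absz T) h l.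
  have : 0 <= (A - 1) * (j' - j) by apply: mulr_ge0; lia.
  have : 0 <= (B - 1) * (i' - i) by apply: mulr_ge0; lia.
  have : T <= absz T by lia.
  move: {A1 B1} h3.
  have := overlap_pos hP hQ dis h4 h5.
  have [k1 _] := key _ _ _ _ (hC i') (hC' j'); have [k2 _] := key _ _ _ _ (hC (i' + 1)) (hC' j').
  rewrite /T; case => [/k1|/k2]; lia.
Qed.

(** In columns per turn, P has slope - V / e and Q has slope V' / e'. If Q had the smaller slope,
    the paths would have to cross, and a crossing contains an overlap. *)
Lemma disjoint_paths : 0 <= V * e' + V' * e.
Proof.
rewrite leNgt; apply/negP => neg.
have dis' j' i' : Q j' <> P i' by move=> /esym; apply: dis.
have m0 := path_pos hP; have m0' := path_pos hQ.
have [z z0] : exists z : int, z = 0 by exists 0.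
have [T [[t1 t2] [t3 t4]]] : exists T : nat,
    ((P z).1 - (Q z).1 + (Q z).2 - (P z).2 < T%:Z /\
     (Q z).1 - (P z).1 + (P z).2 - (Q z).2 < T%:Z) /\
    ((P z).2 - (Q z).2 < T%:Z /\ (Q z).2 - (P z).2 < T%:Z).
  by exists (absz ((P z).1 - (Q z).1) + absz ((P z).2 - (Q z).2)).+1; lia.
have p1 := path_shift hP z (- (e' * T%:Z)).
have q1 := path_shift hQ z (e * T%:Z).
have p2 := path_shift hP z (e' * T%:Z).
have q2 := path_shift hQ z (- (e * T%:Z)).
rewrite {1}z0 add0r in p1; rewrite {1}z0 add0r in p2.
rewrite {1}z0 add0r in q1; rewrite {1}z0 add0r in q2.
have neg' : (V * e' + V' * e) * T%:Z <= - T%:Z by nia.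
(* Going e' * T periods back along P and e * T periods on along Q makes the same e * e' * T turns.
   Only the columns then differ, and Q is so much lower that it comes later in the order. *)
have c1 : prec F (P (- (e' * T%:Z) * m%:Z)) (Q (e * T%:Z * m'%:Z)).
  case: (prec_total F (@dis (- (e' * T%:Z) * m%:Z) (e * T%:Z * m'%:Z))) => //.
  rewrite p1 q1; case=> [[d /= e1 e2]|[d /= e1 _]]; exfalso; last by lia.
  have := le_lt_trans (iter_ge hF d _) e2; lia.
have c2 : prec F (Q (- (e * T%:Z) * m'%:Z)) (P (e' * T%:Z * m%:Z)).
  case: (prec_total F (@dis (e' * T%:Z * m%:Z) (- (e * T%:Z) * m'%:Z))) => //.
  rewrite p2 q2; case=> [[d /= e1 e2]|[d /= e1 _]]; exfalso; last by lia.
  have := le_lt_trans (iter_ge hF d _) e2; lia.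
case: (prec_total F (@dis (- (e' * T%:Z) * m%:Z) (- (e * T%:Z) * m'%:Z))) => c.
- have hd : e' * T%:Z * m%:Z = - (e' * T%:Z) * m%:Z + (absz (2 * (e' * T%:Z * m%:Z)))%:Z by nia.
  rewrite hd in c2.
  have [i [h1 h2]] := path_between (fun j' => @dis j' _) c c2.
  apply: (@overlap_false i (- (e * T%:Z) * m'%:Z)); split=> //.
  exact: (prec_trans hF h1 (path_prec1 hQ _)).
- have hd : e * T%:Z * m'%:Z = - (e * T%:Z) * m'%:Z + (absz (2 * (e * T%:Z * m'%:Z)))%:Z by nia.
  rewrite hd in c1.
  have [j [h1 h2]] := path_between (fun j' => @dis' j' _) c c1.
  apply: (@overlap_false (- (e' * T%:Z) * m%:Z) j); split=> //.
  exact: (prec_trans hF h1 (path_prec1 hP _)).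
Qed.
End Planar.
End Path.

(** * Walks and rows *)

(* A walk is given by its starting point and, for each edge, the kind of the
   edge and the displacement of its endpoints. *)
Fixpoint walkZ (F : int -> int) (k : nat) (x : int) (w : seq (kind * int)) : Prop :=
  if w is p :: w' then edgeZ F k p.1 x (x + p.2) /\ walkZ F k (x + p.2) w' else True.

Definition dispW (w : seq (kind * int)) : int := \sum_(p <- w) p.2.
Definition levW (w : seq (kind * int)) : int := \sum_(p <- w) level p.1.

Definition pathW (x : int) (w : seq (kind * int)) (i : int) : int * int :=
  let m := (size w)%:Z in
  (x + (i %/ m)%Z * dispW w + dispW (take (absz (i %% m)%Z) w),
   (i %/ m)%Z * levW w + levW (take (absz (i %% m)%Z) w)).

Lemma dispW_cons p w : dispW (p :: w) = p.2 + dispW w.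
Proof. exact: big_cons. Qed.

Lemma levW_cons p w : levW (p :: w) = level p.1 + levW w.
Proof. exact: big_cons. Qed.

Lemma dispW_cat w w' : dispW (w ++ w') = dispW w + dispW w'.
Proof. exact: big_cat. Qed.

Lemma levW_cat w w' : levW (w ++ w') = levW w + levW w'.
Proof. exact: big_cat. Qed.

Section Walk.
Variables (n : nat) (F : int -> int) (k : nat).
Hypothesis hF : is_lift n F.

Lemma edge_shift a x y (q : int) :
  edgeZ F k a x y -> edgeZ F k a (x + q * n%:Z) (y + q * n%:Z).
Proof.
case: a => [|i] /=.
  have -> : y + q * n%:Z - 1 = (y - 1) + q * n%:Z by rewrite addrAC.
  by rewrite !(lift_shiftZ hF) => -[-> h]; split=> //; rewrite ltrD2r.
case=> ik ht -> hs; split=> //.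
- by move=> j ji; rewrite (iter_shift hF) addrAC !(lift_shiftZ hF) ltrD2r; apply: ht.
- by rewrite (iter_shift hF) addrAC.
- apply: contra_not hs => -[ltk h]; split=> //; case: h => [[z hz]|h].
    left; exists (z - q * n%:Z); apply: (addIr (q * n%:Z)).
    by rewrite -(lift_shiftZ hF) subrK.
  by right; move: h; rewrite addrAC !(lift_shiftZ hF) ltrD2r.
Qed.

Lemma edge_eq a x y x' y' :
  edgeZ F k a x y -> x = x' -> y = y' -> edgeZ F k a x' y'.
Proof. by move=> h <- <-. Qed.

Lemma walk_shift x w (q : int) : walkZ F k x w -> walkZ F k (x + q * n%:Z) w.
Proof.
elim: w x => //= p w IH x [h1 h2]; rewrite addrAC; split; last exact: IH.
exact: edge_shift.
Qed.

Lemma walk_cat x w w' :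
  walkZ F k x (w ++ w') <-> walkZ F k x w /\ walkZ F k (x + dispW w) w'.
Proof.
elim: w x => [|p w IH] x /=; first by rewrite /dispW big_nil addr0; tauto.
by rewrite dispW_cons addrA IH; tauto.
Qed.

Lemma walk_nth x w r : walkZ F k x w -> (r < size w)%N ->
  exists2 a, edgeZ F k a (x + dispW (take r w)) (x + dispW (take r.+1 w))
           & levW (take r.+1 w) = levW (take r w) + level a.
Proof.
elim: w x r => [//|p w IH] x [|r] /= [h1 h2] hr.
  exists p.1; first by rewrite !dispW_cons /dispW big_nil !addr0 take0 big_nil addr0.
  by rewrite take0 /levW !(big_nil, big_cons) addr0 add0r.
have [a ha ea] := IH _ r h2 hr; exists a.
  by rewrite !dispW_cons !addrA.
by rewrite !levW_cons ea addrA.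
Qed.

Lemma walk_prec x w h : walkZ F k x w -> w <> [::] ->
  prec F (x, h) (x + dispW w, h + levW w).
Proof.
elim: w x h => [//|p w IH] x h /= [h1 h2] _.
have e := edge_prec h h1; rewrite dispW_cons levW_cons !addrA.
case: w IH h2 => [|p' w] IH h2; first by rewrite /dispW /levW !big_nil !addr0.
by apply: (prec_trans hF e); apply: IH.
Qed.

Lemma pathW_path x w (D : int) : walkZ F k x w -> w <> [::] -> dispW w = D * n%:Z ->
  pathZ n F k (pathW x w) (size w) D (levW w).
Proof.
move=> hw w0 hD; have m0 : (0 < size w)%N by case: (w) w0.
split=> // i; last first.
  rewrite /pathW /=.
  have -> : ((i + (size w)%:Z) %/ (size w)%:Z)%Z = (i %/ (size w)%:Z)%Z + 1.
    by rewrite divzDr ?dvdzz // divzz; lia.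
  by rewrite modzDr; congr (_, _); lia.
rewrite /pathW /=; set q := (i %/ _)%Z; set r := absz _.
have hr : (r < size w)%N by rewrite /r; lia.
have hi : i = q * (size w)%:Z + r%:Z.
  by rewrite {1}(divz_eq i (size w)%:Z) /q /r; lia.
clearbody q r; have [a ha ea] := walk_nth hw hr.
have e1 : i + 1 = q * (size w)%:Z + r.+1%:Z by rewrite {1}hi; lia.
have m1 : (size w)%:Z != 0 by lia.
have [e2|e2] : (r.+1 < size w)%N \/ r.+1 = size w by lia.
  exists a; rewrite e1 divzMDl // modzMDl modz_small ?divz_small; try lia.
    by apply: (edge_eq (edge_shift (q * D) ha)); rewrite /= hD; lia.
  by rewrite /= addr0 ea addrA.
exists a; rewrite e1 divzMDl // modzMDl e2 modzz divzz m1 /= take0.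
  apply: (edge_eq (edge_shift (q * D) ha)); rewrite hD; first lia.
  rewrite e2 take_size hD /dispW big_nil; lia.
have := ea; rewrite e2 take_size => {}ea.
by rewrite /levW big_nil -!/(levW _) mulrDl {2}ea; lia.
Qed.
End Walk.

(* [row_end F r] is the last vertex of row r-1; row 0 starts at vertex 0. *)
Definition row_end (F : int -> int) (r : nat) : int := iter r F (-1).

Definition is_row (F : int -> int) (x : int) (r : nat) : Prop :=
  row_end F r < x <= row_end F r.+1.

Lemma modz_eq_ex (x y d : int) : (x %% d)%Z = (y %% d)%Z -> exists q, x = y + q * d.
Proof.
move=> h; exists ((x %/ d)%Z - (y %/ d)%Z).
by rewrite {1}(divz_eq x d) {1}(divz_eq y d) h; ring.
Qed.

Definition absW (w : seq (kind * int)) : nat := \sum_(p <- w) absz p.2.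

Section Rows.
Variables (n : nat) (F : int -> int).
Hypothesis hF : is_lift n F.
Let Y := row_end F.

Lemma row_endS r : Y r.+1 = F (Y r).
Proof. by []. Qed.

Lemma row_endD i r : Y (i + r)%N = iter i F (Y r).
Proof. exact: iterD. Qed.

Lemma row_end_lt r s : (r < s)%N -> Y r < Y s.
Proof.
elim: s => // s IH; rewrite ltnS leq_eqVlt => /orP[/eqP ->|/IH h].
  exact: (lift_gt hF).
exact: (lt_trans h (lift_gt hF _)).
Qed.

Lemma row_end_le r s : (r <= s)%N -> Y r <= Y s.
Proof. by rewrite leq_eqVlt => /orP[/eqP ->|/row_end_lt/ltW]. Qed.

Lemma is_row_inj x r s : is_row F x r -> is_row F x s -> r = s.
Proof.
move=> /andP[r1 r2] /andP[s1 s2].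
have [rs|sr|//] := ltngtP r s; [have := row_end_le rs | have := row_end_le sr]; rewrite /Y; lia.
Qed.

Lemma is_row_ex x : 0 <= x -> exists r, is_row F x r.
Proof.
move=> x0; have hx : exists r, x <= Y r.+1.
  by exists (absz x); have := iter_ge hF (absz x).+1 (-1); rewrite /Y /row_end; lia.
case: (ex_minnP hx) => r hr hmin; exists r; apply/andP; split=> //.
case: r hr hmin => [|r] hr hmin; first by rewrite /row_end /=; lia.
by rewrite ltNge; apply/negP => /hmin; rewrite ltnn.
Qed.

Lemma row_hollow x y r : F y = x -> F (y - 1) < x -> 0 <= y -> is_row F x r ->
  (0 < r)%N /\ is_row F y r.-1.
Proof.
move=> e1 e2 y0 /andP[r1 r2].
have yr : y <= Y r.
  rewrite leNgt; apply/negP => yr.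
  have := lift_mono hF (_ : Y r <= y - 1); rewrite -row_endS.
  move: r2; rewrite -/(Y _); lia.
case: r r1 r2 yr => [|r] r1 r2 yr; first by move: yr; rewrite /Y /row_end /=; lia.
split=> //; apply/andP; split=> //=; apply: (lift_homo hF); rewrite e1.
exact: r1.
Qed.

(** By tightness the iterates of x stay below those of the end of its row unless x is that end, so
    an i-nose climbs exactly i rows. From a row end the final + 1 enters one row more: these are the
    backward noses. *)
Lemma row_nose i x y r : tightZ F i x -> y = iter i F x + 1 -> is_row F x r ->
  is_row F y (i + (r + (x == Y r.+1))).
Proof.
move=> ht ey /andP[r1 r2]; rewrite /is_row -/(Y _) -/(Y _).
have [xY|xY] := eqVneq x (Y r.+1).
  rewrite ey xY -row_endD addn1 row_endS.
  have := lift_gt hF (Y (i + r.+1)); lia.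
rewrite addn0 -addnS !row_endD ey.
have := iter_mono hF i (ltW r1); rewrite -/(Y r).
have [le|lt] := leP (iter i F (Y r.+1)) (iter i F x); last by lia.
have := tight_last hF ht le; move: r2 xY; rewrite -/(Y _); lia.
Qed.

(** Two row ends agree modulo n by the pigeonhole principle, and iteration propagates this. The
    ratio q : p is the translation number of F, as [slope_le] and [slope_ge] express. *)
Lemma row_end_periodic : exists a p (q : nat),
  [/\ (0 < p)%N, (0 < q)%N & forall r, (a <= r)%N -> Y (r + p)%N = Y r + q%:Z * n%:Z].
Proof.
have n0 := lift_pos hF.
have hm (r : 'I_n.+1) : (absz (Y r %% n%:Z)%Z < n)%N by lia.
pose g (r : 'I_n.+1) := Ordinal (hm r).
have [/injectiveP/leq_card|] := boolP (injectiveb g).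
  by rewrite !card_ord ltnn.
move=> /injectivePn[r1 [r2 ne e]].
wlog lt : r1 r2 ne e / (r1 < r2)%N.
  move=> H; have [l|l|l] := ltngtP r1 r2; first exact: (H r1 r2).
    by apply: (H r2 r1); rewrite // eq_sym.
  by move/eqP: ne; case; apply: val_inj.
have [q eY] : exists q, Y r2 = Y r1 + q * n%:Z.
  by apply: modz_eq_ex; have := congr1 val e => /=; lia.
have q0 : 0 < q by have := row_end_lt lt; nia.
exists r1, (r2 - r1)%N, (absz q); split; [lia|lia|move=> r r1r].
have -> : (r + (r2 - r1) = (r - r1) + r2)%N by lia.
rewrite row_endD eY (iter_shift hF) -row_endD subnK //; lia.
Qed.

Section Periodic.
Variables a p q : nat.
Hypothesis hY : forall r, (a <= r)%N -> Y (r + p)%N = Y r + q%:Z * n%:Z.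

Lemma row_endM r (t : nat) : (a <= r)%N -> Y (r + t * p)%N = Y r + t%:Z * q%:Z * n%:Z.
Proof.
move=> ar; elim: t => [|t IH]; first by rewrite mul0n addn0 !mul0r addr0.
rewrite mulSn addnCA addnA (addnC p) -addnA (addnC p) addnA hY; last by lia.
rewrite IH; lia.
Qed.

Lemma is_row_shift x r (t : nat) : (a <= r)%N ->
  is_row F x r -> is_row F (x + t%:Z * q%:Z * n%:Z) (r + t * p).
Proof.
move=> ar; rewrite /is_row -!/(Y _) -addSn !row_endM //; last by lia.
by rewrite ltrD2r lerD2r.
Qed.

Hypothesis p0 : (0 < p)%N.
Hypothesis q0 : (0 < q)%N.

Lemma row_bound : exists K : int, forall x r, is_row F x r ->
  `|p%:Z * x - r%:Z * q%:Z * n%:Z| <= K.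
Proof.
pose g r := p%:Z * Y r - r%:Z * q%:Z * n%:Z.
have hg r : (a <= r)%N -> g (r + p)%N = g r by move=> ar; rewrite /g hY //; lia.
pose C := \sum_(r < a + p) `|g r|.
have hC r : `|g r| <= C.
  have [m] := ubnP r; elim: m r => // m IH r rm.
  have [lt|le] := ltnP r (a + p).
    by rewrite /C (bigD1 (Ordinal lt)) //= lerDl; apply: sumr_ge0 => *; exact: normr_ge0.
  by rewrite -(subnK (_ : p <= r)%N); [rewrite hg; [apply: IH|] |]; lia.
exists (C + q%:Z * n%:Z) => x r /andP[r1 r2].
have p1 : p%:Z * Y r <= p%:Z * x by rewrite ler_pM2l ?ltW.
have p2 : p%:Z * x <= p%:Z * Y r.+1 by rewrite ler_pM2l.
have := hC r; have := hC r.+1; rewrite /g !ler_norml; lia.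
Qed.

(** The orbit of Y a advances exactly q turns in p iterates, and an orbit that starts j turns
    further on stays j turns further on. Repeating the hypothesis s * p times, with s outgrowing
    this offset, contradicts any steeper e. *)
Lemma slope_le (e : int) (v : nat) x :
  x <= iter v F (x - e * n%:Z) -> p%:Z * e <= v%:Z * q%:Z.
Proof.
move=> hx; have n0 := lift_pos hF.
have hs (s : nat) : x <= iter (s * v) F (x - s%:Z * e * n%:Z).
  elim: s => [|s IH]; first by rewrite mul0n !mul0r subr0.
  rewrite mulSn addnC iterD; apply: (le_trans IH); apply: (iter_mono hF).
  have := iter_shift hF v (x - e * n%:Z) (- (s%:Z * e)).
  have -> : x - e * n%:Z + - (s%:Z * e) * n%:Z = x - s.+1%:Z * e * n%:Z by lia.
  move=> ->; lia.
have [j hj] : exists j : nat, `|x - Y a| <= j%:Z by exists (absz (x - Y a)); lia.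
move: hj; rewrite ler_norml => /andP[hj1 hj2].
rewrite leNgt; apply/negP => lt.
have [s [hs1 hs2]] : exists s : nat, x - Y a + j%:Z * n%:Z < s%:Z /\ Y a - x + j%:Z * n%:Z < s%:Z.
  by exists (absz (x - Y a) + j * n).+1; lia.
have h1 := hs (s * p)%N.
have h2 : x - (s * p)%N%:Z * e * n%:Z <= Y a + (j%:Z - (s * p)%N%:Z * e) * n%:Z.
  nia.
have := iter_mono hF (s * p * v) h2; rewrite (iter_shift hF) -row_endD.
have -> : (s * p * v + a = a + (s * v) * p)%N by rewrite addnC mulnAC.
rewrite row_endM // => h3.
have h4 := le_trans h1 h3.
have h6 : 0 <= (p%:Z * e - v%:Z * q%:Z - 1) * (n%:Z - 1) by apply: mulr_ge0; lia.
have h5 : 0 <= s%:Z * ((p%:Z * e - v%:Z * q%:Z) * n%:Z - 1) by apply: mulr_ge0; lia.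
lia.
Qed.

Lemma slope_ge (e : int) (v : nat) x :
  iter v F x <= x + e * n%:Z -> v%:Z * q%:Z <= p%:Z * e.
Proof.
move=> hx; have n0 := lift_pos hF.
have hs (s : nat) : iter (s * v) F x <= x + s%:Z * e * n%:Z.
  elim: s => [|s IH]; first by rewrite mul0n !mul0r addr0.
  rewrite mulSn addnC iterD; apply: (le_trans (iter_mono hF (s * v) hx)).
  by rewrite (iter_shift hF); lia.
have [j hj] : exists j : nat, `|x - Y a| <= j%:Z by exists (absz (x - Y a)); lia.
move: hj; rewrite ler_norml => /andP[hj1 hj2].
rewrite leNgt; apply/negP => lt.
have [s [hs1 hs2]] : exists s : nat, x - Y a + j%:Z * n%:Z < s%:Z /\ Y a - x + j%:Z * n%:Z < s%:Z.
  by exists (absz (x - Y a) + j * n).+1; lia.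
have h1 := hs (s * p)%N.
have h2 : Y a + - j%:Z * n%:Z <= x by nia.
have := iter_mono hF (s * p * v) h2; rewrite (iter_shift hF) -row_endD.
have -> : (s * p * v + a = a + (s * v) * p)%N by rewrite addnC mulnAC.
rewrite row_endM // => h3.
have h4 := le_trans h3 h1.
have h6 : 0 <= (v%:Z * q%:Z - p%:Z * e - 1) * (n%:Z - 1) by apply: mulr_ge0; lia.
have h5 : 0 <= s%:Z * ((v%:Z * q%:Z - p%:Z * e) * n%:Z - 1) by apply: mulr_ge0; lia.
lia.
Qed.

End Periodic.

Lemma row_edge k a x y r : edgeZ F k a x y -> 0 <= y -> is_row F x r ->
  exists2 s, is_row F y s &
    s%:Z = r%:Z + level a + (is_nose_kind a && (x == Y r.+1))%:Z.
Proof.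
case: a => [|i] /=.
  case=> e1 e2 y0 hr; have [r0 h] := row_hollow e1 e2 y0 hr.
  by exists r.-1 => //; lia.
case=> _ ht ey _ _ hr; exists (i + (r + (x == Y r.+1)))%N; first exact: row_nose.
by case: (x == Y r.+1); lia.
Qed.

Fixpoint forwardZ (x : int) (w : seq (kind * int)) : Prop :=
  if w is p :: w' then
    (0 <= x /\ forall r, is_row F x r -> is_nose_kind p.1 -> x <> Y r.+1) /\
    forwardZ (x + p.2) w'
  else True.

Lemma forwardZ_cat x w w' : forwardZ x (w ++ w') -> forwardZ x w.
Proof. by elim: w x => //= p w IH x [h1 /IH]. Qed.

Lemma forwardZ_row k x w r : walkZ F k x w -> forwardZ x w -> 0 <= x + dispW w ->
  is_row F x r -> exists2 s, is_row F (x + dispW w) s & s%:Z = r%:Z + levW w.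
Proof.
elim: w x r => [|p w IH] x r /=.
  by rewrite /dispW /levW !big_nil !addr0; exists r.
move=> [h1 h2] [[x0 hb] h3]; rewrite dispW_cons levW_cons addrA => y0 hr.
have z0 : 0 <= x + p.2.
  by case: w h3 y0 {IH h2} => [|p' w] /= h3; [rewrite /dispW big_nil addr0 | case: h3 => -[]].
have [s hs es] := row_edge h1 z0 hr.
have [s' hs' es'] := IH _ _ h2 h3 y0 hs.
exists s' => //; move: es; rewrite es'.
case: (is_nose_kind p.1) (hb r hr) => [/(_ isT)/eqP/negPf ->|_] /=; lia.
Qed.

(** Each edge gains its level in rows, and one row more if it is a nose from a row end; equality in
    the total therefore excludes such noses. Starting at [absW w] or beyond keeps the walk among the
    nonnegative vertices, where rows exist. *)
Lemma row_walk k x w r : walkZ F k x w -> (absW w)%:Z <= x ->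
  is_row F x r -> exists2 s, is_row F (x + dispW w) s &
    r%:Z + levW w <= s%:Z /\ (s%:Z = r%:Z + levW w -> forwardZ x w).
Proof.
elim: w x r => [|p w IH] x r /=.
  by rewrite /dispW /levW !big_nil !addr0; exists r.
move=> [h1 h2]; rewrite [absW _]big_cons -/(absW w) dispW_cons levW_cons addrA => hx hr.
have hz : (absW w)%:Z <= x + p.2 by lia.
have z0 : 0 <= x + p.2 by exact: le_trans hz.
have [s hs es] := row_edge h1 z0 hr.
have [s' hs' [le1 le2]] := IH _ _ h2 hz hs.
exists s' => //; split; first by lia.
move=> e; split; last by apply: le2; lia.
split; first by lia.
move=> r' hr' hk xY; move: es; rewrite -(is_row_inj hr' hr) hk xY eqxx /=.
have := is_row_inj hr' hr; lia.
Qed.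

Lemma walk_repeat k x w (D : int) (t : nat) : walkZ F k x w -> dispW w = D * n%:Z ->
  walkZ F k x (flatten (nseq t w)).
Proof.
move=> hw hD; elim: t => //= t IH; rewrite walk_cat; split=> //.
by rewrite hD; apply: walk_shift.
Qed.

Lemma dispW_repeat (t : nat) w : dispW (flatten (nseq t w)) = t%:Z * dispW w.
Proof.
by elim: t => [|t IH] /=; [rewrite /dispW big_nil mul0r | rewrite dispW_cat IH; lia].
Qed.

Lemma levW_repeat (t : nat) w : levW (flatten (nseq t w)) = t%:Z * levW w.
Proof.
by elim: t => [|t IH] /=; [rewrite /levW big_nil mul0r | rewrite levW_cat IH; lia].
Qed.

Lemma dispW_le w : - dispW w <= (absW w)%:Z.
Proof.
elim: w => [|p w IH]; first by rewrite /dispW /absW !big_nil.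
by rewrite dispW_cons [absW _]big_cons -/(absW w); lia.
Qed.

(* High enough, rows are periodic; so the rows gained over p turns are exactly
   the levels gained, leaving no room for a backward nose. *)
Lemma forward_repeat k x w (D : int) (a p q g : nat) :
  (0 < p)%N ->
  (forall r, (a <= r)%N -> Y (r + p)%N = Y r + q%:Z * n%:Z) ->
  walkZ F k x w -> dispW w = D * n%:Z -> p%:Z * D = levW w * q%:Z ->
  exists N : int, forall N' : int, N <= N' ->
    walkZ F k (x + N' * n%:Z) (flatten (nseq g w)) /\
    forwardZ (x + N' * n%:Z) (flatten (nseq g w)).
Proof.
move=> p0 hY hw hD slope; have n0 := lift_pos hF.
(* With g * p repetitions the displacement becomes g * levW w periods of q turns, so the row at the
   end is known exactly; the first g of them are then cut out. *)
pose u := flatten (nseq (g * p) w).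
pose B := (absW u)%:Z.
have B0 : 0 <= B by [].
have Y0 : -1 <= Y a by apply: (@row_end_le 0 a).
exists ((absz x)%:Z + B + Y a + 2) => N' hN'.
pose x' := x + N' * n%:Z.
have hx' : Y a + B < x'.
  have : 0 <= (N' - ((absz x)%:Z + B + Y a + 2)) * n%:Z by apply: mulr_ge0; lia.
  have : 0 <= ((absz x)%:Z + B + Y a + 2) * (n%:Z - 1) by apply: mulr_ge0; lia.
  by rewrite /x'; lia.
have hwu t : walkZ F k x' (flatten (nseq t w)) by apply: walk_repeat hD; exact: walk_shift.
split; first exact: hwu.
have hu1 : B <= x' by move: hx' Y0; clear; lia.
have [r hr] : exists r, is_row F x' r by apply: is_row_ex; lia.
have [s hs [le1 le2]] := row_walk (hwu (g * p)%N) hu1 hr.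
have ge_a z t : Y a < z -> is_row F z t -> (a <= t)%N.
  move=> za /andP[_ zt]; rewrite leqNgt; apply/negP => lt.
  by have := lt_le_trans za (le_trans zt (row_end_le lt)); rewrite ltxx.
have ar : (a <= r)%N by apply: (ge_a x') => //; apply: le_lt_trans hx'; rewrite lerDl.
have as_ : (a <= s)%N.
  apply: (ge_a (x' + dispW u)) => //; apply: (lt_le_trans (_ : Y a < x' - B)).
    by rewrite ltrBrDr.
  by rewrite lerD2l lerNl; exact: dispW_le.
suff e : s%:Z = r%:Z + levW u.
  have := le2 e; have {1}-> : (g * p = g + g * p.-1)%N by rewrite -mulnS prednK.
  by rewrite nseqD flatten_cat => /forwardZ_cat.
have eu : dispW u = (g%:Z * levW w) * q%:Z * n%:Z.
  rewrite dispW_repeat hD -(mulrA g%:Z (levW w)) -slope; lia.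
have el : levW u = g%:Z * levW w * p%:Z by rewrite levW_repeat; lia.
(* [is_row_shift] only moves upwards: for a negative level it is applied from the end of the walk
   back to its start. *)
case: (levW w) eu el => v eu el.
  have := is_row_shift hY (g * v) ar hr.
  have -> : x' + (g * v)%N%:Z * q%:Z * n%:Z = x' + dispW u by rewrite eu; lia.
  by move/is_row_inj => /(_ _ hs) es; rewrite el; lia.
have := is_row_shift hY (g * v.+1) as_ hs.
have -> : x' + dispW u + (g * v.+1)%N%:Z * q%:Z * n%:Z = x' by rewrite eu NegzE; lia.
by move/is_row_inj => /(_ _ hr) es; rewrite el NegzE; lia.
Qed.
End Rows.

(** * Short noses *)

(* D y is the width of the gap after y and L the set of gaps for which no edge
   of S^k gives 2 <= D y at once.  V i y z is the part of D y that is left when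
   a chain of i links lk has led from y to z, where own z u charges gap u to z. *)
Section Accounting.
Variables (n k : nat) (D : int -> int) (L : int -> Prop) (lk own : int -> int -> Prop).
Variable (V : nat -> int -> int -> int).
Hypothesis n0 : (0 < n)%N.

Fixpoint chain (i : nat) (y z : int) : Prop :=
  if i is i'.+1 then exists2 w, chain i' y w & lk w z else y = z.

Hypothesis D_shift : forall x q, D (x + q * n%:Z) = D x.
Hypothesis L_shift : forall x q, L x -> L (x + q * n%:Z).
Hypothesis lk_shift : forall x y q, lk x y -> lk (x + q * n%:Z) (y + q * n%:Z).
Hypothesis own_shift : forall x y q, own x y -> own (x + q * n%:Z) (y + q * n%:Z).
Hypothesis lk_inj : forall x y z, lk x z -> lk y z -> x = y.
Hypothesis own_inj : forall x y z, own x z -> own y z -> x = y.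
Hypothesis L_lk : forall x y, L y -> ~ lk x y.
Hypothesis V0 : forall y, V 0%N y y = D y.
Hypothesis V_end : forall i y z, L y -> chain i y z -> (i <= k)%N ->
  i = k \/ (forall z', ~ lk z z') -> 2 <= V i y z.
Hypothesis V_step : forall i y z z', L y -> chain i y z -> (i < k)%N -> lk z z' ->
  exists B : seq int, [/\ uniq B, forall u, u \in B -> L u /\ own z u
    & V i.+1 y z' + \sum_(u <- B) D u <= V i y z].

Lemma chain_shift i y z q : chain i y z -> chain i (y + q * n%:Z) (z + q * n%:Z).
Proof.
elim: i z => [z /= -> //|i IH] z /= [w h1 h2].
by exists (w + q * n%:Z); [exact: IH | exact: lk_shift].
Qed.

(** Links are injective and none leads into L, so chains that start in L never meet; this is why no
    gap is charged twice. *)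
Lemma chain_inj i j y y' z : L y -> L y' -> chain i y z -> chain j y' z ->
  i = j /\ y = y'.
Proof.
move=> hy hy'; elim: i j z => [|i IH] [|j] z /=.
- by move=> -> ->.
- by move=> e [w _]; rewrite -e => /(L_lk hy).
- by move=> [w _ h] e; case: (L_lk hy' (_ : lk w y')); rewrite e.
- move=> [w h1 h2] [w' h1' h2']; rewrite (lk_inj h2' h2) in h1'.
  by have [-> ->] := IH _ _ h1 h1'.
Qed.

Lemma V_children i y z : L y -> chain i y z -> (i <= k)%N ->
  exists B : seq int, [/\ uniq B, forall u, u \in B -> L u /\
      exists j w, [/\ (i <= j)%N, chain j y w & own w u]
    & 2 + \sum_(u <- B) D u <= V i y z].
Proof.
have [m] := ubnP (k - i); elim: m i z => // m IH i z hm hy hc ik.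
case: (classic (i = k \/ (forall z', ~ lk z z'))) => [h|].
  by exists [::]; split=> //; rewrite big_nil addr0; exact: V_end.
move=> /not_or_and[/eqP nk /not_all_not_ex[z' hz]].
have lt : (i < k)%N by lia.
have [B [u1 h1 le1]] := V_step hy hc lt hz.
have hc' : chain i.+1 y z' by exists z.
have [|B' [u2 h2 le2]] := IH i.+1 z' _ hy hc' lt; first lia.
exists (B ++ B'); split.
- rewrite cat_uniq u1 u2 andbT /=; apply/hasPn => u /h2[_ [j [w [ij hj hw]]]].
  apply/negP => /h1[_ ho]; rewrite (own_inj ho hw) in hc.
  have [] := chain_inj hy hy hc hj; lia.
- move=> u; rewrite mem_cat => /orP[/h1[hL ho]|/h2[hL [j [w [ij hj hw]]]]]; split=> //.
    by exists i, z.
  by exists j, w; split=> //; lia.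
- by apply: le_trans le1; rewrite big_cat /= addrCA addrC lerD2r.
Qed.

Let rs (x : int) : 'I_n.
Proof. by refine (Ordinal (_ : (absz (x %% n%:Z)%Z < n)%N)); lia. Defined.

Let rs_ex x : exists q, x = (rs x)%:Z + q * n%:Z.
Proof.
exists (x %/ n%:Z)%Z; rewrite {1}(divz_eq x n%:Z) addrC; congr (_ + _) => /=; lia.
Qed.

(* Summing the accounts of the negative vertices: each of them is charged at
   most once, so the total is at least itself plus 2 per negative vertex. *)
Lemma accounting y : L y -> 2 <= D y.
Proof.
have [Lb hLb] : exists Lb : 'I_n -> bool, forall A : 'I_n, Lb A <-> L A%:Z.
  apply: (@fin_all_exists _ (fun _ => bool) (fun A b => b <-> L (A : 'I_n)%:Z)) => A.
  by case: (classic (L A%:Z)) => h; [exists true | exists false].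
pose neg (A : 'I_n) := Lb A && (D A%:Z < 0).
have fex (A : 'I_n) : exists B : seq int, Lb A ->
    [/\ uniq B, forall u, u \in B -> L u /\
      exists j w, chain j A%:Z w /\ own w u & 2 + \sum_(u <- B) D u <= D A%:Z].
  case h : (Lb A); last by exists [::].
  move/hLb in h; have [B [u1 h1 le1]] := V_children h (erefl _ : chain 0 A%:Z A%:Z) isT.
  exists B => _; split=> //; last by rewrite -V0.
  by move=> u /h1[hL [j [w [_ ??]]]]; split=> //; exists j, w.
have [f hf] := fin_all_exists fex.
have uni (A A' : 'I_n) u u' : Lb A -> Lb A' -> u \in f A -> u' \in f A' -> rs u = rs u' ->
    A = A' /\ u = u'.
  move=> hA hA' hu hu' e.
  have [_ h _] := hf A hA; have [_ [j [w [hj hw]]]] := h u hu.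
  have [_ h' _] := hf A' hA'; have [_ [j' [w' [hj' hw']]]] := h' u' hu'.
  have [q eq] : exists q, u = u' + q * n%:Z.
    have [q1 e1] := rs_ex u; have [q2 e2] := rs_ex u'.
    by exists (q1 - q2); rewrite e1 e2 e; lia.
  have hw2 := own_shift q hw'; rewrite -eq in hw2.
  have hj2 := chain_shift q hj'; rewrite (own_inj hw2 hw) in hj2.
  have [_ e3] := chain_inj ((hLb A).1 hA) (L_shift q ((hLb A').1 hA')) hj hj2.
  have q0 : q = 0.
    have := ltn_ord A; have := ltn_ord A'; nia.
  move: e3 eq; rewrite q0 !mul0r !addr0 => -[e3] ->; split=> //; exact: val_inj.
pose T := \sum_(A | neg A) D A%:Z.
(* Charged gaps of nonnegative width may be dropped, and the negative ones are, modulo n, among the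
   vertices counted in T. *)
have h1 (A : 'I_n) : Lb A ->
    2 + \sum_(B | neg B && (B \in [seq rs u | u <- f A])) D B%:Z <= D A%:Z.
  move=> hA; have [u1 hu le] := hf A hA; apply: (le_trans _ le); rewrite lerD2l.
  have rsD u : D (rs u)%:Z = D u by have [q {2}->] := rs_ex u; rewrite D_shift.
  have hfil : uniq [seq rs u | u <- f A & D u < 0].
    rewrite map_inj_in_uniq ?filter_uniq // => u v; rewrite !mem_filter => /andP[_ hu1] /andP[_ hv1] e.
    by have [] := uni A A u v hA hA hu1 hv1 e.
  have -> : \sum_(B | neg B && (B \in [seq rs u | u <- f A])) D B%:Z =
      \sum_(B <- [seq rs u | u <- f A & D u < 0]) D B%:Z.
    rewrite big_uniq //=; apply: eq_bigl => B; apply/idP/idP.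
      move=> /andP[/andP[_ hB] /mapP[u hu1 eB]]; apply/mapP; exists u => //.
      by rewrite mem_filter hu1 -rsD -eB hB.
    move=> /mapP[u]; rewrite mem_filter => /andP[du hu1] ->.
    rewrite /neg rsD du map_f // !andbT; apply/hLb.
    have [q eq] := rs_ex u; have := L_shift (- q) (hu u hu1).1.
    by rewrite {1}eq mulNr addrK.
  rewrite big_map (eq_bigr D) // big_filter [leRHS](bigID (fun u => D u < 0)) /= lerDl.
  by apply: sumr_ge0 => u; rewrite -leNgt.
have no_neg A : ~~ neg A.
  apply/negP => hA.
  have : \sum_(A | neg A) (2 + \sum_(B | neg B && (B \in [seq rs u | u <- f A])) D B%:Z) <= T.
    by apply: ler_sum => B /andP[hB _]; exact: h1.
  rewrite big_split /= (exchange_big_dep neg) /=; last by move=> ?? _ /andP[].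
  have : T <= \sum_(B | neg B) \sum_(A | neg A && (neg B && (B \in [seq rs u | u <- f A]))) D B%:Z.
    apply: ler_sum => B hB; rewrite sumr_const.
    have : (#|[pred i | neg i && (neg B && (B \in [seq rs u | u <- f i]))]| <= 1)%N.
      apply/card_le1_eqP => A1 A2; rewrite !inE => /and3P[/andP[n1 _] _ /mapP[u1 m1 e1]].
      move=> /and3P[/andP[n2 _] _ /mapP[u2 m2 e2]].
      by have [] := uni A1 A2 u1 u2 n1 n2 m1 m2 (etrans (esym e1) e2).
    case: #|_| => [|[|//]] _; first by rewrite mulr0n ltW //; case/andP: hB.
    by rewrite mulr1n.
  have : 2 <= \sum_(A | neg A) (2 : int).
    by rewrite (bigD1 A) //= lerDl; apply: sumr_ge0.
  by move=> c2 c1 /(le_trans (lerD c2 c1)); rewrite gerDr.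
move=> hy; have [q eq] := rs_ex y.
have hA : Lb (rs y).
  by apply/hLb; have := L_shift (- q) hy; rewrite {1}eq mulNr addrK.
rewrite eq D_shift; apply: le_trans (h1 _ hA); rewrite lerDl.
by apply: sumr_ge0 => B /andP[]; rewrite (negPf (no_neg B)).
Qed.
End Accounting.

Section Potential.
Variables (n : nat) (F : int -> int).
Hypothesis hF : is_lift n F.

Lemma first_preimage x : exists a, [/\ a <= x, F a = F x & F (a - 1) < F x].
Proof.
have hx : exists d : nat, F (x - d.+1%:Z) < F x.
  exists n; have := lift_shift hF (x - n%:Z); rewrite subrK => ->.
  have := lift_mono hF (_ : x - n.+1%:Z <= x - n%:Z); have := lift_pos hF; lia.
case: (ex_minnP hx) => d hd hmin; exists (x - d%:Z); split; first lia.
  apply: le_anti; rewrite (lift_mono hF) /=; last by lia.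
  case: d hd hmin => [|d] hd hmin; first by rewrite subr0.
  by rewrite leNgt; apply/negP => /hmin; rewrite ltnn.
by have -> : x - d%:Z - 1 = x - d.+1%:Z by lia.
Qed.

Lemma last_preimage x : exists z, [/\ x <= z, F z = F x & F x < F (z + 1)].
Proof.
have hx : exists d : nat, F x < F (x + d.+1%:Z).
  exists n; have := lift_shift hF x.
  have := lift_mono hF (_ : x + n%:Z <= x + n.+1%:Z); have := lift_pos hF; lia.
case: (ex_minnP hx) => d hd hmin; exists (x + d%:Z); split; first lia.
  apply: le_anti; rewrite andbC (lift_mono hF) /=; last by lia.
  case: d hd hmin => [|d] hd hmin; first by rewrite addr0.
  by rewrite leNgt; apply/negP => /hmin; rewrite ltnn.
by have -> : x + d%:Z + 1 = x + d.+1%:Z by lia.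
Qed.

Lemma not_image y : ~ (exists z, F z = y) -> exists x, F x < y < F (x + 1).
Proof.
move=> h; have hx : exists d : nat, F (y - d.+1%:Z) < y.
  by exists n; have := lift_lt hF (y - n.+1%:Z); lia.
case: (ex_minnP hx) => d hd hmin; exists (y - d.+1%:Z); rewrite hd /=.
have -> : y - d.+1%:Z + 1 = y - d%:Z by lia.
rewrite lt_neqAle; apply/andP; split.
  by apply/eqP => e; apply: h; exists (y - d%:Z).
case: d hd hmin => [|d] hd hmin; first by rewrite subr0 ltW // (lift_gt hF).
by rewrite leNgt; apply/negP => /hmin; rewrite ltnn.
Qed.

Lemma tightS i z : tightZ F i.+1 z -> F z < F (z + 1) /\ tightZ F i (F z).
Proof.
by move=> h; split; [exact: (h 0%N) | move=> j ji; have := h j.+1; rewrite iterSE; apply].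
Qed.

Lemma tight_pre i z' z : tightZ F i z -> F z' = z -> z < F (z' + 1) -> tightZ F i.+1 z'.
Proof.
by move=> h e l [_|j ji] /=; rewrite ?e // -iterS iterSE e; apply: h.
Qed.

Lemma tight_post i z : tightZ F i z -> F (iter i F z) < F (iter i F z + 1) -> tightZ F i.+1 z.
Proof.
by move=> h l j; rewrite ltnS leq_eqVlt => /orP[/eqP -> //|]; apply: h.
Qed.

Definition interval (a b : int) : seq int := [seq a + j%:Z | j <- iota 0 (absz (b - a))].

Lemma mem_interval a b u : a <= b -> (u \in interval a b) = (a <= u < b).
Proof.
move=> ab; apply/mapP/idP => [[j]|h].
  by rewrite mem_iota => hj ->; lia.
by exists (absz (u - a)); rewrite ?mem_iota; lia.
Qed.

Lemma interval_uniq a b : uniq (interval a b).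
Proof. by rewrite map_inj_uniq ?iota_uniq // => i j; lia. Qed.

Lemma sum_interval (s : int -> int) a b : a <= b ->
  \sum_(u <- interval a b) (s (u + 1) - s u) = s b - s a.
Proof.
move=> ab; rewrite big_map.
have -> : s b = s (a + (absz (b - a))%:Z) by congr s; lia.
elim: (absz (b - a)) => [|d IH]; first by rewrite big_nil addr0 subrr.
rewrite -[in iota _ _]addn1 iotaD big_cat IH /= big_seq1 add0n.
have -> : a + d.+1%:Z = a + d%:Z + 1 by lia.
lia.
Qed.

Section Upgrade.
Variables (k : nat) (s : int -> int) (c l : int).
Hypothesis s_shift : forall x q : int, s (x + q * n%:Z) = s x + q * c.
Hypothesis s_edge : forall a x y, edgeZ F k a x y ->
  s x + level a * l + 2 * (is_nose_kind a)%:Z <= s y.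

Let D (x : int) := s (x + 1) - s x.

Let D_shift (x q : int) : D (x + q * n%:Z) = D x.
Proof. by rewrite /D addrAC !s_shift; ring. Qed.

Let s_hollow x : F (x - 1) < F x -> s (F x) <= s x + l.
Proof. by move=> h; have /= := @s_edge Hollow _ _ (conj erefl h); lia. Qed.

Let s_nose i x : (i <= k)%N -> tightZ F i x ->
  ~ ((i < k)%N /\ ((exists z, F z = x) \/ F (iter i F x) < F (iter i F x + 1))) ->
  s x + i%:Z * l + 2 <= s (iter i F x + 1).
Proof.
move=> ik ht hs; have /= := @s_edge (Nose i) x (iter i F x + 1) _.
rewrite mulr1; apply; split=> //; apply: contra_not hs => -[h1 h2]; split=> //.
by case: h2; [left | rewrite addrK; right].
Qed.

Let chain_left (lk := fun z z' => F z' = z /\ z < F (z' + 1)) i y z :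
  chain lk i y z -> tightZ F i z /\ iter i F z = y.
Proof.
elim: i z => [|i IH] z /=; first by move=> ->; split.
move=> [w /IH[h1 h2] [h3 h4]]; split; first exact: tight_pre h1 h3 h4.
by rewrite -iterS iterSE h3.
Qed.

(** Since F does not separate y from y + 1, a nose into y + 1 can be short only through its source
    or its index. Replacing the source by its last preimage, again and again, ends with a nose of
    S^k. Each replacement costs a hollow and the gaps from the first to the last preimage; F does
    not separate these either, so they are charged gaps of the same kind. *)
Let gap_left y : F y = F (y + 1) -> 2 <= D y.
Proof.
move=> hy.
apply: (@accounting n k D (fun y => F y = F (y + 1)) (fun z z' => F z' = z /\ z < F (z' + 1))
  (fun z u => F u = z) (fun i y z => s (y + 1) - s z - i%:Z * l)) => //.
- exact: lift_pos hF.
- by move=> x q e; rewrite addrAC !(lift_shiftZ hF) e.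
- by move=> x z q [<- h]; rewrite [z + _ + 1]addrAC !(lift_shiftZ hF) ltrD2r.
- by move=> x z q <-; rewrite (lift_shiftZ hF).
- by move=> x y' z [<- _] [<- _].
- by move=> x y' z <- <-.
- by move=> x z e [<-]; rewrite -e ltxx.
- by move=> z; rewrite /D mul0r subr0.
- move=> i y' z ey /chain_left[h1 h2] ik h.
  have := s_nose ik h1; rewrite h2 => h3; suff: s z + i%:Z * l + 2 <= s (y' + 1) by lia.
  apply: h3 => -[lt [[z' ez]|]]; last by rewrite ey ltxx.
  case: h => [e|h]; first by rewrite e ltnn in lt.
  have [w [_ e1 e2]] := last_preimage z'.
  by apply: (h w); rewrite e1 ez in e2 *.
- move=> i y' z z' ey hc ik [e1 e2].
  have [a [az ea ea']] := first_preimage z'.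
  exists (interval a z'); split; first exact: interval_uniq.
    move=> u; rewrite mem_interval // => /andP[au uz].
    have f1 : F u = z by have := lift_mono hF au; have := lift_mono hF (ltW uz); lia.
    have f2 : F (u + 1) = z.
      by have := lift_mono hF (_ : a <= u + 1); have := lift_mono hF (_ : u + 1 <= z'); lia.
    by rewrite f1 f2.
  rewrite sum_interval //.
  by have := s_hollow (_ : F (a - 1) < F a); rewrite ea => /(_ ea'); rewrite e1; lia.
Qed.

Let chain_right (lk := fun z z' => F z = z' /\ z' < F (z + 1)) i y z :
  chain lk i y z -> tightZ F i y /\ iter i F y = z.
Proof.
elim: i z => [|i IH] z /=; first by move=> ->; split.
move=> [w /IH[h1 h2] [h3 h4]]; split; last by rewrite h2.
by apply: tight_post h1 _; rewrite h2 h3.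
Qed.

(** The dual of [gap_left]: a source y outside the image of F leaves only the target, or the index,
    to make a nose short. The chain follows F forwards, and the charged gaps are those after the
    points skipped by F. *)
Let gap_right y : ~ (exists x, F x = y) -> 2 <= D y.
Proof.
move=> /not_image hy.
apply: (@accounting n k D (fun y => exists x, F x < y < F (x + 1))
  (fun z z' => F z = z' /\ z' < F (z + 1))
  (fun z u => F z < u < F (z + 1)) (fun i y z => s (z + 1) - s y - i%:Z * l)) => //.
- exact: lift_pos hF.
- move=> x q [z hz]; exists (z + q * n%:Z).
  by rewrite [z + _ + 1]addrAC !(lift_shiftZ hF) !ltrD2r.
- by move=> x z q [<- h]; rewrite [x + _ + 1]addrAC !(lift_shiftZ hF) ltrD2r.
- by move=> x z q; rewrite [x + _ + 1]addrAC !(lift_shiftZ hF) !ltrD2r.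
- move=> x z w [e1 h1] [e2 h2].
  have := lift_homo hF (_ : F x < F (z + 1)); have := lift_homo hF (_ : F z < F (x + 1)); lia.
- move=> x z w /andP[h1 h2] /andP[h3 h4].
  have := lift_homo hF (lt_trans h1 h4); have := lift_homo hF (lt_trans h3 h2); lia.
- move=> x z [w /andP[h1 h2]] [e _].
  have := lift_homo hF (_ : F w < F x); have := lift_homo hF (_ : F x < F (w + 1)); lia.
- by move=> z; rewrite /D mul0r subr0.
- move=> i y' z ey /chain_right[h1 h2] ik h.
  have := s_nose ik h1; rewrite h2 => h3; suff: s y' + i%:Z * l + 2 <= s (z + 1) by lia.
  apply: h3 => -[lt [[z' ez]|l2]].
    move: ey => [w /andP[l1 l2]].
    have := lift_homo hF (_ : F w < F z'); have := lift_homo hF (_ : F z' < F (w + 1)); lia.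
  case: h => [e|h]; first by rewrite e ltnn in lt.
  exact: (h (F z)).
- move=> i y' z z' ey hc ik [e1 e2].
  exists (interval (z' + 1) (F (z + 1))); split; first exact: interval_uniq.
    move=> u; rewrite mem_interval; last by lia.
    by move=> /andP[l1 l2]; split; [exists z|]; rewrite l2 e1; lia.
  rewrite sum_interval; last by lia.
  by have := s_hollow (_ : F (z + 1 - 1) < F (z + 1)); rewrite addrK e1 => /(_ e2); lia.
Qed.

Let s_inc a b : a <= b -> (forall u, a <= u < b -> 2 <= D u) -> s a + 2 * (b - a) <= s b.
Proof.
move=> ab h; have -> : b = a + (absz (b - a))%:Z by lia.
have : forall u, a <= u < a + (absz (b - a))%:Z -> 2 <= D u by move=> u hu; apply: h; lia.
elim: (absz (b - a)) => [|d IH] hd; first by rewrite addr0; lia.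
have := IH (fun u hu => hd u ltac:(lia)); have := hd (a + d%:Z) ltac:(lia); rewrite /D.
have -> : a + d%:Z + 1 = a + d.+1%:Z by lia.
lia.
Qed.

(** A short nose is extended by one application of F, before its source or after its target. The
    constraint of this longer nose, a hollow back and the intermediate gaps, at least 2 by
    [gap_left] or [gap_right], imply the short one; hence the induction on k - i. *)
Lemma all_tight_noses i x : (i <= k)%N -> tightZ F i x ->
  s x + i%:Z * l + 2 <= s (iter i F x + 1).
Proof.
have [m] := ubnP (k - i); elim: m i x => // m IH i x hm ik ht.
case: (classic ((i < k)%N /\ ((exists z, F z = x) \/ F (iter i F x) < F (iter i F x + 1)))) => [[lt h]|];
  last exact: s_nose.
case: h => [[w ew]|h].
  have [z [_ e1 e2]] := last_preimage w; rewrite ew in e1 e2.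
  have := IH i.+1 z ltac:(lia) lt (tight_pre ht e1 e2); rewrite iterSE e1.
  have [a [az ea ea']] := first_preimage z.
  have := s_hollow (_ : F (a - 1) < F a); rewrite ea => /(_ ea'); rewrite e1.
  have := s_inc az; move=> /(_ _) H; have {}H : s a + 2 * (z - a) <= s z.
    apply: H => u /andP[au uz]; apply: gap_left.
    by have := lift_mono hF au; have := lift_mono hF (_ : u <= u + 1);
      have := lift_mono hF (_ : u + 1 <= z); lia.
  lia.
have := IH i.+1 x ltac:(lia) lt (tight_post ht h) => /=.
set y := iter i F x in h *.
have := s_hollow (_ : F (y + 1 - 1) < F (y + 1)); rewrite addrK => /(_ h).
have : s (F y + 1) + 2 * (F (y + 1) - (F y + 1)) <= s (F (y + 1)).
  apply: s_inc; first lia.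
  move=> u /andP[l1 l2]; apply: gap_right => -[z ez].
  have := lift_homo hF (_ : F y < F z); have := lift_homo hF (_ : F z < F (y + 1)); lia.
lia.
Qed.

Lemma s_step x : s x + 2 <= s (x + 1).
Proof. by have := @all_tight_noses 0 x isT (fun j => ltac:(done)); rewrite /=; lia. Qed.

Lemma s_mono a b : a <= b -> s a + 2 * (b - a) <= s b.
Proof. by move=> ab; apply: s_inc => // u _; have := s_step u; rewrite /D; lia. Qed.

Lemma all_hollows x : s (F x) <= s x + l.
Proof.
have [a [ax ea ea']] := first_preimage x.
have := s_hollow (_ : F (a - 1) < F a); rewrite ea => /(_ ea'); have := s_mono ax; lia.
Qed.

(** From x one may pass to the last z with the same image. Where z fails to be tight, F identifies
    an iterate with its successor, and the constraint is a consequence of two constraints of smaller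
    index, joined at that successor. *)
Lemma all_noses i x : (i <= k)%N -> s x + i%:Z * l + 2 <= s (iter i F x + 1).
Proof.
have [m] := ubnP i; elim: m i x => // m IH i x im ik.
case: i im ik => [|i] im ik; first by have := s_step x; rewrite /=; lia.
have [z [xz e1 e2]] := last_preimage x; rewrite iterSE -e1 -iterSE.
suff : s z + i.+1%:Z * l + 2 <= s (iter i.+1 F z + 1) by have := s_mono xz; lia.
case: (classic (tightZ F i.+1 z)) => [ht|]; first by apply: all_tight_noses ht.
move=> /not_all_ex_not[j hj]; have [ji /negP] := imply_to_and _ _ hj; rewrite -leNgt => le.
have j0 : (0 < j)%N.
  by rewrite lt0n; apply/eqP => j0; move: le; rewrite j0 /= e1; lia.
have h1 := IH j z ltac:(lia) ltac:(lia).
have h2 := IH (i.+1 - j)%N (iter j F z + 1) ltac:(lia) ltac:(lia).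
have e3 : iter (i.+1 - j) F (iter j F z + 1) = iter i.+1 F z.
  have -> : (i.+1 - j = (i - j).+1)%N by lia.
  rewrite iterSE.
  have -> : F (iter j F z + 1) = F (iter j F z).
    by apply: le_anti; rewrite le /=; apply: lift_mono hF _ _ _; lia.
  by rewrite -iterS -iterD; congr (iter _ F z); lia.
rewrite e3 in h2; have : (i.+1 - j)%N%:Z = i.+1%:Z - j%:Z by lia.
move=> e4; rewrite e4 in h2; lia.
Qed.
End Upgrade.
End Potential.

Lemma modz_ltn n (n0 : (0 < n)%N) (x : int) : (absz (x %% n%:Z)%Z < n)%N.
Proof. lia. Qed.

Definition res n (n0 : (0 < n)%N) (x : int) : 'I_n := Ordinal (modz_ltn n0 x).

(** * From arcs to integers *)

Section Res.
Variables (n : nat) (n0 : (0 < n)%N).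

Lemma res_shift x q : res n0 (x + q * n%:Z) = res n0 x.
Proof. by apply: val_inj; rewrite /= addrC modzMDl. Qed.

Lemma res_ord (A : 'I_n) : res n0 A%:Z = A.
Proof. by apply: val_inj; rewrite /= modz_small ?absz_nat //; have := ltn_ord A; lia. Qed.

Lemma resE x : x = (res n0 x)%:Z + (x %/ n%:Z)%Z * n%:Z.
Proof. rewrite {1}(divz_eq x n%:Z) addrC; congr (_ + _) => /=; lia. Qed.

Lemma res_eq x y : res n0 x = res n0 y -> exists q, x = y + q * n%:Z.
Proof.
move=> e; exists ((x %/ n%:Z)%Z - (y %/ n%:Z)%Z).
by rewrite {1}(resE x) e {2}(resE y) mulrBl addrACA subrr addr0 addrC.
Qed.

Lemma res_eq_near x y : res n0 x = res n0 y -> x < y + n%:Z -> y < x + n%:Z -> x = y.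
Proof.
move=> /res_eq[q ->] h1 h2; have q0 : q = 0 by nia.
by rewrite q0 mul0r addr0.
Qed.

Lemma res_lift_ge x A : exists y, [/\ A = res n0 y, x <= y & y < x + n%:Z].
Proof.
exists (x + ((A%:Z - x) %% n%:Z)%Z); split; [|lia|lia].
have -> : x + ((A%:Z - x) %% n%:Z)%Z = A%:Z + (- ((A%:Z - x) %/ n%:Z)%Z) * n%:Z.
  have := divz_eq (A%:Z - x) n%:Z; lia.
by rewrite res_shift res_ord.
Qed.

Lemma card_arcs (P : pred 'I_n) x (m : nat) : (m < n)%N ->
  (forall j : nat, (j < n)%N -> P (res n0 (x + j%:Z)) = (0 < j <= m)%N) ->
  #|[set B | P B]| = m.
Proof.
move=> mn hP.
have -> : [set B | P B] = [set res n0 (x + j.+1%:Z) | j : 'I_m].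
  apply/setP => B; rewrite inE; have [y [-> y1 y2]] := res_lift_ge x B.
  have ey : y = x + (absz (y - x))%:Z by lia.
  rewrite ey hP; last by lia.
  apply/idP/imsetP => [h|[j _ e]].
    have h' : ((absz (y - x)).-1 < m)%N by lia.
    by exists (Ordinal h') => //=; rewrite prednK //; lia.
  have hj := ltn_ord j; rewrite -ey in e.
  have E : y = x + j.+1%:Z by apply: (res_eq_near e); lia.
  lia.
rewrite card_imset ?card_ord // => i j e; apply: val_inj.
have := res_eq_near e; have := ltn_ord j; have := ltn_ord i; rewrite /=; lia.
Qed.
End Res.

Section Circ.
Variables (R : realFieldType) (c : R).
Hypothesis c0 : 0 < c.

Lemma intM_small (q : int) : - c < q%:~R * c < c -> q = 0.
Proof.
move=> h; have [lt|gt|//] := ltgtP q 0.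
  have : q%:~R * c <= -1 * c by rewrite ler_pM2r // -(intrN _ 1) ler_int; lia.
  by move=> ?; exfalso; lra.
have : 1 * c <= q%:~R * c by rewrite ler_pM2r // -[1]/(1%:~R) ler_int; lia.
by move=> ?; exfalso; lra.
Qed.

Lemma cw_range p q : 0 <= p < c -> 0 <= q < c -> 0 <= cw c p q < c.
Proof. by rewrite /cw; case: (leP p q); lra. Qed.

Lemma cw_lift p q (a b : int) : 0 <= p < c -> 0 <= q < c ->
  0 <= (q + b%:~R * c) - (p + a%:~R * c) < c ->
  cw c p q = (q + b%:~R * c) - (p + a%:~R * c).
Proof.
move=> hp hq h; rewrite /cw; case: leP => pq.
  have : b - a = 0.
    by apply: intM_small; rewrite rmorphB mulrBl; lra.
  by move/eqP; rewrite subr_eq0 => /eqP ->; ring.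
have : b - a - 1 = 0.
  by apply: intM_small; rewrite !rmorphB !mulrBl /= mul1r; lra.
move=> e; have -> : b = a + 1 by lia.
by rewrite rmorphD mulrDl /= mul1r; ring.
Qed.
End Circ.

(** * Lifted extremes and the lift of F_r *)

Section Geo.
Variables (R : realFieldType) (N : model R).
Local Notation n := (narcs N).
Local Notation c := (clen N).
Hypothesis n0 : (0 < n)%N.

Definition posS (x : int) : R := beg (res n0 x) + (x %/ n%:Z)%Z%:~R * c.
Definition posT (x : int) : R := posS x + cw c (beg (res n0 x)) (fin (res n0 x)).
(** The lift of F_r. Counting the beginning points inside an arc gives a value in the cover at once,
    whereas [Fr] knows it only modulo n. *)
Definition reach (x : int) : int := x + (#|[set B : arc_of N | inA (res n0 x : arc_of N) (beg B)]|)%:Z.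

(* Of a PCA model only these consequences matter; they also hold for the
   powers, which are not assumed to be PCA models. *)
Record good : Prop := Good {
  good_len : 0 < c;
  good_range : forall e : extreme N, 0 <= pt e < c;
  good_beg : forall A B : arc_of N, (A < B)%N -> beg A < beg B;
  good_T : forall x y, x < y -> posT x < posT y;
  good_ST : forall x y, posS x != posT y
}.

Lemma posS_shift x (q : int) : posS (x + q * n%:Z) = posS x + q%:~R * c.
Proof.
rewrite /posS res_shift divzDr ?dvdz_mull // mulzK; last by lia.
by rewrite rmorphD mulrDl addrA.
Qed.

Lemma posT_shift x (q : int) : posT (x + q * n%:Z) = posT x + q%:~R * c.
Proof. by rewrite /posT posS_shift res_shift addrAC. Qed.

Lemma reach_shift x (q : int) : reach (x + q * n%:Z) = reach x + q * n%:Z.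
Proof. by rewrite /reach res_shift addrAC. Qed.

Section Basic.
Hypothesis c0 : 0 < c.
Hypothesis rng : forall e : extreme N, 0 <= pt e < c.
Hypothesis hbeg : forall A B : arc_of N, (A < B)%N -> beg A < beg B.

Lemma beg_range (A : arc_of N) : 0 <= beg A < c.
Proof. exact: (rng (true, A)). Qed.

Lemma fin_range (A : arc_of N) : 0 <= fin A < c.
Proof. exact: (rng (false, A)). Qed.

Lemma posS_lt x y : x < y -> posS x < posS y.
Proof.
move=> xy; rewrite /posS; have := beg_range (res n0 x); have := beg_range (res n0 y).
have [e|ne] := eqVneq (x %/ n%:Z)%Z (y %/ n%:Z)%Z.
  move=> _ _; rewrite e ltrD2r; apply: hbeg.
  by have := resE n0 x; have := resE n0 y; rewrite e; lia.
have le : (x %/ n%:Z)%Z + 1 <= (y %/ n%:Z)%Z.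
  have := resE n0 x; have := resE n0 y; have := ltn_ord (res n0 x); have := ltn_ord (res n0 y).
  move: (res n0 x) (res n0 y) ne => A B; move: (x %/ _)%Z (y %/ _)%Z => a b; nia.
have : ((x %/ n%:Z)%Z + 1)%:~R * c <= (y %/ n%:Z)%Z%:~R * c by rewrite ler_pM2r // ler_int.
rewrite rmorphD mulrDl /= mul1r; lra.
Qed.

Lemma posS_ltE x y : (posS x < posS y) = (x < y).
Proof.
have [l|l|->] := ltgtP x y; last by rewrite ltxx.
  exact: posS_lt.
by apply/negbTE; rewrite -leNgt ltW // posS_lt.
Qed.

Lemma posS_leE x y : (posS x <= posS y) = (x <= y).
Proof. by rewrite !leNgt posS_ltE. Qed.

Lemma posT_range x : posS x <= posT x < posS x + c.
Proof.
by rewrite lerDl ltrD2l; apply: cw_range; [exact: beg_range|exact: fin_range].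
Qed.

Lemma posT_fin x : exists b : int, posT x = fin (res n0 x) + b%:~R * c.
Proof.
rewrite /posT /posS /cw; case: leP => _.
  by exists (x %/ n%:Z)%Z; ring.
by exists ((x %/ n%:Z)%Z + 1); rewrite rmorphD mulrDl /= mul1r; ring.
Qed.

Lemma cw_SS x y : x <= y < x + n%:Z -> cw c (beg (res n0 x)) (beg (res n0 y)) = posS y - posS x.
Proof.
move=> /andP[xy yx]; apply: cw_lift; rewrite ?beg_range // -!/(posS _).
have := posS_shift x 1; rewrite !mul1r => e.
by rewrite subr_ge0 posS_leE xy ltrBlDl -e posS_ltE.
Qed.

Lemma inA_beg x y : x < y < x + n%:Z -> inA (res n0 x) (beg (res n0 y)) = (posS y < posT x).
Proof.
move=> /andP[xy yx]; rewrite /inA /in_arc cw_SS; last by rewrite ltW.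
by rewrite subr_gt0 posS_lt //= ltrBlDl.
Qed.
End Basic.

Section Good.
Hypothesis hN : good.

Let c0 := good_len hN.
Let rng := good_range hN.
Let hbeg := good_beg hN.

Lemma reach_spec x : posS (reach x) < posT x < posS (reach x + 1).
Proof.
have /andP[t1 t2] := posT_range rng x.
have e := posS_shift x 1; rewrite !mul1r in e.
have hx : exists d : nat, posT x < posS (x + d.+1%:Z).
  by exists n.-1; rewrite prednK // e.
case: (ex_minnP hx) => d hd hmin.
have h1 : posS (x + d%:Z) < posT x.
  rewrite lt_neqAle good_ST //=; case: d hd hmin => [|d] hd hmin; first by rewrite addr0.
  by rewrite leNgt; apply/negP => /hmin; rewrite ltnn.
have dn : (d < n)%N.
  have : posS (x + d%:Z) < posS (x + n%:Z) by rewrite e (lt_trans h1).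
  by rewrite posS_ltE //; lia.
suff -> : reach x = x + d%:Z.
  by rewrite h1 /=; have -> : x + d%:Z + 1 = x + d.+1%:Z by lia.
rewrite /reach (card_arcs (n0 := n0) (x := x) dn) // => -[|j] jn.
  by rewrite addr0 /inA /in_arc /cw lexx subrr ltxx.
rewrite inA_beg //; last by lia.
apply/idP/idP => h /=.
  have := lt_trans h hd; rewrite posS_ltE //; lia.
by apply: le_lt_trans h1; rewrite posS_leE //; lia.
Qed.

Lemma reach_leE x y : (posS y < posT x) = (y <= reach x).
Proof.
have /andP[h1 h2] := reach_spec x; apply/idP/idP => h.
  by have := lt_trans h h2; rewrite posS_ltE //; lia.
by apply: le_lt_trans h1; rewrite posS_leE.
Qed.

Lemma reach_ltE x y : (posT x < posS y) = (reach x < y).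
Proof. by rewrite [RHS]ltNge -reach_leE -leNgt lt_neqAle eq_sym good_ST. Qed.

Lemma reach_uniq x f : posS f < posT x < posS (f + 1) -> f = reach x.
Proof. by rewrite reach_leE reach_ltE; lia. Qed.

Lemma reach_ge x : x <= reach x.
Proof. by rewrite /reach lerDl. Qed.

Lemma reach_lt x : reach x < x + n%:Z.
Proof.
rewrite -reach_ltE; have := posS_shift x 1; rewrite !mul1r => ->.
by case/andP: (posT_range rng x).
Qed.

Lemma reach_mono x y : x <= y -> reach x <= reach y.
Proof.
rewrite le_eqVlt => /orP[/eqP -> //|xy]; rewrite -reach_leE.
by apply: lt_trans (good_T hN xy); rewrite reach_leE.
Qed.

Lemma reach_lift : (forall x, x < reach x) -> is_lift n reach.
Proof.
move=> h; split=> //; [exact: reach_mono | | exact: reach_lt].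
by move=> x; have := reach_shift x 1; rewrite mul1r.
Qed.

Lemma inA_beg_reach x y : x < y < x + n%:Z ->
  inA (res n0 x) (beg (res n0 y)) = (y <= reach x).
Proof. by move=> h; rewrite inA_beg // reach_leE. Qed.

Lemma posT_ltE x y : (posT x < posT y) = (x < y).
Proof.
have [l|l|->] := ltgtP x y; last by rewrite ltxx.
  exact: good_T.
by apply/negbTE; rewrite -leNgt ltW // good_T.
Qed.

Lemma posT_leE x y : (posT x <= posT y) = (x <= y).
Proof. by rewrite !leNgt posT_ltE. Qed.

Lemma Fr_res x : Fr (res n0 x) = res n0 (reach x).
Proof.
rewrite /Fr; case: arg_maxP => [|B hB hmax]; first by rewrite eqxx.
have [y [eB y1 y2]] := res_lift_ge n0 x B.
have yr : y <= reach x.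
  move: hB; rewrite eB; have [-> _|xy] := eqVneq y x; first exact: reach_ge.
  rewrite inA_beg_reach; last by lia.
  case/orP => // /eqP e; have : y = x by apply: (res_eq_near e); lia.
  lia.
have hr : (res n0 (reach x) == res n0 x) || inA (res n0 x) (beg (res n0 (reach x))).
  have [->|ne] := eqVneq (reach x) x; first by rewrite eqxx.
  rewrite inA_beg_reach ?lexx ?orbT //.
  by rewrite lt_neqAle eq_sym ne reach_ge reach_lt.
have : cw c (beg (res n0 x)) (beg (res n0 (reach x))) <= cw c (beg (res n0 x)) (beg B).
  exact: hmax hr.
rewrite eB (cw_SS c0 rng hbeg (x := x) (y := y)) ?y1 //.
rewrite (cw_SS c0 rng hbeg) ?reach_ge ?reach_lt // lerD2r posS_leE // => h.
by congr res; apply: le_anti; rewrite yr h.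
Qed.

Lemma cw_TT x y : x <= y < x + n%:Z ->
  cw c (fin (res n0 x)) (fin (res n0 y)) = posT y - posT x.
Proof.
move=> /andP[xy yx]; have [a ea] := posT_fin x; have [b eb] := posT_fin y.
rewrite ea eb; apply: cw_lift; rewrite ?fin_range // -ea -eb.
have := posT_shift x 1; rewrite !mul1r => e.
by rewrite subr_ge0 posT_leE xy ltrBlDl -e posT_ltE.
Qed.

Lemma inA_fin x y : x - n%:Z < y < x ->
  inA (res n0 x) (fin (res n0 y)) = (x <= reach y).
Proof.
move=> /andP[xy yx]; rewrite -reach_leE /inA /in_arc.
have /andP[t1 t2] := posT_range rng x.
have e := posT_shift y 1; rewrite !mul1r in e.
have lt1 : posT y < posT x by rewrite posT_ltE.
have lt2 : posT x < posT y + c by rewrite -e posT_ltE; lia.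
have [b eb] := posT_fin y.
have -> : cw c (beg (res n0 x)) (fin (res n0 x)) = posT x - posS x by rewrite /posT addrC addKr.
have [h|h|h] := ltgtP (posS x) (posT y).
- have -> : cw c (beg (res n0 x)) (fin (res n0 y)) = posT y - posS x.
    by rewrite eb; apply: cw_lift; rewrite ?beg_range ?fin_range // -eb -/(posS x); lra.
  by lra.
- have -> : cw c (beg (res n0 x)) (fin (res n0 y)) = (posT y + c) - posS x.
    have -> : posT y + c = fin (res n0 y) + (b + 1)%:~R * c by rewrite eb rmorphD mulrDl /= mul1r addrA.
    apply: cw_lift; rewrite ?beg_range ?fin_range // -/(posS x).
    by rewrite rmorphD mulrDl /= mul1r addrA -eb; lra.
  by lra.
- by have := good_ST hN x y; rewrite h eqxx.
Qed.

Lemma Fl_res x a : a <= x -> x <= reach a -> reach (a - 1) < x -> Fl (res n0 x) = res n0 a.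
Proof.
move=> ax ra ra1; have ax' : x - n%:Z < a by have := reach_lt a; lia.
rewrite /Fl; case: arg_maxP => [|B hB hmax]; first by rewrite eqxx.
have [y [eB y1 y2]] := res_lift_ge n0 (x - n%:Z + 1) B.
have yr : x <= reach y.
  move: hB; rewrite eB; have [->|xy] := eqVneq y x; first by rewrite reach_ge.
  rewrite inA_fin; last by lia.
  case/orP => // /eqP e; have : y = x by apply: (res_eq_near e); lia.
  lia.
have ya : a <= y.
  by rewrite leNgt; apply/negP => ya; have := reach_mono (_ : y <= a - 1); lia.
have hr : (res n0 a == res n0 x) || inA (res n0 x) (fin (res n0 a)).
  have [->|ne] := eqVneq a x; first by rewrite eqxx.
  by rewrite inA_fin ?ra ?orbT //; lia.
have : cw c (fin (res n0 a)) (fin (res n0 x)) <= cw c (fin B) (fin (res n0 x)).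
  exact: hmax hr.
rewrite eB (cw_TT (x := y) (y := x)); last by lia.
rewrite (cw_TT (x := a) (y := x)); last by lia.
rewrite lerD2l lerN2 posT_leE // => h.
by congr res; apply: le_anti; rewrite ya h.
Qed.
End Good.
End Geo.

Section Modulo.
Variables (R : realFieldType) (c : R).
Hypothesis c0 : 0 < c.

Lemma modc_eq p q (a b : int) : 0 <= p < c -> 0 <= q < c ->
  p + a%:~R * c = q + b%:~R * c -> p = q /\ a = b.
Proof.
move=> hp hq e; have ab : a - b = 0.
  by apply: (intM_small c0); rewrite rmorphB mulrBl; lra.
have {}ab : a = b by lia.
by split=> //; move: e; rewrite ab; exact: addIr.
Qed.

Lemma cw_congr p q : exists b : int, p + cw c p q = q + b%:~R * c.
Proof.
rewrite /cw; case: leP => _; first by exists 0; rewrite mul0r; ring.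
by exists 1; rewrite mul1r; ring.
Qed.

Lemma wrap_congr p : exists b : int, Defs.wrap c p = p + b%:~R * c.
Proof.
rewrite /Defs.wrap; case: ltP => _; first by exists 0; rewrite mul0r addr0.
by exists (-1); rewrite rmorphN /= mulN1r.
Qed.

Lemma wrap_range p : 0 <= p < c + c -> 0 <= Defs.wrap c p < c.
Proof. by rewrite /Defs.wrap => h; case: ltP => ?; lra. Qed.
End Modulo.

Section PcaGood.
Variables (R : realFieldType) (N : model R).
Local Notation n := (narcs N).
Local Notation c := (clen N).
Hypothesis n0 : (0 < n)%N.

(* Properness enters only here: ending points come in the order of the
   beginning points. *)
Lemma pca_good : is_pca N -> good n0.
Proof.
case=> c0 rng hbeg inj prop.
have step x : posT n0 x < posT n0 (x + 1).
  have [e|ne] := eqVneq (res n0 x) (res n0 (x + 1)).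
    have [q eq] := res_eq (esym e); rewrite eq posT_shift ltrDl.
    by rewrite pmulr_lgt0 // ltr0z; nia.
  rewrite ltNge; apply/negP => le; apply: (prop _ _ (_ : res n0 (x + 1) != res n0 x)).
    by rewrite eq_sym.
  move=> p hp /andP[p0 p1].
  have [b eb] := cw_congr c (beg (res n0 (x + 1))) p.
  have sx : posS n0 x < posS n0 (x + 1) by apply: posS_lt => //; lia.
  have /andP[t1 t2] := posT_range n0 rng x.
  have l1 : posT n0 (x + 1) = posS n0 (x + 1) + cw c (beg (res n0 (x + 1))) (fin (res n0 (x + 1))) by [].
  have l2 : posT n0 x = posS n0 x + cw c (beg (res n0 x)) (fin (res n0 x)) by [].
  have e : cw c (beg (res n0 x)) p = posS n0 (x + 1) + cw c (beg (res n0 (x + 1))) p - posS n0 x.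
    have -> : posS n0 (x + 1) + cw c (beg (res n0 (x + 1))) p =
        p + (b + ((x + 1) %/ n%:Z)%Z)%:~R * c.
      by rewrite rmorphD mulrDl /= addrA -eb /posS; ring.
    apply: cw_lift => //; first exact: beg_range.
    rewrite rmorphD mulrDl /= addrA -eb -/(posS n0 x).
    have -> : beg (res n0 (x + 1)) + cw c (beg (res n0 (x + 1))) p + ((x + 1) %/ n%:Z)%Z%:~R * c =
      posS n0 (x + 1) + cw c (beg (res n0 (x + 1))) p by rewrite /posS; ring.
    by lra.
  by rewrite /in_arc e; lra.
split=> //.
- move=> x y xy; have -> : y = x + (absz (y - x)).-1.+1%:Z by lia.
  elim: (absz (y - x)).-1 => [|d IH]; first exact: step.
  by apply: (lt_trans IH); have -> : x + d.+2%:Z = x + d.+1%:Z + 1 by lia.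
- move=> x y; apply/eqP => e; have [b eb] := posT_fin n0 y.
  have [] := @modc_eq _ c c0 (beg (res n0 x)) (fin (res n0 y)) (x %/ n%:Z)%Z b.
  + exact: beg_range.
  + exact: fin_range.
  + by rewrite -eb -e.
  by move=> e1 _; have := inj (true, res n0 x) (false, res n0 y) e1.
Qed.
End PcaGood.

Section Arcs.
Variables (R : realFieldType) (N : model R).
Local Notation n := (narcs N).
Local Notation c := (clen N).
Variable n0 : (0 < n)%N.
Hypothesis hN : good n0.
Local Notation F := (reach n0).
Hypothesis hF : is_lift n F.

Lemma Frj_res j x : Frj j (res n0 x : arc_of N) = res n0 (iter j F x).
Proof. by elim: j => //= j ->; rewrite Fr_res. Qed.

Lemma Rf_res x : Rf (res n0 x : arc_of N) = res n0 (x + 1).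
Proof.
have h y : (absz (y %% n%:Z)%Z)%:Z = (y %% n%:Z)%Z by lia.
apply: val_inj; apply/eqP; rewrite /= -eqz_nat h -modz_nat -addn1 PoszD h.
by rewrite modzDml.
Qed.

Lemma Lf_res x : Lf (res n0 x : arc_of N) = res n0 (x - 1).
Proof.
have -> : res n0 x = Rf (res n0 (x - 1) : arc_of N) by rewrite Rf_res subrK.
exact: ordSK.
Qed.

Lemma lift_eq_mod x y : res n0 (F x) = res n0 y -> exists q, F (x + q * n%:Z) = y.
Proof.
move=> /res_eq[q e]; exists (- q).
by rewrite (lift_shiftZ hF) e; lia.
Qed.

Lemma Hl_some (x y : int) : F x = y -> y < F (x + 1) -> Hl (res n0 y : arc_of N) = Some (res n0 x).
Proof.
move=> e l; rewrite /Hl; case: pickP => [B|/(_ (res n0 x))]; last first.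
  rewrite Rf_res !(Fr_res hN) e eqxx /=; case: eqP => // /res_eq_near e'.
  have := lift_lt hF (x + 1); have := lift_gt hF x; lia.
have [z [-> _ _]] := res_lift_ge n0 0 B; rewrite Rf_res !(Fr_res hN).
case/andP=> /eqP/lift_eq_mod[q ez']; rewrite -(res_shift n0 z q).
rewrite -(res_shift n0 (F (z + 1)) q) -(lift_shiftZ hF) addrAC.
move: (z + q * n%:Z) ez' => z' ez' ne.
have l' : y < F (z' + 1).
  have ne' : F (z' + 1) <> y by move=> e'; rewrite e' eqxx in ne.
  have := lift_mono hF (_ : z' <= z' + 1); lia.
congr (Some (res n0 _)).
have := lift_homo hF (_ : F x < F (z' + 1)); have := lift_homo hF (_ : F z' < F (x + 1)); lia.
Qed.

Lemma Hl_none y : ~ (exists z, F z = y) -> Hl (res n0 y : arc_of N) = None.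
Proof.
move=> h; rewrite /Hl; case: pickP => // B.
have [z [-> _ _]] := res_lift_ge n0 0 B; rewrite !(Fr_res hN).
by case/andP=> /eqP/lift_eq_mod[q e]; case: h; exists (z + q * n%:Z).
Qed.

Lemma Hl_neq x : (Hl (res n0 x : arc_of N) != None) <-> exists z, F z = x.
Proof.
case: (classic (exists z, F z = x)) => [[w h]|h]; last by rewrite Hl_none.
have [z [_ e1 e2]] := last_preimage hF w; rewrite h in e1 e2.
by rewrite (Hl_some e1 e2); split=> // _; exists w.
Qed.

Lemma HljP i y A : Hlj i (res n0 y : arc_of N) = Some A <->
  exists x, [/\ A = res n0 x, tightZ F i x & iter i F x = y].
Proof.
elim: i A => [|i IH] A.
  rewrite /Hlj /=; split=> [[<-]|[x [-> _ ->]] //]; by exists y.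
rewrite /Hlj iterS -/(Hlj i (res n0 y)); split.
  case E : (Hlj i (res n0 y)) => [B|//] /= hB.
  have [z [eB tz ez]] := (IH B).1 E; rewrite eB in hB.
  have [w hw] : exists w, F w = z by apply/Hl_neq; rewrite hB.
  have [x [_ e1 e2]] := last_preimage hF w; rewrite hw in e1 e2.
  exists x; split; first by move: hB; rewrite (Hl_some e1 e2) => -[].
    exact: tight_pre tz e1 e2.
  by rewrite -iterS iterSE e1.
move=> [x [-> /tightS[t1 t2] e]]; rewrite iterSE in e.
have -> : Hlj i (res n0 y) = Some (res n0 (F x)) by apply/IH; exists (F x).
exact: Hl_some.
Qed.

Lemma Fl_ex w : exists a, [/\ Fl (res n0 w : arc_of N) = res n0 a, a < w, w <= F a & F (a - 1) < w].
Proof.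
have hx : exists d : nat, F (w - d.+2%:Z) < w.
  by exists n; apply: lt_le_trans (lift_lt hF _) _; lia.
case: (ex_minnP hx) => d hd hmin; exists (w - d.+1%:Z).
have -> : w - d.+1%:Z - 1 = w - d.+2%:Z by lia.
have h1 : w <= F (w - d.+1%:Z).
  case: d hd hmin => [|d] hd hmin; first by have := lift_gt hF (w - 1%:Z); lia.
  by rewrite leNgt; apply/negP => /hmin; rewrite ltnn.
split=> //; last by lia.
apply: (Fl_res hN) => //; first lia.
by have -> : w - d.+1%:Z - 1 = w - d.+2%:Z by lia.
Qed.

Lemma Fl_lift w b : Fl (res n0 w : arc_of N) = res n0 b ->
  exists w', [/\ res n0 w' = res n0 w, b < w', w' <= F b & F (b - 1) < w'].
Proof.
have [a [-> h1 h2 h3]] := Fl_ex w; move=> /res_eq[q e].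
exists (w + - q * n%:Z); rewrite res_shift.
have e2 : b = a + - q * n%:Z by lia.
have e3 : b - 1 = (a - 1) + - q * n%:Z by lia.
by rewrite e3 {2}e2 !(lift_shiftZ hF); split=> //; lia.
Qed.

(** F_l sends to b exactly the indices w with F (b - 1) < w <= F b, and H_r picks the first of
    them. *)
Lemma Hr_some (b : int) A : Hr (res n0 b : arc_of N) = Some A ->
  exists a, [/\ A = res n0 a, F (b - 1) + 1 = a & a <= F b].
Proof.
rewrite /Hr; case: pickP => // B hB [<-] {A}.
have [w [eB _ _]] := res_lift_ge n0 0 B; move: hB; rewrite eB.
case/andP=> /eqP/Fl_lift[w' [ew h1 h2 h3]]; rewrite -ew Lf_res => ne.
exists w'; split=> //; apply: le_anti; apply/andP; split; first lia.
rewrite leNgt; apply/negP => lt; case/eqP: ne; by apply: (Fl_res hN); lia.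
Qed.

Lemma Hr_res (b a : int) : F (b - 1) + 1 = a -> a <= F b -> Hr (res n0 b : arc_of N) = Some (res n0 a).
Proof.
move=> e1 e2; case E : (Hr _) => [A|].
  by have [a' [-> e3 _]] := Hr_some E; rewrite -e1 -e3.
move: E; rewrite /Hr; case: pickP => // /(_ (res n0 a)); rewrite Lf_res.
have g := lift_gt hF (b - 1).
rewrite (Fl_res hN (a := b)) ?eqxx /=; try lia.
have [a' [-> h1 h2 h3]] := Fl_ex (a - 1).
case: eqP => // /res_eq_near e; exfalso.
have l1 : a' < b by have := lift_homo hF (_ : F (a' - 1) < F (b - 1)); lia.
have := lift_lt hF a'; have := lift_lt hF (a' - 1); lia.
Qed.

Lemma Hr_neq (x : int) : (Hr (res n0 x : arc_of N) != None) <-> F (x - 1) < F x.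
Proof.
split=> h.
  case E : (Hr _) h => [A|//] _; have [a [_ h1 h2]] := Hr_some E; lia.
by rewrite (Hr_res (erefl _)) //; lia.
Qed.

Lemma is_shortP k i (x y : int) :
  is_short k i (res n0 x : arc_of N) (res n0 y) <-> shortZ F k i x y.
Proof.
rewrite /is_short /shortZ; split.
  by case/andP=> ik /orP[/Hl_neq|/Hr_neq]; [split=> //; left | split=> //; right].
by case=> -> [/Hl_neq -> //|/Hr_neq ->]; rewrite orbT.
Qed.

Lemma is_hollowP (A B : arc_of N) :
  is_hollow B A <-> exists x, [/\ A = res n0 x, B = res n0 (F x) & F (x - 1) < F x].
Proof.
split.
  case/and3P=> _ /eqP eB /eqP eA.
  have [x [ex _ _]] := res_lift_ge n0 0 A; exists x; split=> //; first by rewrite eB ex Fr_res.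
  move: eA; rewrite eB ex Fr_res // => /esym/Fl_lift[w [ew h1 h2 h3]].
  have := res_eq_near ew; have := lift_lt hF x; lia.
case=> x [-> -> h]; rewrite /is_hollow (Fr_res hN) eqxx (Fl_res hN (a := x)) ?eqxx //.
  rewrite (inA_beg_reach hN) ?lexx //; have := lift_gt hF x; have := lift_lt hF x; lia.
by have := lift_gt hF x; lia.
Qed.

(* [hpow] says that i-fold reach is short of one turn, as the inequality
   i < omega provides. *)
Lemma is_noseP i (A B : arc_of N)
  (hpow : forall x y, x < y < x + n%:Z -> inApow i (res n0 x : arc_of N) (beg (res n0 y)) = (y <= iter i F x))
  (hi : forall x, iter i F x < x + n%:Z) :
  is_nose i A B <-> exists x, [/\ A = res n0 x, B = res n0 (iter i F x + 1) & tightZ F i x].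
Proof.
have [y [-> _ _]] := res_lift_ge n0 0 B; rewrite /is_nose Lf_res; split.
  case/andP=> _ /eqP/HljP[x [-> t e]]; exists x; split=> //; rewrite e; congr res; lia.
case=> x [-> e t]; apply/andP; split; last first.
  have [q eq] := res_eq e; apply/eqP/HljP; exists (x + q * n%:Z); rewrite res_shift; split=> //.
    by move=> j ji; rewrite (iter_shift hF) [_ + 1]addrAC !(lift_shiftZ hF) ltrD2r; exact: t.
  by rewrite (iter_shift hF) eq; lia.
(* A nose of one full turn is a loop; it qualifies because the open arc A^i does not contain its own
   beginning point. *)
rewrite e; have [e2|ne] := eqVneq (iter i F x + 1) (x + n%:Z).
  have -> : res n0 (iter i F x + 1) = res n0 x by rewrite e2; have := res_shift n0 x 1; rewrite mul1r.
  rewrite /inApow /inA /in_arc /=.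
  by rewrite /cw lexx subrr ltxx.
rewrite hpow; first by rewrite -ltNge; lia.
have := hi x; have := iter_ge hF i x; lia.
Qed.
End Arcs.

(** * Powers of a model and the value omega *)

Section Power.
Variables (R : realFieldType) (N : model R).
Local Notation n := (narcs N).
Local Notation c := (clen N).
Variable n0 : (0 < n)%N.
Hypothesis hpca : is_pca N.
Let hN := pca_good n0 hpca.
Local Notation F := (reach n0).
Hypothesis hF : is_lift n F.
Variable i : nat.

Let c0 : 0 < c := good_len hN.
Let rng := good_range hN.
Let hbeg := good_beg hN.

Definition nudge (x : int) : R := eps N * (xnum i (res n0 x : arc_of N)).+1%:R.

Lemma nudge_gt0 x : 0 < nudge x.
Proof. by rewrite mulr_gt0 ?ltr0n ?eps_gt0. Qed.

Lemma nudge_lt x (e : extreme N) : pt e != beg (res n0 (iter i F x)) ->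
  nudge x < cw c (beg (res n0 (iter i F x))) (pt e).
Proof. by rewrite -(Frj_res hN); exact: eps_small. Qed.

Lemma nudge_T x y : posS n0 (iter i F x) < posT n0 y < posS n0 (iter i F x) + c ->
  nudge x < posT n0 y - posS n0 (iter i F x).
Proof.
move=> h; have [b eb] := posT_fin n0 y.
have e : cw c (beg (res n0 (iter i F x))) (fin (res n0 y)) = posT n0 y - posS n0 (iter i F x).
  by rewrite eb; apply: cw_lift; rewrite ?beg_range ?fin_range // -eb -/(posS _ _); lra.
rewrite -e; apply: (nudge_lt (e := (false, res n0 y))); rewrite /pt /=.
apply/eqP => e2; move: e; rewrite e2 /cw lexx subrr; lra.
Qed.

Lemma nudge_len x : nudge x < c.
Proof.
have /andP[t1 t2] := posT_range n0 rng (iter i F x).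
apply: lt_trans (nudge_T (y := iter i F x) _) _; last by lra.
by rewrite lt_neqAle (good_ST hN) t1.
Qed.

Lemma nudge_next x : posS n0 (iter i F x) + nudge x < posS n0 (iter i F x + 1).
Proof.
set y := iter i F x.
have [e|ne] := eqVneq (res n0 y) (res n0 (y + 1)).
  have [q eq] := res_eq (esym e); rewrite eq posS_shift ltrD2l.
  have q1 : 1 <= q by clearbody y; nia.
  apply: (lt_le_trans (nudge_len x)); rewrite -[leLHS]mul1r ler_pM2r //.
  by rewrite -[1]/(1%:~R) ler_int.
rewrite addrC -ltrBrDr.
have n2 : 1 < n%:Z.
  rewrite ltNge; apply/negP => n1; case/eqP: ne.
  have -> : y + 1 = y + 1 * n%:Z by lia.
  by rewrite res_shift.
rewrite -(cw_SS n0 c0 rng hbeg); last by lia.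
apply: (nudge_lt (e := (true, res n0 (y + 1)))); rewrite /pt /=.
apply/eqP => eb; case/eqP: ne; case: hpca => _ _ _ inj _.
exact: (congr1 snd (inj (true, res n0 y) (true, res n0 (y + 1)) (esym eb))).
Qed.

Lemma power_fin x : exists b : int,
  fin (res n0 x : arc_of (power N i)) = posS n0 (iter i F x) + nudge x + b%:~R * c.
Proof.
rewrite /fin /= (Frj_res hN) -/(nudge x).
have [b eb] := wrap_congr c (beg (res n0 (iter i F x)) + nudge x).
exists (b - (iter i F x %/ n%:Z)%Z); rewrite eb /posS rmorphB mulrBl; ring.
Qed.

Lemma power_range (e : extreme (power N i)) : 0 <= pt e < c.
Proof.
case: e => -[] A; first exact: (rng (true, A)).
have [x [-> _ _]] := res_lift_ge n0 0 A.
rewrite /pt /= (Frj_res hN) -/(nudge x); apply: wrap_range.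
have := nudge_len x; have := nudge_gt0 x; have := beg_range rng (res n0 (iter i F x)); lra.
Qed.

Hypothesis hi : forall x, iter i F x < x + n%:Z.

Lemma xnum_mem x B :
  (B \in [set B : arc_of N | [&& B != res n0 x, Frj i B == Frj i (res n0 x : arc_of N)
      & cw c (beg B) (beg (res n0 x)) <= cw c (beg B) (beg (Frj i (res n0 x : arc_of N)))]]) <->
  exists z, [/\ B = res n0 z, x - n%:Z < z < x & iter i F z = iter i F x].
Proof.
rewrite inE; split.
  have [z [-> z1 z2]] := res_lift_ge n0 (x - n%:Z + 1) B.
  rewrite !(Frj_res hN) => /and3P[ne /eqP e le].
  have zx : z < x.
    have [//|/eqP zx] : z < x \/ z == x by lia.
    by rewrite zx eqxx in ne.
  exists z; split=> //; first by lia.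
  have g := iter_ge hF i z; have m := iter_mono hF i (ltW zx).
  have [q eq] := res_eq e.
  have hz := hi z; have hx := hi x.
  rewrite -e (cw_SS n0 c0 rng hbeg) in le; last by lia.
  rewrite (cw_SS n0 c0 rng hbeg) in le; last by lia.
  move: le; rewrite lerD2r posS_leE // => le.
  have q0 : q = 0 by nia.
  by rewrite eq q0 mul0r addr0.
case=> z [-> /andP[z1 z2] e]; rewrite !(Frj_res hN) e eqxx /=; apply/andP; split.
  by apply/eqP => e2; have := res_eq_near e2; lia.
have hz := hi z; have g := iter_ge hF i x.
rewrite !(cw_SS n0 c0 rng hbeg); try lia.
by rewrite lerD2r posS_leE //; lia.
Qed.

(** All arcs counted for x are counted for y, and so is x itself. Thus the count [xnum] puts the
    ending points that share one place s(F_r^i(A)) in the order of their beginning points. *)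
Lemma nudge_lt_same x y : x < y -> iter i F x = iter i F y -> nudge x < nudge y.
Proof.
move=> xy e; rewrite /nudge ltr_pM2l ?eps_gt0 // ltr_nat ltnS /xnum.
apply/proper_card/properP; split.
  apply/subsetP => B /xnum_mem[z [eB hz e2]]; apply/xnum_mem; exists z; split=> //.
    have := hi z; have := iter_ge hF i y; lia.
  by rewrite e2.
exists (res n0 x); last by rewrite inE eqxx.
apply/xnum_mem; exists x; split=> //.
have := hi x; have := iter_ge hF i y; lia.
Qed.

Lemma power_posT x : posT (N := power N i) n0 x = posS n0 (iter i F x) + nudge x.
Proof.
have [b eb] := power_fin x.
have g := iter_ge hF i x; have h := hi x.
have l1 : posS n0 x <= posS n0 (iter i F x) by rewrite posS_leE //; lia.
have l2 : posS n0 (iter i F x + 1) <= posS n0 x + c.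
  by have := posS_shift n0 x 1; rewrite !mul1r => <-; rewrite posS_leE //; lia.
have := nudge_next x; have := nudge_gt0 x => l3 l4.
have eb' : posS n0 (iter i F x) + nudge x =
    fin (res n0 x : arc_of (power N i)) + (- b)%:~R * c by rewrite eb rmorphN; ring.
rewrite /posT -[posS (N := power N i) n0 x]/(posS n0 x) /=.
have -> : cw c (beg (res n0 x)) (fin (res n0 x : arc_of (power N i))) =
    posS n0 (iter i F x) + nudge x - posS n0 x.
  rewrite eb'; apply: cw_lift => //; first exact: beg_range.
    exact: (power_range (false, res n0 x)).
  by rewrite -eb' -/(posS n0 x); lra.
by ring.
Qed.

Lemma power_good : good (N := power N i) n0.
Proof.
split=> //.
- exact: power_range.
- move=> x y xy; rewrite !power_posT.
  have := iter_mono hF i (ltW xy); rewrite le_eqVlt => /orP[/eqP e|lt].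
    by rewrite e ltrD2l nudge_lt_same.
  apply: (lt_trans (nudge_next x)); apply: (le_lt_trans (y := posS n0 (iter i F y))).
    by rewrite posS_leE //; lia.
  by rewrite ltrDl nudge_gt0.
- move=> x y; rewrite power_posT -[posS (N := power N i) n0 x]/(posS n0 x).
  apply/eqP => e; have := nudge_next y; rewrite -e posS_ltE // => l1.
  have : posS n0 (iter i F y) < posS n0 x by rewrite e ltrDl nudge_gt0.
  by rewrite posS_ltE //; lia.
Qed.

Lemma power_reach x : reach (N := power N i) n0 x = iter i F x.
Proof.
apply/esym/(reach_uniq power_good); rewrite power_posT.
rewrite -![posS (N := power N i) n0 _]/(posS n0 _) nudge_next andbT.
by rewrite ltrDl nudge_gt0.
Qed.

Lemma inApow_reach x y : x < y < x + n%:Z ->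
  inApow i (res n0 x : arc_of N) (beg (res n0 y)) = (y <= iter i F x).
Proof. by move=> h; rewrite -power_reach -(inA_beg_reach power_good). Qed.
End Power.

Section Omega.
Variables (R : realFieldType) (N : model R).
Local Notation n := (narcs N).
Local Notation c := (clen N).
Variable n0 : (0 < n)%N.
Hypothesis hpca : is_pca N.
Let hN := pca_good n0 hpca.
Local Notation F := (reach n0).
Hypothesis hF : is_lift n F.

Lemma full_turn_power j (x : int) : x + n%:Z <= iter j F x <= F x + n%:Z ->
  pow_in_self j (res n0 x : arc_of N).
Proof.
have c0 : 0 < c := good_len hN; have rng := good_range hN; have hbeg := good_beg hN.
move=> /andP[h1 h2] p hp; rewrite /in_arc => /andP[-> p1] /=; apply: (lt_trans p1).
have [b eb] := power_fin n0 hpca j x.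
have e1 := posS_shift n0 x 1; have e2 := posT_shift n0 x 1; rewrite !mul1r in e1 e2.
have l1 : posS n0 x + c <= posS n0 (iter j F x) by rewrite -e1 posS_leE.
have l2 : posS n0 (iter j F x) < posT n0 x + c.
  by rewrite -e2 (reach_leE hN) (lift_shift hF).
have /andP[t1 t2] := posT_range n0 rng x.
have l3 := nudge_gt0 n0 hpca j x.
have l4 : nudge n0 j x < posT n0 (x + n%:Z) - posS n0 (iter j F x).
  by apply: (nudge_T hpca); rewrite e2; lra.
rewrite e2 in l4.
have eb' : posS n0 (iter j F x) + nudge n0 j x - c =
    fin (res n0 x : arc_of (power N j)) + (- b - 1)%:~R * c.
  by rewrite eb rmorphB rmorphN /=; ring.
have -> : cw c (beg (res n0 x)) (fin (res n0 x : arc_of (power N j))) =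
    posS n0 (iter j F x) + nudge n0 j x - c - posS n0 x.
  rewrite eb'; apply: cw_lift => //; first exact: beg_range.
    exact: (power_range n0 hpca (false, res n0 x)).
  by rewrite -eb' -/(posS n0 x); lra.
have -> : cw c (beg (res n0 x)) (fin (res n0 x)) = posT n0 x - posS n0 x by rewrite /posT addrC addKr.
lra.
Qed.

(** By monotonicity the first iterate that completes a turn lands at F x + n or before, so that
    power of the arc lies inside the arc by [full_turn_power], against the minimality of omega. *)
Lemma omega_iter w i (x : int) : ~ is_pig N -> is_omega N w -> (i < w)%N -> iter i F x < x + n%:Z.
Proof.
move=> np [[//]|[_ w1 _ hmin]].
elim: i x => [|i IH] x iw; first by rewrite /=; lia.
case: i IH iw => [|i] IH iw; first exact: (lift_lt hF).
rewrite ltNge; apply/negP => h; apply: (hmin i.+2); first by rewrite iw.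
exists (res n0 x); apply: full_turn_power; rewrite h /=.
have := IH x ltac:(lia) => lt; rewrite /=.
have := lift_mono hF (ltW lt); rewrite (lift_shift hF) /=; lia.
Qed.
End Omega.

(** * Edges and walks of the synthetic graph in the cover *)

Section Edges.
Variables (R : realFieldType) (N : model R).
Local Notation n := (narcs N).
Variable n0 : (0 < n)%N.
Hypothesis hpca : is_pca N.
Let hN := pca_good n0 hpca.
Local Notation F := (reach n0).
Hypothesis hF : is_lift n F.
Variable k : nat.
Hypothesis hk : forall i x, (i <= k)%N -> iter i F x < x + n%:Z.

Lemma in_SP (e : edge N) : in_S k e <->
  exists x y, [/\ esrc e = res n0 x, etgt e = res n0 y & edgeZ F k (ekind e) x y].
Proof.
case: e => [[|i] A B]; rewrite /in_S /in_Sstar /=.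
  rewrite andbT (is_hollowP hN hF); split.
    by case=> x [-> -> h]; exists (F x), x.
  by case=> x [y [-> -> [<- h]]]; exists y.
split.
  case/andP=> /andP[ik]; rewrite (is_noseP hN hF) => [[x [-> -> t]]|x y|x]; last 2 first.
  - exact: (inApow_reach hpca hF (fun x => hk x ik)).
  - exact: hk.
  move=> /negP/(is_shortP hN hF) sh; by exists x, (iter i F x + 1).
case=> x [y [-> -> [ik t ey sh]]]; rewrite ik /=; apply/andP; split; last first.
  by apply/negP => /(is_shortP hN hF).
apply/(is_noseP hN hF).
- exact: (inApow_reach hpca hF (fun x => hk x ik)).
- by move=> z; exact: hk.
by exists x; rewrite ey.
Qed.
End Edges.

(** The displacement of a lifted edge: an external nose passes the point 0 clockwise and an external
    hollow anticlockwise, so that a cycle W is displaced by - ext W turns. *)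
Definition disp (R : realFieldType) (N : model R) (e : edge N) : int :=
  (etgt e)%:Z - (esrc e)%:Z +
  (if internal e then 0 else if is_nose_kind (ekind e) then (narcs N)%:Z else - (narcs N)%:Z).

Definition steps (R : realFieldType) (N : model R) (W : seq (edge N)) : seq (kind * int) :=
  [seq (ekind e, disp e) | e <- W].

Section Walks.
Variables (R : realFieldType) (N : model R).
Local Notation n := (narcs N).
Variable n0 : (0 < n)%N.

Lemma disp_cycle (W : seq (edge N)) : path.cycle (@follows _ N) W ->
  dispW (steps W) = - ext W * n%:Z.
Proof.
have tel (e : edge N) V : path (@follows _ N) e V ->
    \sum_(f <- e :: V) ((etgt f)%:Z - (esrc f)%:Z) = (etgt (last e V))%:Z - (esrc e)%:Z :> int.
  elim: V e => [|f V IH] e /=; first by rewrite big_seq1.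
  by case/andP=> /eqP ef /IH h; rewrite big_cons h ef; lia.
have key (V : seq (edge N)) : dispW (steps V) = \sum_(f <- V) ((etgt f)%:Z - (esrc f)%:Z) - ext V * n%:Z.
  rewrite /dispW big_map; elim: V => [|e V IH]; first by rewrite !big_nil /ext.
  rewrite !big_cons IH /disp /ext /=.
  by set S := \sum_(f <- V) _; case: internal; case: is_nose_kind; rewrite /=; lia.
rewrite key; case: W => [|e W] hW; first by rewrite big_nil sub0r mulNr.
suff -> : \sum_(f <- e :: W) ((etgt f)%:Z - (esrc f)%:Z) = 0 :> int by rewrite sub0r mulNr.
move: hW; rewrite /= rcons_path => /andP[h /eqP h2].
by rewrite tel // h2 subrr.
Qed.

Lemma res_disp (e : edge N) x : res n0 x = esrc e -> res n0 (x + disp e) = etgt e.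
Proof.
move=> h; have ex := resE n0 x; rewrite h in ex.
have [q hq] : exists q, disp e = (etgt e)%:Z - (esrc e)%:Z + q * n%:Z.
  rewrite /disp; case: ifP => _; first by exists 0; rewrite mul0r.
  by case: ifP => _; [exists 1; rewrite mul1r | exists (-1); rewrite mulN1r].
have -> : x + disp e = (etgt e)%:Z + ((x %/ n%:Z)%Z + q) * n%:Z by rewrite hq {1}ex; lia.
by rewrite res_shift res_ord.
Qed.

Hypothesis hpca : is_pca N.
Let hN := pca_good n0 hpca.
Local Notation F := (reach n0).
Hypothesis hF : is_lift n F.
Variable k : nat.
Hypothesis hk : forall i x, (i <= k)%N -> iter i F x < x + n%:Z.

Lemma edge_disp_range a x y : edgeZ F k a x y ->
  if is_nose_kind a then x < y <= x + n%:Z else x - n%:Z < y < x.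
Proof.
case: a => [|i] /=; first by case=> e _; have := lift_gt hF y; have := lift_lt hF y; lia.
by case=> ik _ -> _; have := hk x ik; have := iter_ge hF i x; lia.
Qed.

Lemma disp_unique (e : edge N) x y : esrc e = res n0 x -> etgt e = res n0 y ->
  (if is_nose_kind (ekind e) then x < y <= x + n%:Z else x - n%:Z <= y < x) ->
  y = x + disp e.
Proof.
move=> ex ey hr; have [q eq] := res_eq (etrans (esym ey) (esym (res_disp (esym ex)))).
suff : q = 0 by move=> q0; rewrite eq q0 mul0r addr0.
have l1 := ltn_ord (esrc e); have l2 := ltn_ord (etgt e).
have hd : if is_nose_kind (ekind e) then 0 < disp e <= n%:Z else - n%:Z <= disp e < 0.
  by rewrite /disp /internal; case: is_nose_kind; case: ltnP; lia.
by move: hd hr eq; move: (disp e) => d; case: is_nose_kind; clear -n0; nia.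
Qed.

Lemma in_S_edge (e : edge N) x : in_S k e -> esrc e = res n0 x ->
  edgeZ F k (ekind e) x (x + disp e).
Proof.
move=> /(in_SP hpca hF hk)[x' [y' [h1 h2 h3]]] ex.
have [q eq] := res_eq (etrans (esym ex) h1).
have h4 := edge_shift hF q h3; rewrite -eq in h4.
have h5 : etgt e = res n0 (y' + q * n%:Z) by rewrite res_shift.
rewrite -(disp_unique ex h5) //.
by have := edge_disp_range h4; case: ifP => _; lia.
Qed.

Lemma walk_steps (W : seq (edge N)) e x : all (in_S k) (e :: W) -> path (@follows _ N) e W ->
  esrc e = res n0 x -> walkZ F k x (steps (e :: W)).
Proof.
elim: W e x => [|f W IH] e x /=.
  by rewrite andbT => h _ ex; split=> //; exact: in_S_edge.
case/and3P=> h1 h2 h3 /andP[/eqP ef h4] ex; split; first exact: in_S_edge.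
by apply: IH => //=; rewrite ?h2 // -ef res_disp.
Qed.

Lemma steps_vertex (W : seq (edge N)) e x r : path (@follows _ N) e W ->
  esrc e = res n0 x -> (r < size (e :: W))%N ->
  res n0 (x + dispW (take r (steps (e :: W)))) \in [seq esrc f | f <- e :: W].
Proof.
elim: W e x r => [|f W IH] e x [|r] //=.
- by rewrite /dispW big_nil addr0 => _ -> _; rewrite mem_head.
- by rewrite /dispW big_nil addr0 => _ -> _; rewrite mem_head.
case/andP=> /eqP ef h ex hr; rewrite dispW_cons addrA inE; apply/orP; right.
by apply: IH => //; rewrite -ef res_disp.
Qed.
End Walks.

(** * The order of the extremes in terms of F *)

Section GoodPca.
Variables (R : realFieldType) (N : model R).
Local Notation n := (narcs N).
Local Notation c := (clen N).
Variable n0 : (0 < n)%N.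
Hypothesis hN : good n0.
Let c0 := good_len hN.
Let rng := good_range hN.
Let hbeg := good_beg hN.
Local Notation F := (reach n0).

Definition key (e : extreme N) : R := cw c (origin N) (pt e).

(* The lift of an ending point to the turn that starts at the initial arc. *)
Definition home (A : arc_of N) : int := A%:Z - (if F A%:Z < n%:Z then 0 else n%:Z).

Lemma origin_beg : origin N = beg (res n0 0).
Proof.
have sz : (0 < size (enum 'I_n))%N by rewrite size_enum_ord.
rewrite /origin -nth0 /codom /image_mem (nth_map (res n0 0)) //; congr beg.
by apply: val_inj; rewrite /= nth_enum_ord // mod0z.
Qed.

Lemma key_beg (A : arc_of N) : key (true, A) = posS n0 A%:Z - posS n0 0.
Proof.
rewrite /key origin_beg /pt /= -{1}(res_ord n0 A) (cw_SS n0 c0 rng hbeg) //.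
by have := ltn_ord A; lia.
Qed.

Lemma key_fin (A : arc_of N) : key (false, A) = posT n0 (home A) - posS n0 0.
Proof.
rewrite /key origin_beg /pt /=; have [b eb] := posT_fin n0 (home A).
have eh : res n0 (home A) = A.
  rewrite /home; case: ifP => _; first by rewrite subr0 res_ord.
  by have := res_shift n0 A%:Z (-1); rewrite mulN1r => ->; rewrite res_ord.
have l : posS n0 0 <= posT n0 (home A) < posS n0 0 + c.
  have lA := ltn_ord A.
  have := posS_shift n0 0 1; rewrite !mul1r add0r => e.
  rewrite -e ltW; last first.
    rewrite (reach_leE hN) /home; case: ifP => h; first by rewrite subr0; have := reach_ge n0 A%:Z; lia.
    by have := reach_shift n0 A%:Z (-1); rewrite mulN1r => ->; lia.
  rewrite (reach_ltE hN) /home; case: ifP => h; first by rewrite subr0.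
  have := reach_shift n0 A%:Z (-1); rewrite mulN1r => ->; have := reach_lt hN A%:Z; lia.
rewrite eh in eb; rewrite eb; apply: cw_lift => //; [exact: beg_range|exact: fin_range|].
by rewrite -eb -/(posS n0 0); lra.
Qed.

(** Only n and F occur here, no coordinates; this is why models with the same n and F are
    equivalent. *)
Definition ext_le (e f : extreme N) : bool :=
  match e, f with
  | (true, A), (true, B) => (A <= B)%N
  | (true, A), (false, B) => A%:Z <= F (home B)
  | (false, A), (true, B) => F (home A) < B%:Z
  | (false, A), (false, B) => home A <= home B
  end.

Lemma key_le e f : (key e <= key f) = ext_le e f.
Proof.
case: e f => [[] A] [[] B]; rewrite ?key_beg ?key_fin lerD2r /ext_le.
- by rewrite (posS_leE n0 c0 rng hbeg).
- by rewrite le_eqVlt (negPf (good_ST hN _ _)) (reach_leE hN).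
- by rewrite le_eqVlt eq_sym (negPf (good_ST hN _ _)) (reach_ltE hN).
- by rewrite (posT_leE hN).
Qed.

Lemma home_inj : injective home.
Proof.
move=> A B e; apply: val_inj; have := ltn_ord A; have := ltn_ord B.
by move: e; rewrite /home; case: ifP => _; case: ifP => _ /=; lia.
Qed.

Lemma key_inj : injective key.
Proof.
move=> e f h; have := key_le e f; have := key_le f e; rewrite h lexx => /esym + /esym.
case: e f {h} => [[] A] [[] B] /=; try lia.
  by move=> h1 h2; congr (_, _); apply: val_inj => /=; lia.
by move=> h1 h2; congr (_, _); apply: home_inj; lia.
Qed.

(** Conversely F can be read off the order of the extremes: count the beginning points up to t(A),
    and add a turn if t(A) comes before s(A). *)
Lemma reach_key (A : arc_of N) : F A%:Z =
  (#|[set B | key (true, B) <= key (false, A)]|)%:Z - 1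
  + (if key (true, A) <= key (false, A) then 0 else n%:Z).
Proof.
have lA := ltn_ord A; have g := reach_ge n0 A%:Z; have l := reach_lt hN A%:Z.
have eF : F (home A) = F A%:Z - (if F A%:Z < n%:Z then 0 else n%:Z).
  rewrite /home; case: ifP => _; first by rewrite !subr0.
  by have := reach_shift n0 A%:Z (-1); rewrite mulN1r.
have -> : #|[set B | key (true, B) <= key (false, A)]| = (absz (F (home A))).+1.
  have lt : ((absz (F (home A))).+1 <= n)%N by rewrite eF; case: ifP; lia.
  have hr : 0 <= F (home A) by rewrite eF; case: ifP; lia.
  have wi : injective (widen_ord lt) by move=> i j /(congr1 val) /= e; apply: val_inj.
  rewrite -[RHS](card_ord) -(card_imset _ wi).
  apply: eq_card => B; rewrite inE key_le /=; apply/idP/imsetP.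
    move=> h; have h' : (B < (absz (F (home A))).+1)%N by lia.
    by exists (Ordinal h') => //; apply: val_inj.
  by move=> [j _ ->] /=; have := ltn_ord j; lia.
rewrite key_le /= eF; case: ifP => h; case: ifP; lia.
Qed.

Lemma good_pca : is_pca N.
Proof.
split; [exact: c0 | exact: rng | exact: hbeg | |].
  by move=> e f h; apply: key_inj; rewrite /key h.
move=> A B AB hs.
have [y [ey _ _]] := res_lift_ge n0 0 B.
have [x [ex x1 x2]] := res_lift_ge n0 y A.
have xy : y < x.
  by rewrite lt_neqAle x1 andbT; apply: contraNneq AB => e; rewrite ex ey e.
have s1 : posS n0 y < posS n0 x by rewrite posS_ltE.
have s2 : posS n0 x < posS n0 y + c.
  by have := posS_shift n0 y 1; rewrite !mul1r => <-; rewrite posS_ltE.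
have t1 : posT n0 y < posT n0 x by exact: (good_T hN).
have /andP[r1 r2] := posT_range n0 rng x.
have /andP[r3 r4] := posT_range n0 rng y.
have r5 : posS n0 x < posT n0 x by rewrite lt_neqAle r1 (good_ST hN).
have key p : posS n0 x < p < posT n0 x -> p < posS n0 y + c -> p < posT n0 y.
  move=> /andP[p1 p2] p3.
  have [q [b eb hq]] : exists q : R, exists2 b : int, p = q + b%:~R * c & 0 <= q < c.
    exists (p - (y %/ n%:Z)%Z%:~R * c - (if c <= p - (y %/ n%:Z)%Z%:~R * c then c else 0)).
    exists ((y %/ n%:Z)%Z + (if c <= p - (y %/ n%:Z)%Z%:~R * c then 1 else 0)).
      by case: ifP => _; rewrite rmorphD /= ?mulr0z; ring.
    have e : posS n0 y = beg (res n0 y) + (y %/ n%:Z)%Z%:~R * c by [].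
    move: e (beg_range rng (res n0 y)); set t := _ * c => e /andP[b1 b2].
    by case: (leP c (p - t)) => h; apply/andP; split; lra.
  have := hs q hq; rewrite /in_arc ex ey.
  have -> : cw c (beg (res n0 x)) q = p - posS n0 x.
    by rewrite eb; apply: cw_lift; rewrite ?beg_range // -eb -/(posS n0 x); lra.
  have -> : cw c (beg (res n0 y)) q = p - posS n0 y.
    by rewrite eb; apply: cw_lift; rewrite ?beg_range // -eb -/(posS n0 y); lra.
  have -> : cw c (beg (res n0 x)) (fin (res n0 x)) = posT n0 x - posS n0 x by rewrite /posT addrC addKr.
  have -> : cw c (beg (res n0 y)) (fin (res n0 y)) = posT n0 y - posS n0 y by rewrite /posT addrC addKr.
  by move=> h; have : 0 < p - posS n0 y < posT n0 y - posS n0 y by [apply: h; lra]; lra.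
have /negPf ne := good_ST hN x y.
(* If A begins inside B, the ending point of B lies in A but not in B. Otherwise any point of A
   before the next copy of s(B) will do. *)
have [lt|gt|e] := ltgtP (posS n0 x) (posT n0 y); last by rewrite e eqxx in ne.
  by have := key (posT n0 y); lra.
have [m [m1 m2 m3]] : exists m, [/\ posS n0 x < m, m < posT n0 x & m < posS n0 y + c].
  have [l|l] := leP (posT n0 x) (posS n0 y + c).
    by exists ((posS n0 x + posT n0 x) / 2%:R); split; lra.
  by exists ((posS n0 x + (posS n0 y + c)) / 2%:R); split; lra.
by have := key m; lra.
Qed.
End GoodPca.

(** * Equivalence and multiplicative models *)

Section Equiv.
Variables (R : realFieldType) (M N : model R).
Variables (m0 : (0 < narcs M)%N) (n0 : (0 < narcs N)%N).
Hypothesis hM : good m0.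
Hypothesis hN : good n0.

Lemma reach_equivalent : narcs M = narcs N -> (forall x, reach m0 x = reach n0 x) ->
  equivalent M N.
Proof.
move=> hn hF; exists (cast_ord hn); split.
  by exists (cast_ord (esym hn)) => A; [exact: cast_ordK|exact: cast_ordKV].
pose phi (e : extreme M) : extreme N := (e.1, cast_ord hn e.2).
rewrite -[LHS]/(map phi (extreme_seq M)).
have hn' : (narcs M)%:Z = (narcs N)%:Z by rewrite hn.
have hh (A : arc_of M) : home m0 A = home n0 (cast_ord hn A) by rewrite /home hF hn'.
have e1 : (fun e f : extreme M => key e <= key f) =2 relpre phi (fun e f => key e <= key f).
  move=> e f /=; rewrite (key_le hM) (key_le hN) /phi.
  by case: e f => [[] A] [[] B] /=; rewrite ?hh ?hF.
apply: (@sorted_eq _ (fun e f : extreme N => key e <= key f)).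
- by move=> e f g; exact: le_trans.
- by move=> e f h; apply: (key_inj hN); exact: le_anti.
- rewrite sorted_map -(eq_sorted e1); apply: sort_sorted => e f; exact: le_total.
- by apply: sort_sorted => e f; exact: le_total.
have pM : perm_eq (extreme_seq M) (enum {: bool * 'I_(narcs M)}) by rewrite perm_sort.
have pN : perm_eq (enum {: bool * 'I_(narcs N)}) (extreme_seq N) by rewrite perm_sym perm_sort.
apply: perm_trans (perm_map phi pM) _; apply: perm_trans pN.
apply: uniq_perm; rewrite ?enum_uniq //.
  rewrite map_inj_uniq ?enum_uniq // => -[b A] [b' A'] h.
  by rewrite (congr1 fst h : b = b') (cast_ord_inj (congr1 snd h) : A = A').
move=> [b A]; rewrite mem_enum inE; apply/mapP.
by exists (b, cast_ord (esym hn) A); rewrite ?mem_enum // /phi /= cast_ordKV.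
Qed.

Lemma incr_ord_ge p q (f : 'I_p -> 'I_q) :
  (forall A B : 'I_p, (A < B)%N -> (f A < f B)%N) -> forall A : 'I_p, (A <= f A)%N.
Proof.
move=> hf [a]; elim: a => [//|a IH] ha /=.
by apply: leq_ltn_trans (IH (ltnW ha)) _; apply: hf.
Qed.

Lemma equivalent_reach : equivalent M N ->
  narcs M = narcs N /\ forall x, reach m0 x = reach n0 x.
Proof.
move=> [f [bf]]; pose phi (e : extreme M) : extreme N := (e.1, f e.2).
rewrite -[X in X = _ -> _]/(map phi (extreme_seq M)) => hs.
have inj_phi : injective phi.
  move=> [b A] [b' A'] h.
  by rewrite (congr1 fst h : b = b') (bij_inj bf (congr1 snd h) : A = A').
have trN : transitive (fun e f : extreme N => key e <= key f) by move=> e g h; exact: le_trans.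
have trM : transitive (fun e f : extreme M => key e <= key f) by move=> e g h; exact: le_trans.
have sortedM : sorted (fun e f : extreme M => key e <= key f) (extreme_seq M).
  by apply: sort_sorted => e g; exact: le_total.
have sortedN : sorted (fun e f : extreme N => key e <= key f) (extreme_seq N).
  by apply: sort_sorted => e g; exact: le_total.
have inM e : e \in extreme_seq M by rewrite mem_sort mem_enum.
have imp e g : key e <= key g -> key (phi e) <= key (phi g).
  have [-> //|ne] := eqVneq e g => le.
  have ix : (index e (extreme_seq M) <= index g (extreme_seq M))%N.
    rewrite leqNgt; apply/negP => lt.
    have ge : key g <= key e.
      by apply: (sorted_leq_index trM (fun e => lexx _) sortedM g e); rewrite ?inM // ltnW.
    by case/eqP: ne; apply: (key_inj hM); apply: le_anti; rewrite le.
  have := sorted_leq_index trN (fun e => lexx _) sortedN; rewrite -hs; apply.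
  - exact: map_f.
  - exact: map_f.
  - by rewrite !index_map.
have iff e g : (key (phi e) <= key (phi g)) = (key e <= key g).
  apply/idP/idP => [le|/imp//]; rewrite leNgt; apply/negP => lt.
  have := imp _ _ (ltW lt) => ge.
  have /inj_phi e1 : phi e = phi g by apply: (key_inj hN); apply: le_anti; rewrite le.
  by rewrite e1 ltxx in lt.
have hn : narcs M = narcs N.
  by have := bij_eq_card bf; rewrite !card_ord.
have fle (A B : arc_of M) : (f A <= f B)%N = (A <= B)%N.
  by have := iff (true, A) (true, B); rewrite (key_le hM) (key_le hN).
have flt (A B : arc_of M) : (f A < f B)%N = (A < B)%N by rewrite !ltnNge fle.
have fval (A : arc_of M) : f A = A :> nat.
  have [g fK gK] := bf; apply/eqP; rewrite eqn_leq; apply/andP; split.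
    rewrite -{2}(fK A); apply: incr_ord_ge => B C BC.
    by rewrite -flt !gK.
  by apply: incr_ord_ge => B C; rewrite flt.
have hn' : (narcs M)%:Z = (narcs N)%:Z by rewrite hn.
split=> // x; rewrite (resE m0 x); move: (res m0 x) (x %/ _)%Z => A q.
rewrite reach_shift hn' reach_shift; congr (_ + _).
rewrite (reach_key hM) -(fval A) (reach_key hN) hn'.
rewrite -[(true, f A)]/(phi (true, A)) -[(false, f A)]/(phi (false, A)) iff.
congr (_%:Z - 1 + _); rewrite -(card_imset _ (bij_inj bf)).
apply: eq_card => C; rewrite !inE; apply/imsetP/idP.
  by move=> [B]; rewrite inE => h ->; rewrite -[(true, f B)]/(phi (true, B)) iff.
have [g fK gK] := bf; move=> h; exists (g C); rewrite ?gK // inE -iff /phi /=.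
by rewrite gK.
Qed.
End Equiv.

Lemma is_lift_ext n F G : (forall x, F x = G x) -> is_lift n F -> is_lift n G.
Proof. by move=> e [h1 h2 h3 h4]; split=> *; rewrite -?e; auto. Qed.

Lemma iter_ext (F G : int -> int) i x : (forall x, F x = G x) -> iter i F x = iter i G x.
Proof. by move=> e; elim: i => //= i ->. Qed.

(* [s] is an integer solution of the difference constraints that state that
   the arcs (s x, s x + l + 1) realize F and that its powers are multiples. *)
Definition potential (n : nat) (F : int -> int) (k c l : nat) (s : int -> int) : Prop :=
  [/\ forall x q : int, s (x + q * n%:Z) = s x + q * c%:Z,
      forall x, s (F x) <= s x + l%:Z
    & forall (i : nat) x, (i <= k)%N -> s x + i%:Z * l%:Z + 2 <= s (iter i F x + 1)].

Section Incr.
Variable s : int -> int.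
Hypothesis s_inc : forall x, s x < s (x + 1).

Lemma s_lt x y : x < y -> s x < s y.
Proof.
move=> xy; have -> : y = x + (absz (y - x)).-1.+1%:Z by lia.
elim: (absz (y - x)).-1 => [|d IH]; first exact: s_inc.
apply: (lt_trans IH); have -> : x + d.+2%:Z = x + d.+1%:Z + 1 by lia.
exact: s_inc.
Qed.

Lemma s_lt_inv x y : s x < s y -> x < y.
Proof. by move=> h; have [//|/s_lt|e] := ltgtP x y; [lia | rewrite e ltxx in h]. Qed.

End Incr.

Section IntModel.
Variables (R : realFieldType) (n c : nat) (s : int -> int).
Variable n0 : (0 < n)%N.
Hypothesis c0 : (0 < c)%N.
Hypothesis s_shift : forall x q : int, s (x + q * n%:Z) = s x + q * c%:Z.
Hypothesis s_inc : forall x, s x < s (x + 1).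
Hypothesis s0 : s 0 = 0.

(** One construction for all multiples: q = l + 1 gives the model U, and q = i * l + 1 gives i times
    U. *)
Definition int_model (q : nat) : model R :=
  @Model R c%:R n (fun A : 'I_n => (s A%:Z)%:~R)
    (fun A => Defs.wrap c%:R ((s A%:Z)%:~R + q%:R)).

Lemma s_range (A : 'I_n) : 0 <= s A%:Z < c%:Z.
Proof.
have := s_shift 0 1; rewrite !mul1r add0r s0 => e; have lA := ltn_ord A.
apply/andP; split; last by have := @s_lt s s_inc A%:Z n%:Z; rewrite e; apply; lia.
have [->|ne] := eqVneq A%:Z 0; first by rewrite s0.
by have := @s_lt s s_inc 0 A%:Z; rewrite s0; lia.
Qed.

Lemma int_posS q x : posS (N := int_model q) n0 x = (s x)%:~R.
Proof.
by rewrite {2}(resE n0 x) s_shift rmorphD rmorphM.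
Qed.

Lemma int_beg_range (A : 'I_n) : 0 <= ((s A%:Z)%:~R : R) < c%:R.
Proof. by rewrite ler0z pmulrn ltr_int; exact: s_range. Qed.

Section Width.
Variables (q : nat) (qc : (q < c)%N).

Lemma int_fin_range (A : 'I_n) : 0 <= Defs.wrap c%:R ((s A%:Z)%:~R + q%:R : R) < c%:R.
Proof.
apply: wrap_range; have := int_beg_range A; have : 0 <= (q%:R : R) < c%:R by rewrite ler0n ltr_nat.
lra.
Qed.

Lemma int_cw (A : 'I_n) :
  cw c%:R (s A%:Z)%:~R (Defs.wrap c%:R ((s A%:Z)%:~R + q%:R)) = q%:R :> R.
Proof.
have [b eb] := wrap_congr c%:R ((s A%:Z)%:~R + q%:R : R).
have c0' : 0 < c%:R :> R by rewrite ltr0n.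
have qr : 0 <= (q%:R : R) < c%:R by rewrite ler0n ltr_nat.
have e : (Defs.wrap c%:R ((s A%:Z)%:~R + q%:R) + (- b)%:~R * c%:R)
    - ((s A%:Z)%:~R + 0%:~R * c%:R) = q%:R :> R.
  by rewrite eb rmorphN /=; ring.
by rewrite -[RHS]e; apply: cw_lift => //; rewrite ?int_beg_range ?int_fin_range ?e.
Qed.

Lemma int_posT x : posT (N := int_model q) n0 x = (s x + q%:Z)%:~R.
Proof.
by rewrite /posT int_posS rmorphD; congr (_ + _); exact: (int_cw (res n0 x)).
Qed.

Variable G : int -> int.
Hypothesis hG : forall x, s (G x) < s x + q%:Z < s (G x + 1).

Lemma int_good : good (N := int_model q) n0.
Proof.
split.
- by rewrite /= ltr0n.
- by case=> [[] A]; [exact: int_beg_range | exact: int_fin_range].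
- by move=> A B AB; rewrite /= ltr_int; apply: (s_lt s_inc); rewrite ltz_nat.
- by move=> x y xy; rewrite !int_posT ltr_int ltrD2r; apply: (s_lt s_inc).
- move=> x y; rewrite int_posS int_posT eqr_int; apply/eqP => e.
  have /andP[] := hG y; rewrite -e => /(s_lt_inv s_inc) h1 /(s_lt_inv s_inc) h2; lia.
Qed.

Lemma int_reach x : reach (N := int_model q) n0 x = G x.
Proof.
apply/esym/(reach_uniq int_good); rewrite !int_posS int_posT !ltr_int.
exact: hG.
Qed.
End Width.
End IntModel.

Section Realize.
Variables (R : realFieldType) (M : model R).
Local Notation n := (narcs M).
Variable n0 : (0 < n)%N.
Hypothesis hM : good n0.
Local Notation F := (reach n0).
Hypothesis hF : is_lift n F.
Variable k : nat.
Hypothesis k1 : (1 <= k)%N.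
Hypothesis hk : forall i x, (i <= k)%N -> iter i F x < x + n%:Z.

Lemma potential_model c l s : potential n F k c l s ->
  exists U : model R, equivalent M U /\ k_multiplicative k U.
Proof.
case=> hs0 hs1 hs2; pose t x := s x - s 0.
have t_shift x q : t (x + q * n%:Z) = t x + q * c%:Z by rewrite /t hs0 addrAC.
have tF i x : t (iter i F x) <= t x + i%:Z * l%:Z.
  elim: i x => [|i IH] x; first by rewrite /=; lia.
  by have := hs1 (iter i F x); have := IH x; rewrite /t /=; lia.
have tN i x : (i <= k)%N -> t x + i%:Z * l%:Z + 2 <= t (iter i F x + 1).
  by move=> /hs2 => /(_ x); rewrite /t; lia.
have t_inc x : t x < t (x + 1) by have := tN 0%N x isT; rewrite /=; lia.
have t0 : t 0 = 0 by rewrite /t subrr.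
have ilc i : (i <= k)%N -> ((i * l).+1 < c)%N.
  move=> ik; have h := tN i 0 ik; have := hk 0 ik; rewrite add0r => lt.
  have := t_shift 0 1; rewrite !mul1r add0r t0 => e.
  have : t (iter i F 0 + 1) <= t n%:Z.
    have [->//|ne] := eqVneq (iter i F 0 + 1) n%:Z.
    by apply: ltW; apply: (s_lt t_inc); lia.
  by rewrite e t0 in h *; lia.
have c0 : (0 < c)%N by have := ilc 0%N isT; lia.
(* The slack 2 is what fits the ending point, at distance i * l + 1, strictly between two
   consecutive beginning points. *)
have hG i x : (i <= k)%N -> t (iter i F x) < t x + (i * l).+1%:Z < t (iter i F x + 1).
  by move=> ik; have := tF i x; have := tN i x ik; lia.
have hG1 x : t (F x) < t x + l.+1%:Z < t (F x + 1).
  by have := hG 1%N x k1; rewrite mul1n.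
have lc : (l.+1 < c)%N by have := ilc 1%N k1; rewrite mul1n.
pose U := int_model R n c t l.+1.
have gU : good (N := U) n0 by exact: (int_good R n0 c0 t_shift t_inc t0 lc hG1).
have rU x : reach (N := U) n0 x = F x by exact: (int_reach R n0 c0 t_shift t_inc t0 lc hG1).
have liftU : is_lift n (reach (N := U) n0) by apply: is_lift_ext hF => x; rewrite rU.
have pU : is_pca U by apply: good_pca gU.
have eqlen q i : (q < c)%N -> (forall x, t (iter i F x) < t x + q%:Z < t (iter i F x + 1)) ->
    is_uca (int_model R n c t q) /\ forall A : 'I_n, arc_len (A : arc_of (int_model R n c t q)) = q%:R.
  move=> qc h; have len (A : 'I_n) : arc_len (A : arc_of (int_model R n c t q)) = q%:R.
    exact: int_cw.
  split=> //; split; last by move=> A B; rewrite (len A) (len B).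
  by apply: (@good_pca R (int_model R n c t q) n0); apply: (int_good R n0 c0 t_shift t_inc t0 qc h).
exists U; split.
  by apply: (reach_equivalent hM gU) => // x; rewrite rU.
exists c, l; split.
  have [u1 u2] := eqlen l.+1 1%N lc hG1; split=> //.
  case=> [[] A].
    by exists (absz (t A%:Z)); rewrite /pt /= pmulrn; have := s_range n0 c0 t_shift t_inc t0 A; case: (t A%:Z).
  rewrite /pt /= /Defs.wrap; case: ifP => h.
    exists (absz (t A%:Z + l.+1%:Z)%R); rewrite !pmulrn -rmorphD /=; congr (_%:~R).
    have := s_range n0 c0 t_shift t_inc t0 A; lia.
  exists (absz (t A%:Z + l.+1%:Z - c%:Z)%R); rewrite !pmulrn -rmorphD -rmorphB /=; congr (_%:~R).
  move: h; rewrite !pmulrn -rmorphD ltr_int /=; lia.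
move=> i ik; have lt := ilc i ik.
have -> : times c l i U = int_model R n c t (i * l).+1.
  by rewrite -[in RHS](modn_small lt).
have [u1 _] := eqlen _ _ lt (fun x => hG i x ik); split=> //.
have g1 : good (N := int_model R n c t (i * l).+1) n0.
  exact: (int_good R n0 c0 t_shift t_inc t0 lt (fun x => hG i x ik)).
have hiU x : iter i (reach (N := U) n0) x < x + n%:Z by rewrite (iter_ext i x rU); exact: hk.
have g2 : good (N := power U i) n0 by apply: power_good.
apply: (reach_equivalent g1 g2) => // x.
rewrite (power_reach (N := U)) // (iter_ext i x rU).
exact: (int_reach R n0 c0 t_shift t_inc t0 lt (fun x => hG i x ik)).
Qed.

Lemma model_potential : (exists U : model R, equivalent M U /\ k_multiplicative k U) ->
  exists c l s, potential n F k c l s.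
Proof.
case=> U [eqU [c [l [[[pU _] clU lenU ptU] hi]]]].
have un : narcs M = narcs U.
  by have [f [/bij_eq_card]] := eqU; rewrite !card_ord.
have u0 : (0 < narcs U)%N by rewrite -un.
have gU := pca_good u0 pU.
have [_ rU] := equivalent_reach hM gU eqU.
have liftU : is_lift (narcs U) (reach u0) by rewrite -un; apply: is_lift_ext hF.
have ex (A : arc_of U) : exists m : nat, beg A = m%:R by exact: (ptU (true, A)).
have [m hm] := fin_all_exists ex.
pose s x := (m (res u0 x))%:Z + (x %/ (narcs U)%:Z)%Z * c%:Z.
have posSU x : posS u0 x = (s x)%:~R.
  by rewrite /posS hm clU /s rmorphD rmorphM /= -!pmulrn.
clearbody s; have c0 : 0 < clen U := good_len gU.
have s_shift x q : s (x + q * (narcs U)%:Z) = s x + q * c%:Z.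
  apply: (@intr_inj R); rewrite -posSU posS_shift posSU clU.
  by rewrite rmorphD rmorphM.
have s_ltE x y : (s x < s y) = (x < y).
  have h := posS_ltE u0 c0 (good_range gU) (good_beg gU) x y.
  by rewrite -h !posSU ltr_int.
have c1 : (0 < c)%N by move: c0; rewrite clU ltr0n.
pose q i := ((i * l).+1 %% c)%N.
have spec i x : (i <= k)%N -> s (iter i F x) < s x + (q i)%:Z < s (iter i F x + 1).
  move=> ik; have [[pT _] eqT] := hi i ik.
  have gT : good (N := times c l i U) u0 := pca_good (N := times c l i U) u0 pT.
  have hiU z : iter i (reach u0) z < z + (narcs U)%:Z.
    by rewrite -(iter_ext i z rU) -un; exact: hk.
  have gP : good (N := power U i) u0 by apply: power_good.
  have [_ rT] := equivalent_reach gT gP eqT.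
  have qr : 0 <= ((q i)%:R : R) < clen U by rewrite clU ler0n ltr_nat ltn_mod.
  have pT' : posT (N := times c l i U) u0 x = posS u0 x + (q i)%:R.
    rewrite /posT -[posS (N := times c l i U) u0 x]/(posS u0 x) /=; congr (_ + _).
    have rb := beg_range (good_range gU) (res u0 x).
    have [b eb] := wrap_congr (clen U) (beg (res u0 x) + (q i)%:R).
    have e : (Defs.wrap (clen U) (beg (res u0 x) + (q i)%:R) + (- b)%:~R * clen U)
        - (beg (res u0 x) + 0%:~R * clen U) = (q i)%:R.
      by rewrite eb rmorphN /=; ring.
    rewrite -[RHS]e; apply: cw_lift; rewrite ?e //.
    exact: (good_range gT (false, res u0 x)).
  have := reach_spec gT x; rewrite rT (power_reach (N := U)) // -(iter_ext i x rU) pT'.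
  rewrite -![posS (N := times c l i U) u0 _]/(posS u0 _) !posSU.
  by rewrite pmulrn -rmorphD !ltr_int.
(* The lengths are known only modulo c. If i + 1 were the first index to wrap around, comparison
   with the lengths for i and 1 would force F y + n <= F (y + 1) at y = iter i F 0, although F (y +
   1) < y + 1 + n. *)
have qE i : (i <= k)%N -> q i = (i * l).+1.
  have lc : (l.+1 < c)%N.
    rewrite -(ltr_nat R) -clU -(lenU (res u0 0)); rewrite /arc_len.
    have := cw_range (beg_range (good_range gU) (res u0 0)) (fin_range (good_range gU) (res u0 0)).
    by case/andP.
  elim: i => [|i IH] ik; first by rewrite /q mul0n modn_small //; lia.
  have ei := IH (ltnW ik).
  have [lt|ge] := ltnP (i.+1 * l).+1 c; first by rewrite /q modn_small.
  have qi : (q i < c)%N by rewrite /q ltn_mod.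
  have e : q i.+1 = ((i.+1 * l).+1 - c)%N.
    by rewrite /q -{1}(subnK ge) modnDr modn_small //; move: ei ge; rewrite mulSn; lia.
  have /andP[_ h1] := spec i.+1 0 ik; have /andP[h0 h2] := spec i 0 (ltnW ik).
  have /andP[h3 h3'] := spec 1%N (iter i F 0 + 1) k1.
  have /andP[h4 _] := spec i.+1 0 ik; rewrite /= in h3 h3' h4.
  have q1 : q 1%N = l.+1 by rewrite /q mul1n modn_small.
  have := s_shift (F (iter i F 0)) 1; rewrite !mul1r => sh.
  have : s (F (iter i F 0) + (narcs U)%:Z) < s (F (iter i F 0 + 1) + 1).
    move: ge; rewrite sh e q1 mulSn in h4 h3' *; rewrite ei in h2; lia.
  rewrite s_ltE => lt1; have := lift_lt hF (iter i F 0 + 1); have := lift_gt hF (iter i F 0).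
  by rewrite un; lia.
exists c, l, s; split.
- by rewrite un.
- by move=> x; have := spec 1%N x k1; rewrite (qE 1%N k1) mul1n /=; lia.
- by move=> i x ik; have := spec i x ik; rewrite (qE i ik); lia.
Qed.
End Realize.

(** * Forward copies in the unrolled graph *)

Section Unroll.
Variables (R : realFieldType) (M : model R).
Local Notation n := (narcs M).
Local Notation c := (clen M).
Variable n0 : (0 < n)%N.
Hypothesis hM : good n0.
Variable lam : nat.
Hypothesis lam0 : (0 < lam)%N.
Let U := unroll lam M.
Variable u0 : (0 < narcs U)%N.

Let c0 := good_len hM.

Lemma copied_arc_res z : copied_arc (res u0 z : 'I_(lam * n)) = res n0 z.
Proof.
apply: val_inj => /=; apply/eqP; rewrite -eqz_nat -modz_nat.
have e x d : (0 < d)%N -> (absz (x %% d%:Z)%Z)%:Z = (x %% d%:Z)%Z by lia.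
rewrite !e // PoszM {2}(divz_eq z (lam%:Z * n%:Z)) mulrA modzMDl.
by rewrite eqxx.
Qed.

Lemma unroll_beg (a : arc_of U) : beg a = posS n0 a%:Z.
Proof.
rewrite -{1}(res_ord u0 a) /= copied_arc_res /posS /=; congr (_ + _).
have la : (a < narcs U)%N := ltn_ord a.
by rewrite modz_small ?absz_nat ?divz_nat //; lia.
Qed.

Lemma unroll_posS x : posS (N := U) u0 x = posS n0 x.
Proof.
rewrite {2}(resE u0 x) /posS unroll_beg.
have -> : (x %/ (narcs U)%:Z)%Z * (narcs U)%:Z = ((x %/ (narcs U)%:Z)%Z * lam%:Z) * n%:Z.
  by rewrite /U /= PoszM mulrA.
rewrite -/(posS n0 _) posS_shift intrM -mulrA; congr (_ + _ * _).
Qed.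


Lemma unroll_fin (a : arc_of U) : fin a = Defs.wrap (clen U) (posT n0 a%:Z).
Proof.
rewrite -{1}(res_ord u0 a) /= copied_arc_res; congr (Defs.wrap _ _).
have la : (a < narcs U)%N := ltn_ord a.
rewrite modz_small; last by rewrite lez_nat ltz_nat.
rewrite /posT /posS absz_nat divz_nat /cw.
have [e|e] := leP (beg (res n0 a%:Z)) (fin (res n0 a%:Z)).
  by rewrite addn0 -pmulrn; ring.
by rewrite addn1 -natr1 -pmulrn; ring.
Qed.

Lemma turn_lt (a : arc_of U) : 0 <= posS n0 a%:Z < clen U.
Proof.
have /andP[b1 b2] := beg_range (good_range hM) (res n0 a%:Z).
have la : (a < lam * n)%N := ltn_ord a.
have q1 : (a %/ n < lam)%N by rewrite ltn_divLR.
rewrite /posS divz_nat -pmulrn /U /=; apply/andP; split.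
  by rewrite addr_ge0 // mulr_ge0 ?ler0n // ltW.
apply: (lt_le_trans (y := (a %/ n).+1%:R * c)).
  by rewrite -natr1 mulrDl mul1r addrC ltrD2l.
by rewrite ler_pM2r // ler_nat.
Qed.

Lemma clen_ge : c <= clen U.
Proof. by rewrite /U /= -[leLHS]mul1r ler_pM2r // ler1n. Qed.

Lemma unroll_fin_range (a : arc_of U) : 0 <= fin a < clen U.
Proof.
rewrite unroll_fin; apply: wrap_range.
have := turn_lt a; have /andP[t1 t2] := posT_range n0 (good_range hM) a%:Z; have := clen_ge.
lra.
Qed.

Lemma unroll_posT x : posT (N := U) u0 x = posT n0 x.
Proof.
have key (a : arc_of U) : cw (clen U) (beg a) (fin a) = posT n0 a%:Z - posS n0 a%:Z.
  have [b eb] := wrap_congr (clen U) (posT n0 a%:Z).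
  have e : (fin a + (- b)%:~R * clen U) - (beg a + 0%:~R * clen U) = posT n0 a%:Z - posS n0 a%:Z.
    by rewrite unroll_fin unroll_beg eb rmorphN; ring.
  rewrite -e; apply: cw_lift; rewrite ?e ?unroll_fin_range ?unroll_beg ?turn_lt //.
    by rewrite /U /= mulr_gt0 ?ltr0n.
  have /andP[t1 t2] := posT_range n0 (good_range hM) a%:Z; have := clen_ge; lra.
rewrite {1}/posT key unroll_posS.
suff <- : posT n0 x - posS n0 x = posT n0 (res u0 x)%:Z - posS n0 (res u0 x)%:Z by ring.
have e : x = (res u0 x)%:Z + ((x %/ (narcs U)%:Z)%Z * lam%:Z) * n%:Z.
  by rewrite {1}(resE u0 x) /U /= PoszM mulrA.
by rewrite {1 2}e posS_shift posT_shift; ring.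
Qed.

Lemma unroll_good : good (N := U) u0.
Proof.
split.
- by rewrite /U /= mulr_gt0 ?ltr0n.
- by case=> [[] a]; [have := turn_lt a; rewrite -unroll_beg | exact: unroll_fin_range].
- move=> a b ab; rewrite !unroll_beg (posS_ltE n0 c0 (good_range hM) (good_beg hM)).
  by rewrite ltz_nat.
- by move=> x y xy; rewrite !unroll_posT; exact: (good_T hM).
- by move=> x y; rewrite unroll_posS unroll_posT; exact: (good_ST hM).
Qed.

Lemma unroll_reach x : reach (N := U) u0 x = reach n0 x.
Proof.
apply/esym/(reach_uniq unroll_good); rewrite !unroll_posS unroll_posT.
exact: (reach_spec hM).
Qed.
End Unroll.

(** * Rows and forward edges of a model *)

Section Rows.
Variables (R : realFieldType) (N : model R).
Local Notation n := (narcs N).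
Variable n0 : (0 < n)%N.
Hypothesis hN : good n0.
Local Notation F := (reach n0).
Hypothesis hF : is_lift n F.

Lemma row_rec_res d (a : int) r : (absz a < d)%N -> 0 <= a < n%:Z -> is_row F a r ->
  row_rec d (res n0 a : arc_of N) = r.
Proof.
elim: d a r => [//|d IH] a r ad /andP[a0 an] hr.
have va : (res n0 a : nat) = absz a by rewrite /= modz_small ?a0.
have /andP[r1 r2] := hr.
rewrite [LHS]/=; case: eqP => [e|ne].
  have a00 : a = 0 by move: e => /=; rewrite modz_small ?a0 //; lia.
  apply/esym/(is_row_inj hF hr); rewrite a00; apply/andP; split=> //.
  by have := row_end_lt hF (ltnSn 0); rewrite {1}/row_end [iter 0 _ _]/=; lia.
have a1 : 0 < a.
  by rewrite lt_neqAle a0 andbT eq_sym; apply/eqP => e; apply: ne; rewrite e /= mod0z.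
case: pickP => [B /andP[Ba /eqP hB]|none].
  have lB := ltn_ord B; rewrite -(res_ord n0 B) in hB.
  have [a' [ea e1 e2]] := Hr_some hN hF hB.
  have Ba' : (B < absz a)%N by rewrite -va.
  have g := lift_gt hF (B%:Z - 1); have l := lift_lt hF B%:Z.
  have g2 : B%:Z < a'.
    have : F (B%:Z - 1) + 1 <> B%:Z by move=> e; have := lift_gt hF (B%:Z); lia.
    by lia.
  have e3 : a = a' by apply: (res_eq_near ea); lia.
  rewrite -e3 in e1 e2.
  have B0 : 0 <= B%:Z by [].
  have [r' hr'] := is_row_ex hF B0.
  rewrite -(res_ord n0 B) (IH B%:Z r') ?absz_nat //; try lia.
  apply: (is_row_inj hF _ hr); have /andP[h1 h2] := hr'.
  apply/andP; split; rewrite row_endS.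
    have h3 : row_end F r' <= B%:Z - 1 by lia.
    have := lift_mono hF h3; lia.
  by apply: (le_trans e2); rewrite row_endS; apply: (lift_mono hF).
rewrite (Lf_res n0); apply: IH; try lia.
apply/andP; split; last by lia.
have [//|ge] := ltP (row_end F r) (a - 1).
have ea : a - 1 = row_end F r by lia.
case: r hr r1 r2 ge ea => [|r] hr r1 r2 ge ea; first by rewrite /row_end /= in ea; lia.
(* If a - 1 ended a row, it would be F z for such a last z, and then a = H_r(z + 1) with z + 1 < a,
   against [none]. *)
have [z [z1 z2 z3]] := last_preimage hF (row_end F r).
rewrite -row_endS -ea in z2 z3.
have y0 : -1 <= row_end F r by exact: (row_end_le hF (leq0n r)).
have z4 := lift_gt hF z.
have hb : Hr (res n0 (z + 1) : arc_of N) = Some (res n0 a).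
  by apply: (Hr_res hN hF); rewrite ?addrK ?z2; lia.
have := none (res n0 (z + 1)); rewrite hb eqxx andbT /= !modz_small; lia.
Qed.

Lemma arc_row_res (a : int) r : 0 <= a < n%:Z -> is_row F a r ->
  arc_row (res n0 a : arc_of N) = r.
Proof. by move=> h hr; apply: row_rec_res => //=; rewrite modz_small. Qed.

(** The bound on a excludes the last arc of the model, which is rightmost even if its row is cut off
    there. The source of an internal nose always satisfies it. *)
Lemma rightmost_res (a : int) r : 0 <= a -> a + 1 < n%:Z -> is_row F a r ->
  rightmost (res n0 a : arc_of N) = (a == row_end F r.+1).
Proof.
move=> a0 an hr; have /andP[r1 r2] := hr.
have ha : arc_row (res n0 a : arc_of N) = r by apply: arc_row_res => //; lia.
apply/forallP/eqP => [/(_ (res n0 (a + 1)))|ea B].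
  rewrite ha => h; have [//|lt] : a = row_end F r.+1 \/ a < row_end F r.+1 by lia.
  exfalso; move: h; rewrite (@arc_row_res (a + 1) r) ?eqxx /=; try lia.
    by rewrite !modz_small; lia.
  by apply/andP; split; lia.
rewrite ha; apply/implyP => /eqP hB.
have lB := ltn_ord B.
have B0 : 0 <= B%:Z by [].
have [s hs] := is_row_ex hF B0.
have e := @arc_row_res B%:Z s; rewrite res_ord hB in e.
have {}e : r = s by apply: e => //; lia.
have /andP[_ s2] := hs; rewrite -e -ea in s2.
by rewrite /= modz_small; lia.
Qed.
End Rows.

Section Forward.
Variables (R : realFieldType) (N : model R).
Local Notation n := (narcs N).
Variable n0 : (0 < n)%N.
Hypothesis pN : is_pca N.
Let hN : good n0 := pca_good n0 pN.
Local Notation F := (reach n0).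
Hypothesis hF : is_lift n F.
Variable k : nat.
Hypothesis hk : forall i x, (i <= k)%N -> iter i F x < x + n%:Z.

Lemma internal_disp (e : edge N) : internal e -> (etgt e)%:Z = (esrc e)%:Z + disp e.
Proof. by rewrite /disp => ->; lia. Qed.

Lemma forward_forwardZ (W : seq (edge N)) e :
  path (@follows _ N) e W -> all (@forward _ N) (e :: W) ->
  forwardZ F (esrc e)%:Z (steps (e :: W)).
Proof.
have key (f : edge N) : forward f -> 0 <= (esrc f)%:Z /\ forall r, is_row F (esrc f)%:Z r ->
    is_nose_kind (ekind f) -> (esrc f)%:Z <> row_end F r.+1.
  case/andP=> hi hb; split=> // r hr hk0 e0; case/negP: hb; rewrite /backward hi hk0 /=.
  have lt : (esrc f)%:Z + 1 < n%:Z.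
    by move: hi; rewrite /internal hk0; have := ltn_ord (etgt f); lia.
  by rewrite -(res_ord n0 (esrc f)) (rightmost_res hN hF _ lt hr) // e0 eqxx.
elim: W e => [|f W IH] e.
  by rewrite /= andbT => _ /key.
move=> h /andP[h1 h2]; have /andP[/eqP ef h3] := h.
rewrite [forwardZ _ _ _]/=; split; first exact: key.
have hi : internal e by case/andP: h1.
by rewrite -internal_disp // ef; apply: IH.
Qed.

Lemma res_small x : 0 <= x < n%:Z -> (res n0 x : nat) = absz x.
Proof. by move=> h; rewrite /= modz_small. Qed.

Fixpoint edges_at (x : int) (w : seq (kind * int)) : seq (edge N) :=
  if w is p :: w' then
    Edge p.1 (res n0 x : arc_of N) (res n0 (x + p.2)) :: edges_at (x + p.2) w'
  else [::].

Lemma edges_at_path e y w : etgt e = res n0 y -> path (@follows _ N) e (edges_at y w).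
Proof.
elim: w e y => //= p w IH e y he; apply/andP; split; first by rewrite /follows he.
exact: IH.
Qed.

Lemma edges_at_walk x w : walkZ F k x w -> is_walk k (edges_at x w).
Proof.
move=> hw; apply/andP; split; last by case: w {hw} => //= p w; exact: edges_at_path.
elim: w x hw => //= p w IH x [h1 h2]; rewrite IH // andbT.
by apply/(in_SP pN hF hk); exists x, (x + p.2).
Qed.

Lemma edges_at_forward x w : walkZ F k x w -> forwardZ F x w ->
  (absW w)%:Z <= x -> x + (absW w)%:Z < n%:Z ->
  all (@internal _ N) (edges_at x w) /\ all (@forward _ N) (edges_at x w).
Proof.
elim: w x => //= p w IH x [h1 h2] [[x0 h3] h4].
rewrite [absW _]big_cons -/(absW w) => l1 l2.
have [i1 i2] := IH (x + p.2) h2 h4 ltac:(lia) ltac:(lia).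
have r1 : res n0 x = absz x :> nat by apply: res_small; lia.
have r2 : res n0 (x + p.2) = absz (x + p.2) :> nat by apply: res_small; lia.
have rg := edge_disp_range hF hk h1.
have hi : internal (Edge p.1 (res n0 x : arc_of N) (res n0 (x + p.2))).
  rewrite /internal [ekind _]/= [esrc _]/= [etgt _]/= r1 r2.
  by move: rg; case: ifP => _; lia.
rewrite i1 i2 !andbT hi; split=> //; rewrite /forward hi /=; apply/negP => /and3P[hn _].
have [r hr] := is_row_ex hF x0.
rewrite [esrc _]/= [ekind _]/= in hn *; rewrite hn in rg.
rewrite (rightmost_res hN hF x0 _ hr); last by lia.
by move/eqP; apply: h3.
Qed.
End Forward.

Section Copies.
Variables (R : realFieldType) (M : model R).
Local Notation n := (narcs M).
Variable n0 : (0 < n)%N.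
Hypothesis pM : is_pca M.
Let hM : good n0 := pca_good n0 pM.
Local Notation F := (reach n0).
Hypothesis hF : is_lift n F.
Variable k : nat.
Hypothesis hk : forall i x, (i <= k)%N -> iter i F x < x + n%:Z.

Lemma steps_repeat g (W : seq (edge M)) : steps (repeat_walk g W) = flatten (nseq g (steps W)).
Proof. by rewrite /steps /repeat_walk map_flatten map_nseq. Qed.

Lemma cycle_repeat g e (V : seq (edge M)) f : path.cycle (@follows _ M) (e :: V) ->
  follows f e -> path (@follows _ M) f (repeat_walk g (e :: V)).
Proof.
rewrite /= rcons_path => /andP[h1 h2].
elim: g f => //= g IH f hf; rewrite hf cat_path h1 /=; exact: IH.
Qed.

Section Unrolled.
Variables (lam : nat) (lam0 : (0 < lam)%N).
Let U := unroll lam M.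
Variable u0 : (0 < narcs U)%N.

Lemma unroll_lift : is_lift (narcs U) (reach (N := U) u0).
Proof.
apply: (@is_lift_ext _ F); first by move=> x; rewrite (unroll_reach hM lam0).
case: hF => h1 h2 h3 h4; split=> // x.
  by have := lift_shiftZ hF x lam%:Z; rewrite /U /= PoszM.
by apply: lt_le_trans (h4 x) _; rewrite /U /=; nia.
Qed.

Lemma unroll_pca : is_pca U.
Proof. exact: good_pca (unroll_good hM lam0 u0). Qed.

Lemma unroll_iter i x : (i <= k)%N -> iter i (reach (N := U) u0) x < x + (narcs U)%:Z.
Proof.
move=> ik; rewrite (iter_ext (G := F)); last by move=> z; rewrite (unroll_reach hM lam0).
by apply: lt_le_trans (hk x ik) _; rewrite /U /=; nia.
Qed.

Lemma edges_at_copy e (W : seq (edge M)) x : path (@follows _ M) e W -> esrc e = res n0 x ->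
  all2 (@edge_copy R lam M) (edges_at (N := U) u0 x (steps (e :: W))) (e :: W).
Proof.
have key f y : esrc f = res n0 y ->
    edge_copy (Edge (ekind f) (res u0 y : arc_of U) (res u0 (y + disp f))) f.
  move=> ey; apply/and3P; split; first by [].
    by apply/eqP; rewrite ey; exact: (copied_arc_res hM).
  by apply/eqP; rewrite -(res_disp (esym ey)); exact: (copied_arc_res hM).
elim: W e x => [|f W IH] e x h ex; first by rewrite [all2 _ _ _]/= key.
have /andP[/eqP ef h1] := h.
have := IH f (x + disp e) h1; rewrite -ef (res_disp (esym ex)) => /(_ erefl) h2.
by apply/andP; split; [exact: key | exact: h2].
Qed.

(** A nose or hollow moves by at most one turn of M in its own direction, so its ends modulo n fix
    the displacement. The level is not transferred: a copy may be a nose of another index. *)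
Lemma copy_disp (e' : edge U) (e : edge M) : in_S k e' -> edge_copy e' e -> disp e' = disp e.
Proof.
move=> hS /and3P[/eqP e1 /eqP e2 /eqP e3].
have hU := in_S_edge unroll_pca unroll_lift unroll_iter hS (esym (res_ord u0 (esrc e'))).
have hE : edgeZ F k (ekind e') (esrc e')%:Z ((esrc e')%:Z + disp e').
  move: hU; rewrite /edgeZ; case: (ekind e') => [|i].
    by rewrite !(unroll_reach hM lam0).
  rewrite !(iter_ext _ _ (unroll_reach hM lam0 u0)) => -[ik t ey sh]; split=> //.
    by move=> j ji; have := t j ji; rewrite !(unroll_reach hM lam0) (iter_ext _ _ (unroll_reach hM lam0 u0)).
  move=> [lt h]; apply: sh; split=> //; case: h => [[z ez]|h]; [left; exists z | right];
    by rewrite !(unroll_reach hM lam0).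
have rg := edge_disp_range hF hk hE.
have ex : esrc e = res n0 (esrc e')%:Z by rewrite -e2 -{1}(res_ord u0 (esrc e')) (copied_arc_res hM).
have ey : etgt e = res n0 ((esrc e')%:Z + disp e').
  by rewrite -e3 -(res_disp (res_ord u0 (esrc e'))) (copied_arc_res hM).
apply: (addrI (esrc e')%:Z); apply: (disp_unique ex ey).
by move: rg; rewrite e1; case: ifP => _ //; lia.
Qed.

Lemma copy_dispW (W' : seq (edge U)) (W : seq (edge M)) : all (in_S k) W' ->
  all2 (@edge_copy R lam M) W' W -> dispW (steps W') = dispW (steps W).
Proof.
elim: W' W => [|e' W' IH] [|e W] //= /andP[h1 h2] /andP[h3 h4].
by rewrite !dispW_cons (IH W) //= (copy_disp h1 h3).
Qed.
End Unrolled.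
End Copies.

(** * Cycles of opposite signs and twisting bounds *)

Definition nosesW (w : seq (kind * int)) : nat := count (fun p => is_nose_kind p.1) w.

Section Graph.
Variables (R : realFieldType) (M : model R).
Local Notation n := (narcs M).
Variable n0 : (0 < n)%N.
Hypothesis pM : is_pca M.
Let hM : good n0 := pca_good n0 pM.
Local Notation F := (reach n0).
Hypothesis hF : is_lift n F.
Variable k : nat.
Hypothesis hk : forall i x, (i <= k)%N -> iter i F x < x + n%:Z.

Lemma unroll_reachE lam (lam0 : (0 < lam)%N) (u0 : (0 < narcs (unroll lam M))%N) :
  reach u0 = F.
Proof. apply: functional_extensionality => x; exact: (unroll_reach hM lam0). Qed.

Lemma cycleP (W : seq (edge M)) : is_cycle k W -> exists e V, W = e :: V /\
  [/\ all (in_S k) W, path.cycle (@follows _ M) W, path (@follows _ M) e V,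
      walkZ F k (esrc e)%:Z (steps W) & dispW (steps W) = - ext W * n%:Z].
Proof.
case/and3P=> /andP[h1 h2]; case: W h1 h2 => // e V h1 h2 _ _; exists e, V; split=> //.
have h3 : path (@follows _ M) e V by move: h2; rewrite /= rcons_path => /andP[].
split=> //; last exact: (disp_cycle n0 h2).
by apply: (walk_steps pM hF hk h1 h3); rewrite res_ord.
Qed.

Lemma forward_copy (W : seq (edge M)) (a p q g : nat) : is_cycle k W ->
  (0 < p)%N ->
  (forall r, (a <= r)%N -> row_end F (r + p) = row_end F r + q%:Z * n%:Z) ->
  p%:Z * - ext W = levW (steps W) * q%:Z -> ~ no_forward_copy k g W.
Proof.
move=> /cycleP[e [V [eW [h1 h2 h3 hw hD]]]] p0 hY slope.
have [N hN] := forward_repeat hF g p0 hY hw hD slope.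
pose w := flatten (nseq g (steps W)).
pose N' := (absz N + absW w)%N.
have [f1 f2] := hN N'%:Z ltac:(lia).
pose x := (esrc e)%:Z + N'%:Z * n%:Z.
(* Together with the choice of N', this leaves a margin of [absW w] on both sides of x, so that no
   edge of the copy passes the point 0. *)
pose lam := (g + N' + absW w).+2.
have u0 : (0 < narcs (unroll lam M))%N by rewrite /= muln_gt0 /= n0.
have lam0 : (0 < lam)%N by [].
have eF := unroll_reachE lam0 u0.
have x1 : (absW w)%:Z <= x by rewrite /x /N'; nia.
have x2 : x + (absW w)%:Z < (narcs (unroll lam M))%:Z.
  rewrite /x /= PoszM /lam; have := ltn_ord (esrc e); nia.
have pU := unroll_pca n0 pM lam0 u0.
have lU := unroll_lift pM hF lam0 u0.
have kU := unroll_iter pM hk lam0 u0.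
have [i1 i2] : all (@internal _ _) (edges_at (N := unroll lam M) u0 x w) /\
    all (@forward _ _) (edges_at (N := unroll lam M) u0 x w).
  by apply: (edges_at_forward pU lU (k := k)) => //; rewrite ?eF.
move=> nof; apply: (nof lam (edges_at (N := unroll lam M) u0 x w)) => //; first by rewrite /lam; lia.
apply/andP; split.
  by apply: (edges_at_walk pU lU kU); rewrite eF.
rewrite /w -steps_repeat; have ex : esrc e = res n0 x by rewrite /x res_shift res_ord.
have hp : path (@follows _ M) e (behead (repeat_walk g W)).
  case: (g) => // g'; rewrite eW /= cat_path h3 /=; apply: cycle_repeat; first by rewrite -eW.
  by move: h2; rewrite eW /= rcons_path => /andP[].
move: hp; rewrite eW; case: (g) => [|g'] //= hp.
exact: (edges_at_copy pM lam0).
Qed.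

Lemma disjoint_cycles (W W' : seq (edge M)) (g : nat) : is_cycle k W -> is_cycle k W' ->
  0 < ext W -> ext W' < 0 ->
  (forall A, A \in [seq esrc f | f <- W] -> A \notin [seq esrc f | f <- W']) ->
  ~ is_ctb M k g.
Proof.
move=> cW cW' pos neg dis.
have [e [V [eW [h1 h2 h3 hw hD]]]] := cycleP cW.
have [e' [V' [eW' [h1' h2' h3' hw' hD']]]] := cycleP cW'.
have nw : steps W <> [::] by rewrite eW.
have nw' : steps W' <> [::] by rewrite eW'.
have hP := pathW_path hF hw nw hD; have hQ := pathW_path hF hw' nw' hD'.
have vert f Z x D i : path (@follows _ M) f Z -> esrc f = res n0 x ->
    dispW (steps (f :: Z)) = D * n%:Z ->
    res n0 (pathW x (steps (f :: Z)) i).1 \in [seq esrc h | h <- f :: Z].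
  move=> hZ ex hDZ; rewrite /pathW [(_, _).1]/= hDZ mulrA addrAC res_shift.
  apply: steps_vertex => //; rewrite /steps size_map; exact: modz_ltn.
have disPQ i j : pathW (esrc e)%:Z (steps W) i <> pathW (esrc e')%:Z (steps W') j.
  move=> E; have hin : res n0 (pathW (esrc e)%:Z (steps W) i).1 \in [seq esrc h | h <- W].
    by move: hD; rewrite eW => hD; apply: vert hD; rewrite ?res_ord.
  have := dis _ hin; rewrite E => /negP; apply.
  by move: hD'; rewrite eW' => hD'; apply: vert hD'; rewrite ?res_ord.
have neg' : 0 < - ext W' by rewrite oppr_gt0.
have planar := disjoint_paths hF hP hQ disPQ pos neg'.
have [a [p [q [p0 q0 hY]]]] := row_end_periodic hF.
have lW : exists2 d : nat, levW (steps W) = - d.+1%:Z & p%:Z * ext W <= d.+1%:Z * q%:Z.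
  case: (walk_prec hF 0 hw nw) => [[d /= _ le]|[d /= el le]].
    have := iter_ge hF d (esrc e)%:Z; have := lift_pos hF; rewrite hD in le; nia.
  exists d; first by lia.
  by apply: (slope_le hF hY p0 q0 (x := (esrc e)%:Z)); rewrite hD mulNr in le.
have lW' : exists2 d : nat, levW (steps W') = d%:Z & d%:Z * q%:Z <= p%:Z * - ext W'.
  case: (walk_prec hF 0 hw' nw') => [[d /= el le]|[d /= el _]].
    exists d; first by lia.
    by apply: (slope_ge hF hY p0 q0 (x := (esrc e')%:Z)); rewrite hD' in le; exact: ltW.
  have [d' e1 _] := lW; exfalso; rewrite e1 in planar; nia.
have [d el le] := lW; have [d' el' le'] := lW'; rewrite el el' in planar.
have d0' : 0 < d'%:Z by nia.
(* The three nonnegative quantities t1, t2, t3 add up to 0. Hence both cycles have exactly the slope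
   of the rows, and a bound of either kind is refuted. *)
have t1 : 0 <= (d.+1%:Z * q%:Z - p%:Z * ext W) * d'%:Z by apply: mulr_ge0; lia.
have t2 : 0 <= (p%:Z * - ext W' - d'%:Z * q%:Z) * d.+1%:Z by apply: mulr_ge0; lia.
have t3 : 0 <= p%:Z * (- d.+1%:Z * - ext W' + d'%:Z * ext W) by apply: mulr_ge0; lia.
have e1 : (d.+1%:Z * q%:Z - p%:Z * ext W) * d'%:Z = 0 by lia.
have e2 : (p%:Z * - ext W' - d'%:Z * q%:Z) * d.+1%:Z = 0 by lia.
case=> ctb.
  apply: (forward_copy (W := W') (g := g) cW' p0 hY); last exact: ctb.
  by rewrite el'; move/eqP: e2; rewrite mulf_eq0 => /orP[/eqP|/eqP]; lia.
apply: (forward_copy (W := W) (g := g) cW p0 hY); last exact: ctb.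
by rewrite el; move/eqP: e1; rewrite mulf_eq0 => /orP[/eqP|/eqP]; lia.
Qed.

Lemma potential_walk c l s x w : potential n F k c l s -> walkZ F k x w ->
  s x + levW w * l%:Z + 2 * (nosesW w)%:Z <= s (x + dispW w).
Proof.
move=> [_ hs1 hs2]; elim: w x => [|p w IH] x.
  by rewrite /levW /dispW !big_nil /= mul0r !addr0.
move=> /= [h1 /IH h2]; rewrite dispW_cons levW_cons -/(nosesW w) addrA.
suff h3 : s x + level p.1 * l%:Z + 2 * (is_nose_kind p.1)%:Z <= s (x + p.2).
  by apply: le_trans h2; rewrite PoszD; lia.
case: (p.1) h1 => [|i] /=.
  by move=> [e _]; have := hs1 (x + p.2); rewrite e; lia.
by case=> ik _ -> _; have := hs2 i x ik; lia.
Qed.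

Lemma noses_disp x w : walkZ F k x w -> dispW w <= (nosesW w)%:Z * n%:Z.
Proof.
elim: w x => [|p w IH] x; first by rewrite /dispW /nosesW big_nil.
move=> /= [h1 /IH h]; rewrite dispW_cons -/(nosesW w).
by have := edge_disp_range hF hk h1; case: is_nose_kind; rewrite /=; lia.
Qed.

Lemma internal_dispW (N : model R) (m0 : (0 < narcs N)%N) (V : seq (edge N)) e : path (@follows _ N) e V ->
  all (@internal _ N) (e :: V) -> 0 <= (esrc e)%:Z + dispW (steps (e :: V)).
Proof.
elim: V e => [|f V IH] e.
  rewrite /= andbT => _ /(internal_disp m0) h.
  by rewrite /dispW big_seq1 [(_, _).2]/= -h.
move=> /andP[/eqP ef h] /andP[/(internal_disp m0) e1 /(IH _ h)].
rewrite -[steps (e :: f :: V)]/((ekind e, disp e) :: steps (f :: V)) dispW_cons addrA.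
by rewrite [(_, _).2]/= -e1 ef.
Qed.

(** A forward copy has the slope of the rows up to a bounded error, whereas s restricts slopes by c
    : l. Which of c * q and l * p is larger decides the kind of the bound. *)
Lemma potential_ctb c l s : potential n F k c l s -> exists g, is_ctb M k g.
Proof.
move=> pot; have [s_shift _ _] := pot; have n1 := lift_pos hF.
have [a [p [q [p0 q0 hY]]]] := row_end_periodic hF.
have [K hK] := row_bound hY p0 q0.
(* Each end of the copy deviates from the slope of the rows by at most |K|; after multiplication by
   l, g must outweigh both deviations. *)
pose g := (2 * absz K * l).+1.
have main (W : seq (edge M)) : is_cycle k W -> ~ no_forward_copy k g W ->
    exists x D y N, [/\ y = x - g%:Z * ext W * n%:Z,
      s x + D * l%:Z + 2 * N <= s y, 0 <= N, g%:Z * - ext W <= N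
      & p%:Z * (y - x) - 2 * (absz K)%:Z <= D * q%:Z * n%:Z].
  move=> cW nof; have [e [V [eW [h1 h2 h3 hw hD]]]] := cycleP cW.
  have [lam [W' [glam /andP[/andP[iS srt] cp] intW fwd]]] : exists lam W', [/\ (g <= lam)%N,
      is_copy k W' (repeat_walk g W), all (@internal R (unroll lam M)) W' & all (@forward R (unroll lam M)) W'].
    apply: NNPP => no; apply: nof => lam W' h4 h5 h6 h7; apply: no.
    by exists lam, W'.
  have lam0 : (0 < lam)%N by exact: leq_trans glam.
  have u0 : (0 < narcs (unroll lam M))%N by rewrite /= muln_gt0 lam0.
  have eF := unroll_reachE lam0 u0.
  have pU := unroll_pca n0 pM lam0 u0.
  have lU := unroll_lift pM hF lam0 u0.
  have kU := unroll_iter pM hk lam0 u0.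
  have dW := copy_dispW pM hF hk lam0 u0 iS cp.
  rewrite steps_repeat (dispW_repeat _ _) hD in dW.
  case: W' iS srt cp intW fwd dW => [|e' V'] iS srt cp intW fwd dW.
    by move: cp; rewrite eW.
  have fz := forward_forwardZ pU lU srt fwd; rewrite eF in fz.
  have wz := walk_steps pU lU kU iS srt (esym (res_ord u0 (esrc e'))); rewrite eF in wz.
  have y0 := internal_dispW u0 srt intW.
  have [r hr] : exists r, is_row F (esrc e')%:Z r by apply: (is_row_ex hF).
  have [r' hr' er] := forwardZ_row hF wz fz y0 hr.
  exists (esrc e')%:Z, (levW (steps (e' :: V'))), ((esrc e')%:Z + dispW (steps (e' :: V'))).
  exists (nosesW (steps (e' :: V')))%:Z; split.
  - by rewrite dW; lia.
  - exact: (potential_walk pot wz).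
  - by [].
  - have := noses_disp wz; rewrite dW => h4; nia.
  - have := hK _ _ hr; have := hK _ _ hr'; rewrite !ler_norml => /andP[k1 k2] /andP[k3 k4].
    have e1 : levW (steps (e' :: V')) = r'%:Z - r%:Z by rewrite er; lia.
    rewrite e1; lia.
have hg : g%:Z = 2 * (absz K)%:Z * l%:Z + 1 by rewrite /g; lia.
exists g; move: (absz K) hg main => B hg main; clearbody g; clear K hK.
have qn : 0 <= q%:Z * n%:Z - 1 by nia.
(* When c * q = l * p the ratios alone give no contradiction. It then comes from the slack of the
   noses: a copy of g repetitions with ext W < 0 has at least g of them, each advancing by at most
   one turn. *)
have [le|lt] := leP (c * q)%N (l * p)%N.
  left=> W cW neg; apply: NNPP => /(main W cW)[x [D [y [N [ey h1 N0 h2 h3]]]]].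
  have es : s y = s x + g%:Z * - ext W * c%:Z.
    by rewrite -s_shift ey; congr s; lia.
  have [E [eE E1]] : exists E, ext W = - E /\ 1 <= E by exists (- ext W); lia.
  rewrite es ey eE {es ey eE} in h1 h2 h3.
  have f1 : 0 <= l%:Z * (D * q%:Z * n%:Z - (p%:Z * (x - g%:Z * - E * n%:Z - x) - 2 * B%:Z)).
    by apply: mulr_ge0; lia.
  have f2 : 0 <= (g%:Z * - - E * c%:Z - (D * l%:Z + 2 * N)) * (q%:Z * n%:Z).
    by apply: mulr_ge0; lia.
  have f3 : 0 <= (l%:Z * p%:Z - c%:Z * q%:Z) * (g%:Z * E * n%:Z) by apply: mulr_ge0; nia.
  have f4 : 0 <= N * (q%:Z * n%:Z - 1) by apply: mulr_ge0; lia.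
  have f5 : 0 <= g%:Z * (E - 1) by apply: mulr_ge0; lia.
  clear h1 h3; lia.
right=> W cW pos; apply: NNPP => /(main W cW)[x [D [y [N [ey h1 N0 h2 h3]]]]].
have es : s x = s y + g%:Z * ext W * c%:Z.
  by rewrite -s_shift ey; congr s; lia.
move: (ext W) pos es ey h2 => E pos es ey h2; rewrite es ey {es ey h2} in h1 h3.
have f1 : 0 <= l%:Z * (D * q%:Z * n%:Z - (p%:Z * (x - g%:Z * E * n%:Z - x) - 2 * B%:Z)).
  by apply: mulr_ge0; lia.
have f2 : 0 <= (- (g%:Z * E * c%:Z) - D * l%:Z) * (q%:Z * n%:Z).
  by apply: mulr_ge0; lia.
have f3 : 0 <= (c%:Z * q%:Z - l%:Z * p%:Z - 1) * (g%:Z * E * n%:Z) by apply: mulr_ge0; nia.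
have f4 : 0 <= g%:Z * (E * n%:Z - 1) by apply: mulr_ge0; nia.
clear h1 h3; lia.
Qed.
End Graph.

(** * Potentials from crossing cycles *)

Lemma max_int (Q : int -> Prop) (B w : int) : Q w -> (forall x, Q x -> x <= B) ->
  exists2 m, Q m & forall x, Q x -> x <= m.
Proof.
move=> hw hB; have [N] := ubnP (absz (B - w)); elim: N w hw => // N IH w hw hN.
case: (classic (exists2 x, Q x & w < x)) => [[x hx wx]|no].
  by apply: (IH x hx); have := hB x hx; lia.
exists w => // x hx; rewrite leNgt; apply/negP => wx; apply: no; by exists x.
Qed.

Lemma best_ratio (Q : int * int -> Prop) (b0 : int * int) (L : seq (int * int)) :
  (forall x, Q x -> 0 < x.2) -> Q b0 ->
  exists2 b, Q b & b0.1 * b.2 <= b.1 * b0.2 /\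
    forall x, x \in L -> Q x -> x.1 * b.2 <= b.1 * x.2.
Proof.
move=> hQ h0; elim: L => [|y L [b hb [h1 h2]]]; first by exists b0.
have pb := hQ b hb; have p0 := hQ b0 h0.
case: (classic (Q y /\ b.1 * y.2 < y.1 * b.2)) => [[hy lt]|no].
  have py := hQ y hy.
  have tr (x : int * int) : 0 < x.2 -> x.1 * b.2 <= b.1 * x.2 -> x.1 * y.2 <= y.1 * x.2.
    move=> px le; have : b.2 * (x.1 * y.2) <= b.2 * (y.1 * x.2).
      have : 0 <= (b.1 * x.2 - x.1 * b.2) * y.2 by apply: mulr_ge0; lia.
      have : 0 <= (y.1 * b.2 - b.1 * y.2) * x.2 by apply: mulr_ge0; lia.
      lia.
    by rewrite ler_pM2l.
  exists y => //; split; first exact: tr.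
  move=> x; rewrite inE => /orP[/eqP -> //|xL] hx; apply: tr; [exact: hQ|exact: h2].
exists b => //; split=> // x; rewrite inE => /orP[/eqP ->|xL] hx; last exact: h2.
by rewrite leNgt; apply/negP => lt; apply: no.
Qed.

(* The ratio c : l is put just above the largest ratio forced by the pairs with
   e < 0; the pair (0, -1) keeps it positive. *)
Lemma separating_ratio (P : int -> int -> Prop) (B : nat) :
  (forall v e, P v e -> - B%:Z <= v <= B%:Z /\ - B%:Z <= e <= B%:Z) ->
  (forall v e, P v e -> 0 <= e -> 0 < v) ->
  (forall v e v' e', P v e -> P v' e' -> 0 < e -> e' < 0 -> 0 < v * - e' + v' * e) ->
  exists c l : nat, [/\ (0 < c)%N, (0 < l)%N &
    forall v e, P v e -> 1 <= l%:Z * v - c%:Z * e].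
Proof.
move=> hB h0 hs.
pose Q (x : int * int) := x = (0, 1) \/ 0 < x.2 /\ P (- x.1) (- x.2).
pose rg := [seq i%:Z - B%:Z | i <- iota 0 (2 * B).+1].
have [x|[mu ep] hb /= [b1 b2]] := @best_ratio Q (0, 1) [seq (a, b) | a <- rg, b <- rg] _ (or_introl erefl).
  by case=> [-> //|[]].
have ep0 : 0 < ep by case: hb => [[_ ->] //|[]].
have mu0 : 0 <= mu by lia.
(* This ratio exceeds mu : ep by just enough to gain - e >= 1 when e < 0. When e > 0, integrality
   gives v * ep - mu * e >= 1, and B + 1 times this pays for the loss of e <= B. *)
exists (absz (mu * (B.+1)%:Z + 1)), (absz (ep * (B.+1)%:Z)); split; [nia|nia|].
move=> v e hP; have [hv he] := hB v e hP.
have -> : (absz (mu * (B.+1)%:Z + 1))%:Z = mu * (B.+1)%:Z + 1 by nia.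
have -> : (absz (ep * (B.+1)%:Z))%:Z = ep * (B.+1)%:Z by nia.
have [e0|e0|e0] := ltgtP e 0.
- have mem z : - B%:Z <= z <= B%:Z -> z \in rg.
    move=> hz; apply/mapP; exists (absz (z + B%:Z)%R); rewrite ?mem_iota; lia.
  have H := b2 (- v, - e).
  have h : - v * ep <= mu * - e.
    apply: H; last by right; rewrite !opprK; split=> //=; lia.
    by apply: (allpairs_f (fun a b : int => (a, b)) (mem (- v) _) (mem (- e) _)); lia.
  have : 0 <= (mu * - e + v * ep) * (B.+1)%:Z by apply: mulr_ge0; lia.
  lia.
- have v0 := h0 v e hP (ltW e0).
  have h : 1 <= v * ep - mu * e.
    case: hb => [[-> ->]|[_ hP']]; first by lia.
    have := hs v e (- mu) (- ep) hP hP' e0; rewrite opprK oppr_lt0 => /(_ ep0); lia.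
  have : 0 <= (v * ep - mu * e - 1) * (B.+1)%:Z by apply: mulr_ge0; lia.
  lia.
- have := h0 v e hP; rewrite e0 => /(_ isT) v0; nia.
Qed.

Section LongestPath.
Variables (V : finType) (E : Type) (src tgt : E -> V) (valid : pred E) (wt : E -> int).
Variable b : nat.
Hypothesis wt_le : forall e, valid e -> wt e <= b%:Z.

(* Paths are listed backwards, from the last edge to the first. *)
Fixpoint back_path (v : V) (W : seq E) : bool :=
  if W is e :: W' then (tgt e == v) && back_path (src e) W' else true.

Hypothesis cycle_le0 : forall e W, all valid (e :: W) -> back_path (tgt e) (e :: W) ->
  src (last e W) = tgt e -> uniq (map src (e :: W)) -> \sum_(f <- e :: W) wt f <= 0.

Let simple v w := exists W, [/\ all valid W, back_path v W, uniq (v :: map src W)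
  & w = \sum_(f <- W) wt f].

(** The value at v is the largest weight of a simple path into v. If e closes a cycle with the best
    path into its source, dropping this cycle does not lower the weight. *)
Lemma longest_path : exists p : V -> int, forall e, valid e -> p (src e) + wt e <= p (tgt e).
Proof.
have ex v : exists m, simple v m /\ forall w, simple v w -> w <= m.
  have [|w [W [h1 _ h3 ->]]|m m1 m2] := @max_int (simple v) (#|V| * b)%N%:Z 0.
  - by exists [::]; rewrite big_nil.
  - have sz : (size W <= #|V|)%N.
      by have := max_card (mem (v :: map src W)); rewrite (card_uniqP h3) /= size_map; lia.
    have : \sum_(f <- W) wt f <= (size W * b)%N%:Z.
      elim: W h1 {h3 sz} => [|f W IH] /=; first by rewrite big_nil.
      by case/andP=> /wt_le h /IH h'; rewrite big_cons mulSn PoszD lerD.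
    by move/le_trans; apply; rewrite lez_nat leq_mul2r sz orbT.
  - by exists m.
have [p hp] := fin_all_exists ex; exists p => e ve.
have [[W [h1 h2 h3 ->]] _] := hp (src e); have [_ hmax] := hp (tgt e).
have [inW|notin] := boolP (tgt e \in src e :: map src W); last first.
  apply: hmax; exists (e :: W); split; rewrite ?big_cons 1?addrC //=.
  - by rewrite ve.
  - by rewrite eqxx.
  - by rewrite notin.
have split_at v U : v \in src e :: map src U -> back_path (src e) U ->
    exists U1 U2, [/\ U = U1 ++ U2, back_path v U2 & src (last e U1) = v].
  move: (e) => f; elim: U f => [|g U IH] f /=.
    by rewrite inE => /eqP -> _; exists [::], [::].
  rewrite inE => /orP[/eqP ->|hv] /andP[/eqP hg hU]; first by exists [::], (g :: U); rewrite /= hg eqxx.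
  have [U1 [U2 [-> h4 h5]]] := IH g hv hU.
  by exists (g :: U1), U2.
have [W1 [W2 [eW hW2 hlast]]] := split_at _ _ inW h2.
have cyc : \sum_(f <- e :: W1) wt f <= 0.
  apply: cycle_le0 => //.
  - by move: h1; rewrite eW all_cat /= ve => /andP[->].
  - rewrite /= eqxx /=; move: h2; rewrite eW; elim: (W1) (src e) => //= f W' IH v.
    by case/andP=> -> /IH.
  - by move: h3; rewrite eW /= map_cat mem_cat negb_or cat_uniq => /andP[/andP[-> _] /andP[]].
have le2 : \sum_(f <- W2) wt f <= p (tgt e).
  apply: hmax; exists W2; split=> //.
    by move: h1; rewrite eW all_cat => /andP[].
  rewrite /=; have u3 : uniq (map src (e :: W1) ++ map src W2).
    by rewrite -map_cat /= -eW.
  move: u3; rewrite cat_uniq => /and3P[_ /hasPn hd ->]; rewrite andbT.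
  apply/negP => /hd /negP; apply; rewrite -hlast -last_map; exact: mem_last.
rewrite big_cons in cyc; rewrite addrC eW big_cat /= addrA; apply: le_trans le2.
by rewrite gerDr.
Qed.
End LongestPath.

Lemma map_split (T : Type) (S : eqType) (f : T -> S) a (s : seq T) : a \in map f s ->
  exists s1 x s2, s = s1 ++ x :: s2 /\ f x = a.
Proof.
elim: s => //= y s IH; rewrite inE => /orP[/eqP ->|/IH[s1 [x [s2 [-> h]]]]].
  by exists [::], y, s.
by exists (y :: s1), x, s2.
Qed.

Section Cycles.
Variables (R : realFieldType) (M : model R).
Local Notation n := (narcs M).
Variable n0 : (0 < n)%N.
Hypothesis pM : is_pca M.
Let hM : good n0 := pca_good n0 pM.
Local Notation F := (reach n0).
Hypothesis hF : is_lift n F.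
Variable k : nat.
Hypothesis hk : forall i x, (i <= k)%N -> iter i F x < x + n%:Z.

Lemma cycle_at (W : seq (edge M)) A : is_cycle k W -> A \in [seq esrc e | e <- W] ->
  exists w, [/\ w <> [::], walkZ F k A%:Z w, dispW w = - ext W * n%:Z
    & levW w = levW (steps W)].
Proof.
move=> /andP[/andP[hS hc] _] /map_split[W1 [e [W2 [eW eA]]]].
have hc' : path.cycle (@follows _ M) (e :: W2 ++ W1).
  by rewrite -cat_cons -[_ ++ W1]rot_size_cat rot_cycle -eW.
exists (steps (e :: W2 ++ W1)); split=> //.
- apply: (walk_steps pM hF hk); last by rewrite eA res_ord.
    by move: hS; rewrite eW !all_cat /= all_cat andbC andbA.
  by move: hc'; rewrite /= rcons_path => /andP[].
- by rewrite -(disp_cycle n0 hc) -cat_cons eW /steps !map_cat !dispW_cat addrC.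
- by rewrite -cat_cons eW /steps !map_cat !levW_cat addrC.
Qed.

(** Walks rise in the strict order of places, so a level d >= 0 would give iter d F x < x + dispW w
    <= x. *)
Lemma closed_lev x w : walkZ F k x w -> w <> [::] -> dispW w <= 0 -> levW w < 0.
Proof.
move=> hw nw d0; case: (walk_prec hF 0 hw nw) => [[d /= e le]|[d /= e _]]; last by lia.
have := iter_ge hF d x; lia.
Qed.

Lemma cycle_lev (W : seq (edge M)) : is_cycle k W -> 0 <= ext W -> 0 < - levW (steps W).
Proof.
move=> cW ext0; have [e [V [eW _]]] := cycleP pM hF hk cW.
have [|w [nw hw hd <-]] := cycle_at cW (A := esrc e); first by rewrite eW mem_head.
by have := closed_lev hw nw; rewrite hd; nia.
Qed.

Lemma crossing_cycles (W W' : seq (edge M)) A : is_cycle k W -> is_cycle k W' ->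
  A \in [seq esrc e | e <- W] -> A \in [seq esrc e | e <- W'] ->
  0 < ext W -> ext W' < 0 ->
  0 < - levW (steps W) * - ext W' + - levW (steps W') * ext W.
Proof.
move=> cW cW' AW AW' pos neg.
have [w [nw hw dw <-]] := cycle_at cW AW; have [w' [_ hw' dw' <-]] := cycle_at cW' AW'.
move: (ext W) (ext W') pos neg dw dw' => E E' pos neg dw dw'.
(* These multiplicities make the turns of the two cycles cancel, which leaves a closed walk in the
   cover. *)
pose v := flatten (nseq (absz E') w) ++ flatten (nseq (absz E) w').
have hv : walkZ F k A%:Z v.
  rewrite walk_cat dispW_repeat dw mulrA; split; first exact: walk_repeat dw.
  by apply: walk_shift => //; exact: walk_repeat dw'.
have nv : v <> [::].
  have : (0 < absz E')%N by lia.
  rewrite /v; case: (absz E') => // m _; case: (w) nw => //.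
have := closed_lev hv nv; rewrite dispW_cat levW_cat !dispW_repeat !levW_repeat dw dw'.
have -> : (absz E')%:Z = - E' by lia.
have -> : (absz E)%:Z = E by lia.
by move=> h; have := h ltac:(lia); lia.
Qed.

Definition turns (e : edge M) : int :=
  if internal e then 0 else if is_nose_kind (ekind e) then 1 else -1.

Lemma sum_turns (W : seq (edge M)) : \sum_(e <- W) turns e = - ext W.
Proof.
elim: W => [|e W IH]; first by rewrite big_nil /ext.
by rewrite big_cons IH /ext /= /turns; case: internal; case: is_nose_kind; rewrite /=; lia.
Qed.

Lemma sum_noses (W : seq (edge M)) :
  \sum_(e <- W) (is_nose_kind (ekind e) : nat)%:Z = (nosesW (steps W))%:Z.
Proof.
rewrite /nosesW /steps; elim: W => [|e W IH]; first by rewrite big_nil.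
by rewrite big_cons IH /= PoszD.
Qed.

Lemma level_bound (a : kind) x y : (0 < k)%N -> edgeZ F k a x y -> - k%:Z <= level a <= k%:Z.
Proof. by case: a => [|i] /= k0; [lia|case; lia]. Qed.

Lemma cycle_bounds (W : seq (edge M)) : (0 < k)%N -> is_cycle k W ->
  [/\ - (n * k)%N%:Z <= - levW (steps W) <= (n * k)%N%:Z, - (n * k)%N%:Z <= ext W <= (n * k)%N%:Z
    & (nosesW (steps W) <= n)%N].
Proof.
move=> k1 /and3P[/andP[hS _] _ un].
have sz : (size W <= n)%N.
  by have := max_card (mem [seq esrc e | e <- W]); rewrite card_ord (card_uniqP un) size_map.
split.
- have : - (size W * k)%N%:Z <= - levW (steps W) <= (size W * k)%N%:Z.
    rewrite /levW /steps; elim: W hS {un sz} => [|e W IH]; first by rewrite big_nil.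
    case/andP=> he hW; rewrite /= big_cons /=; have := IH hW.
    have [x [y [_ _ /(level_bound k1)]]] := (in_SP pM hF hk e).1 he.
    by rewrite mulSn PoszD; move: (\sum_(_ <- _) _) (size W * k)%N (level _) => S m u; lia.
  have : (size W * k <= n * k)%N by rewrite leq_mul2r sz orbT.
  lia.
- have := count_size (fun e => ~~ is_nose_kind (ekind e) && ~~ internal e) W.
  have := count_size (fun e => is_nose_kind (ekind e) && ~~ internal e) W.
  by rewrite /ext; nia.
- by apply: leq_trans (count_size _ _) _; rewrite size_map.
Qed.

Lemma crossing_potential : (0 < k)%N ->
  (forall W W' : seq (edge M), is_cycle k W -> is_cycle k W' -> ext W * ext W' < 0 ->
     exists2 A : arc_of M, A \in [seq esrc e | e <- W] & A \in [seq esrc e | e <- W']) ->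
  exists c l s, potential n F k c l s.
Proof.
move=> k1 hcross.
pose P v e := exists2 W : seq (edge M), is_cycle k W & v = - levW (steps W) /\ e = ext W.
have [| | |c0 [l0 [c00 l00 hcl]]] := @separating_ratio P (n * k)%N.
- by move=> v e [W cW [-> ->]]; case: (cycle_bounds k1 cW).
- by move=> v e [W cW [-> ->]]; exact: cycle_lev.
- move=> v e v' e' [W cW [-> ->]] [W' cW' [-> ->]] pos neg.
  have [|A hA hA'] := hcross W W' cW cW'; first by nia.
  exact: crossing_cycles hA hA' pos neg.
(* The factor 2 * n turns the slack 1 of a cycle into 2 for each of its noses, of which there are at
   most n. *)
pose c := (2 * n * c0)%N; pose l := (2 * n * l0)%N.
pose wt (e : edge M) := level (ekind e) * l%:Z + 2 * (is_nose_kind (ekind e) : nat)%:Z - c%:Z * turns e.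
have sum_wt (W : seq (edge M)) : \sum_(e <- W) wt e =
    levW (steps W) * l%:Z + 2 * (nosesW (steps W))%:Z + c%:Z * ext W.
  rewrite -[ext W]opprK -sum_turns -sum_noses /levW big_map.
  elim: W => [|e W IH]; first by rewrite !big_nil; lia.
  by rewrite !big_cons IH /wt /=; lia.
have [||p hp] := @longest_path 'I_n (edge M) (@esrc _ M) (@etgt _ M) (in_S k) wt (k * l + 2 + c)%N.
- move=> e /(in_SP pM hF hk e).1 [x [y [_ _ /(level_bound k1) h]]].
  have h1 : level (ekind e) * l%:Z <= k%:Z * l%:Z by apply: ler_wpM2r; lia.
  have h2 : - (c%:Z * turns e) <= c%:Z.
    by rewrite /turns; case: internal; [|case: is_nose_kind]; lia.
  by rewrite /wt; case: is_nose_kind; lia.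
- move=> e V hS hp0 hl hu.
  have cyc : is_cycle k (rev (e :: V)).
    rewrite /is_cycle /is_circuit all_rev hS size_rev map_rev rev_uniq hu /= andbT rev_cycle.
    rewrite /= rcons_path; apply/andP; split; last by rewrite /follows hl.
    move: hp0; rewrite /= eqxx /=; elim: (V) (e) => //= f V' IH g /andP[h1 h2].
    by rewrite /follows h1; exact: IH.
  have <- : \sum_(f <- rev (e :: V)) wt f = \sum_(f <- e :: V) wt f.
    exact: big_rev.
  have [_ _ hno] := cycle_bounds k1 cyc.
  rewrite sum_wt; have := hcl _ _ (ex_intro2 (is_cycle k) _ _ cyc (conj erefl erefl)).
  move: (levW _) (ext _) (nosesW _) hno => v E m hno h.
  have : 0 <= (l0%:Z * - v - c0%:Z * E - 1) * n%:Z by apply: mulr_ge0; lia.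
  by rewrite /l /c; lia.
exists c, l, (fun x => p (res n0 x) + (x %/ n%:Z)%Z * c%:Z).
have s_shift x q : p (res n0 (x + q * n%:Z)) + ((x + q * n%:Z) %/ n%:Z)%Z * c%:Z =
    p (res n0 x) + (x %/ n%:Z)%Z * c%:Z + q * c%:Z.
  by rewrite res_shift (addrC x) divzMDl; lia.
have s_edge a x y : edgeZ F k a x y ->
    p (res n0 x) + (x %/ n%:Z)%Z * c%:Z + level a * l%:Z + 2 * (is_nose_kind a)%:Z
      <= p (res n0 y) + (y %/ n%:Z)%Z * c%:Z.
  move=> h; pose e : edge M := @Edge R M a (res n0 x) (res n0 y).
  have he : in_S k e by apply/(in_SP pM hF hk); exists x, y.
  have := hp e he; rewrite /wt /=.
  have ey : y = x + disp e.
    apply: (disp_unique (n0 := n0)) => //=; have := edge_disp_range hF hk h.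
    by case: is_nose_kind; lia.
  have : (y %/ n%:Z)%Z = (x %/ n%:Z)%Z + turns e.
    have ex := resE n0 x; have ey' := resE n0 y; rewrite /disp /= in ey.
    have nz : n%:Z != 0 by lia.
    apply: (mulIf nz); move: ey; rewrite {1}ex {1}ey' /turns /=.
    move: (absz _) (absz _) (x %/ _)%Z (y %/ _)%Z => u v p1 p2.
    by case: internal => /=; [|case: is_nose_kind => /=]; lia.
  by move=> -> ; lia.
split=> //; first exact: (all_hollows hF s_shift s_edge).
exact: (all_noses hF s_shift s_edge).
Qed.
End Cycles.

(** An arc that covers the ending point of x ends after it, hence has a larger index, and begins
    before it, hence is within reach of x. *)
Lemma covers_lt_reach (R : realFieldType) (M : model R) (n0 : (0 < narcs M)%N) :
  good n0 -> covers M -> forall x, x < reach n0 x.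
Proof.
move=> hM cov x.
rewrite ltNge; apply/negP => le.
have /andP[f0 fc] : 0 <= fin (res n0 x) < clen M by exact: (good_range hM (false, res n0 x)).
have [A hA] := cov (fin (res n0 x)) ltac:(lra).
have [b hb] := posT_fin n0 x.
have [a ha] : exists a : int, beg A + cw (clen M) (beg A) (fin (res n0 x)) = fin (res n0 x) + a%:~R * clen M.
  by rewrite /cw; case: leP => _; [exists 0|exists 1]; ring.
pose y : int := A%:Z + (b - a) * (narcs M)%:Z.
have ry : res n0 y = A by rewrite res_shift res_ord.
have ey : posS n0 y = beg A + (b - a)%:~R * clen M.
  rewrite /posS ry /y (addrC A%:Z) divzMDl; last by lia.
  by rewrite divz_small ?addr0 //; have := ltn_ord A; lia.
move: hA; rewrite /inA /in_arc => /andP[d0 d1].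
have h1 : posS n0 y < posT n0 x by rewrite hb ey rmorphB /=; lra.
have h2 : posT n0 x < posT n0 y by rewrite /(posT n0 y) ry hb ey rmorphB /=; lra.
rewrite (reach_leE hM) in h1; rewrite (posT_ltE hM) in h2; lia.
Qed.

Theorem theorem8 (R : realFieldType) (M : model R) (k w : nat)
    (hM : is_spca M) (hw : is_omega M w) (hk : (1 <= k < w)%N) :
  ((exists U : model R, equivalent M U /\ k_multiplicative k U)
     <-> (exists g : nat, is_ctb M k g)) /\
  ((exists g : nat, is_ctb M k g)
     <-> (forall W W' : seq (edge M),
            is_cycle k W -> is_cycle k W' -> ext W * ext W' < 0 ->
            exists2 A : arc_of M,
              A \in [seq esrc e | e <- W] & A \in [seq esrc e | e <- W'])).
Proof.
have [pM cov np] := hM; have [k1 kw] := andP hk.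
have n0 : (0 < narcs M)%N.
  by rewrite lt0n; apply/eqP => e; apply: np => A; exfalso; have := ltn_ord A; lia.
have gM := pca_good n0 pM.
have hF : is_lift (narcs M) (reach n0).
  apply: (reach_lift gM); apply: (covers_lt_reach gM).
  by apply: NNPP => /cov.
have hi i x : (i <= k)%N -> iter i (reach n0) x < x + (narcs M)%:Z.
  by move=> ik; apply: (omega_iter pM hF x np hw); apply: leq_ltn_trans ik kw.
have h12 : (exists U : model R, equivalent M U /\ k_multiplicative k U) ->
    exists g : nat, is_ctb M k g.
  by case/(model_potential gM hF k1 hi)=> c [l [s /(potential_ctb pM hF hi)]].
have h23 : (exists g : nat, is_ctb M k g) -> forall W W' : seq (edge M),
    is_cycle k W -> is_cycle k W' -> ext W * ext W' < 0 ->
    exists2 A : arc_of M, A \in [seq esrc e | e <- W] & A \in [seq esrc e | e <- W'].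
  move=> [g hg] W W' cW cW' neg; apply: NNPP => no.
  have [pos|pos] : (0 < ext W /\ ext W' < 0) \/ (0 < ext W' /\ ext W < 0) by move: neg; rewrite mulr_lt0; lia.
    apply: (disjoint_cycles pM hF hi cW cW' pos.1 pos.2 _ hg) => A h.
    by apply/negP => h'; apply: no; exists A.
  apply: (disjoint_cycles pM hF hi cW' cW pos.1 pos.2 _ hg) => A h.
  by apply/negP => h'; apply: no; exists A.
have h31 : (forall W W' : seq (edge M),
      is_cycle k W -> is_cycle k W' -> ext W * ext W' < 0 ->
      exists2 A : arc_of M, A \in [seq esrc e | e <- W] & A \in [seq esrc e | e <- W']) ->
    exists U : model R, equivalent M U /\ k_multiplicative k U.
  by move=> /(crossing_potential pM hF hi k1)[c [l [s /(potential_model gM hF k1 hi)]]].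
by split; split; auto.
Qed.
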